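(* Let $\mathcal{M}$ be a Type $\mathcal{A}$ model. 1. Suppose $\mathcal{M}$ is flat. Then $\mathcal{M}$ is geodesically complete if and only if $\mathcal{M}$ is linearly equivalent to $\mathcal{M}_0^0$ or to $\mathcal{M}_4^0$. 2. Suppose the Ricci tensor of $\mathcal{M}$ has rank $1$. Then $\mathcal{M}$ is geodesically complete if and only if $\mathcal{M}$ is linearly equivalent to $\mathcal{M}_3^1(-\frac12)$. If $\mathcal{M}$ is linearly equivalent to $\mathcal{M}_5^1(0)$, then $\mathcal{M}$ is geodesically incomplete but has the geodesic completion $\mathcal{N}$. If $\mathcal{M}$ is linearly equivalent to $\mathcal{M}_2^1(-\frac12)$, then $\mathcal{M}$ is geodesically incomplete but has the geodesic completion $\mathcal{M}_3^1(-\frac12)$. Otherwise (i.e. if $\mathcal{M}$ is not linearly equivalent to $\mathcal{M}_3^1(-\frac12)$, $\mathcal{M}_5^1(0)$ or $\mathcal{M}_2^1(-\frac12)$), $\mathcal{M}$ is essentially geodesically incomplete. 3. Suppose the Ricci tensor of $\mathcal{M}$ has rank $2$. If $\mathcal{M}$ is linearly equivalent to $\mathcal{M}_2^2(-1,b_2)$ for some $b_2\in\mathbb{R}$, then $\mathcal{M}$ is geodesically complete. Otherwise $\mathcal{M}$ is essentially geodesically incomplete.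
   Context: An affine surface is a pair $(M,\nabla)$ with $M$ a smooth surface and $\nabla$ a torsion free connection on $TM$; a map between affine surfaces is affine if it intertwines the connections. A Type $\mathcal{A}$ model is a pair $(\mathbb{R}^2,\nabla)$ with $\nabla$ torsion free and with Christoffel symbols $\Gamma_{ij}{}^k=\Gamma_{ji}{}^k$ (where $\nabla_{\partial_{x^i}}\partial_{x^j}=\Gamma_{ij}{}^k\partial_{x^k}$) constant in the standard coordinates. Write $\mathcal{M}(a,b,c,d,e,f)$ for the Type $\mathcal{A}$ model with $\Gamma_{11}{}^1=a$, $\Gamma_{11}{}^2=b$, $\Gamma_{12}{}^1=\Gamma_{21}{}^1=c$, $\Gamma_{12}{}^2=\Gamma_{21}{}^2=d$, $\Gamma_{22}{}^1=e$, $\Gamma_{22}{}^2=f$. Two Type $\mathcal{A}$ models are linearly equivalent if some element of $\operatorname{Gl}(2,\mathbb{R})$, acting as a linear change of variables on $\mathbb{R}^2$, intertwines the two connections. Curvature $R(\xi_1,\xi_2)=\nabla_{\xi_1}\nabla_{\xi_2}-\nabla_{\xi_2}\nabla_{\xi_1}-\nabla_{[\xi_1,\xi_2]}$; Ricci tensor $\rho(\xi_1,\xi_2)=\operatorname{Tr}\{\xi_3\mapsto R(\xi_3,\xi_1)\xi_2\}$, which is symmetric with constant coefficients for Type $\mathcal{A}$ models. Flat means $R=0$. The models used are $\mathcal{M}_0^0=\mathcal{M}(0,0,0,0,0,0)$, $\mathcal{M}_4^0=\mathcal{M}(0,0,0,0,1,0)$, $\mathcal{M}_3^1(-\frac12)=\mathcal{M}(0,0,-\frac12,0,0,0)$,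 $\mathcal{M}_2^1(-\frac12)=\mathcal{M}(-1,0,-\frac12,0,0,0)$, $\mathcal{M}_5^1(0)=\mathcal{M}(1,0,0,0,1,0)$, $\mathcal{M}_2^2(-1,b_2)=\mathcal{M}\left(0,0,b_2,1,-\frac{1+b_2^2}{2},0\right)$. Also $\mathcal{N}=(\mathbb{R}^2,\nabla)$ is the (not Type $\mathcal{A}$ in these coordinates) affine surface whose only non-zero Christoffel symbol is $\Gamma_{22}{}^1=x^1$. A geodesic is a curve $\sigma$ with $\nabla_{\dot\sigma}\dot\sigma=0$, i.e. $\ddot\sigma^i+\Gamma_{jk}{}^i\dot\sigma^j\dot\sigma^k=0$. An affine surface is geodesically complete if every geodesic extends to a geodesic defined for all $t\in\mathbb{R}$, and geodesically incomplete otherwise. A Type $\mathcal{A}$ model $\mathcal{M}$ can be geodesically completed if there is an affine embedding of $\mathcal{M}$ in a homogeneous (the affine diffeomorphisms act transitively) geodesically complete affine surface; such a surface is called a geodesic completion of $\mathcal{M}$. Otherwise $\mathcal{M}$ is said to be essentially geodesically incomplete. *)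

(* Defs.v *)
From HB Require Import structures.
From mathcomp Require Import all_boot all_order all_algebra.
From mathcomp Require Import all_classical all_reals all_analysis.

Set Implicit Arguments.
Unset Strict Implicit.
Unset Printing Implicit Defensive.

Import Order.TTheory GRing.Theory Num.Theory.
Import numFieldNormedType.Exports.
Local Open Scope classical_set_scope.
Local Open Scope ring_scope.

(* The coordinates x^1, x^2 of a point x : 'rV_2 are x 0 0 and x 0 1; tensor
   indices 1, 2 are accordingly 0, 1 : 'I_2. *)

Section Calculus.
Variable R : realType.

Definition component (F : 'rV[R]_2 -> 'rV[R]_2) (k : 'I_2) : 'rV[R]_2 -> R :=
  fun x => F x 0 k.

Definition partial (i : 'I_2) (f : 'rV[R]_2 -> R) : 'rV[R]_2 -> R :=
  fun x => 'D_(delta_mx 0 i) f x.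

Fixpoint Ck (n : nat) (U : set 'rV[R]_2) (f : 'rV[R]_2 -> R) : Prop :=
  (forall x, U x -> {for x, continuous f}) /\
  if n is m.+1 then
    forall i : 'I_2, (forall x, U x -> derivable f x (delta_mx 0 i)) /\
                     Ck m U (partial i f)
  else True.

(* Meaningful for open U only. *)
Definition smooth (U : set 'rV[R]_2) (f : 'rV[R]_2 -> R) : Prop :=
  forall n, Ck n U f.

Definition smooth_map (U : set 'rV[R]_2) (F : 'rV[R]_2 -> 'rV[R]_2) : Prop :=
  forall k, smooth U (component F k).

Definition jacobian_mx (F : 'rV[R]_2 -> 'rV[R]_2) (x : 'rV[R]_2) : 'M[R]_2 :=
  \matrix_(i, k) partial i (component F k) x.

(* G i j k x is the value at x of the Christoffel symbol \Gamma_{ij}^k. *)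
Definition christoffel := 'I_2 -> 'I_2 -> 'I_2 -> 'rV[R]_2 -> R.

(* dF (\nabla_{\partial_i} \partial_j) = \nabla'_{dF \partial_i} dF \partial_j
   (covariant derivative along F), written in coordinates. *)
Definition intertwines (U : set 'rV[R]_2) (G G' : christoffel)
    (F : 'rV[R]_2 -> 'rV[R]_2) : Prop :=
  forall x, U x -> forall i j k : 'I_2,
    \sum_l G i j l x * partial l (component F k) x =
    partial i (partial j (component F k)) x +
    \sum_p \sum_q G' p q k (F x) *
      partial i (component F p) x * partial j (component F q) x.

End Calculus.

(* A connection on TM is given by its Christoffel symbols in the charts of an
   atlas; they obey the transformation law expressing that the transition maps
   intertwine them. Surfaces need not be connected. *)
Record affine_surface (R : realType) := AffineSurface {
  points :> topologicalType;
  surface_hausdorff : hausdorff_space points;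
  surface_second_countable : @second_countable points;
  atlas : Type;
  dom : atlas -> set points;
  chart : atlas -> points -> 'rV[R]_2;
  chart_inv : atlas -> 'rV[R]_2 -> points;
  gamma : atlas -> christoffel R;
  dom_open : forall i, open (dom i);
  dom_cover : forall p, exists i, dom i p;
  chart_open : forall i, open (chart i @` dom i);
  chartK : forall i p, dom i p -> chart_inv i (chart i p) = p;
  chart_continuous : forall i p, dom i p -> {for p, continuous (chart i)};
  chart_inv_continuous : forall i x, (chart i @` dom i) x ->
    {for x, continuous (chart_inv i)};
  transition_smooth : forall i j,
    smooth_map (chart i @` (dom i `&` dom j)) (chart j \o chart_inv i);
  gamma_sym : forall i a b k x, (chart i @` dom i) x ->
    gamma i a b k x = gamma i b a k x;
  gamma_smooth : forall i a b k, smooth (chart i @` dom i) (gamma i a b k);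
  gamma_transition : forall i j,
    intertwines (chart i @` (dom i `&` dom j)) (gamma i) (gamma j)
      (chart j \o chart_inv i)
}.

Section AffineSurfaces.
Variable R : realType.
Implicit Types S T : affine_surface R.

Definition local_dom S T (F : S -> T) (i : atlas S) (j : atlas T) :
    set 'rV[R]_2 :=
  chart i @` (dom i `&` F @^-1` dom j).

Definition local_expr S T (F : S -> T) (i : atlas S) (j : atlas T) :
    'rV[R]_2 -> 'rV[R]_2 :=
  chart j \o F \o chart_inv i.

Definition affine_map S T (F : S -> T) : Prop :=
  continuous F /\
  forall i j, smooth_map (local_dom F i j) (local_expr F i j) /\
    intertwines (local_dom F i j) (gamma i) (gamma j) (local_expr F i j).

Definition immersion S T (F : S -> T) : Prop :=
  forall i j x, local_dom F i j x ->
    jacobian_mx (local_expr F i j) x \in unitmx.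

Definition homeo_onto_image S T (F : S -> T) : Prop :=
  [/\ injective F, continuous F &
      forall U : set S, open U ->
        exists2 V : set T, open V & F @` U = V `&` range F].

Definition affine_embedding S T (F : S -> T) : Prop :=
  [/\ affine_map F, immersion F & homeo_onto_image F].

Definition affine_diffeomorphism S (F : S -> S) : Prop :=
  exists F' : S -> S,
    [/\ cancel F F', cancel F' F, affine_map F & affine_map F'].

Definition homogeneous S : Prop :=
  forall p q : S, exists2 F : S -> S, affine_diffeomorphism F & F p = q.

(* J is meant to be an open interval; only s restricted to J matters. *)
Definition geodesic_on S (J : set R) (s : R -> S) : Prop :=
  (forall t, J t -> {for t, continuous s}) /\
  forall (i : atlas S) t, J t -> dom i (s t) ->
    let x k := fun u : R => chart i (s u) 0 k in
    forall k : 'I_2,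
      [/\ derivable (x k) t 1, derivable (derive1 (x k)) t 1 &
          derive1 (derive1 (x k)) t +
          \sum_a \sum_b gamma i a b k (chart i (s t)) *
            derive1 (x a) t * derive1 (x b) t = 0].

Definition geodesically_complete S : Prop :=
  forall (J : set R) (s : R -> S),
    open J -> is_interval J -> J !=set0 -> geodesic_on J s ->
    exists2 s' : R -> S, geodesic_on setT s' & forall t, J t -> s' t = s t.

Definition geodesic_completion S T : Prop :=
  [/\ homogeneous T, geodesically_complete T &
      exists F : S -> T, affine_embedding F].

Definition essentially_incomplete S : Prop :=
  ~ exists T : affine_surface R, geodesic_completion S T.

End AffineSurfaces.

Record plane_connection (R : realType) := PlaneConnection {
  Gam : christoffel R;
  Gam_sym : forall i j k x, Gam i j k x = Gam j i k x;
  Gam_smooth : forall i j k, smooth setT (Gam i j k)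
}.

Section PlaneLemmas.
Variable R : realType.

Lemma plane_second_countable : @second_countable 'rV[R]_2.
Proof.
pose b (qn : 'rV[rat]_2 * nat) : set 'rV[R]_2 :=
  ball (map_mx ratr qn.1 : 'rV[R]_2) qn.2.+1%:R^-1.
exists (range b); first exact: card_le_trans (card_image_le _ _) (countableP _).
split=> [_ [qn _ <-]|x A /nbhs_ballP[e e0 xeA]]; first exact: ball_open.
have e20 : 0 < e / 2 by rewrite divr_gt0.
have [n _ /(_ n (leqnn n))/= ne] := near_infty_natSinv_lt (PosNum e20).
have n0 : 0 < n.+1%:R^-1 :> R by rewrite invr_gt0.
have xq k : {q : rat | `|ratr q - x 0 k| < n.+1%:R^-1}.
  apply: cid.
  have /rat_in_itvoo[q] : x 0 k < x 0 k + n.+1%:R^-1 by rewrite ltrDl.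
  rewrite in_itv/= => /andP[q1 q2]; exists q.
  by rewrite gtr0_norm ?subr_gt0// ltrBlDl.
pose q : 'rV[rat]_2 := \row_k sval (xq k).
have bqx : ball (map_mx ratr q : 'rV[R]_2) n.+1%:R^-1 x.
  split=> // i k; rewrite (ord1 i) !mxE -ball_normE/=.
  exact: (svalP (xq k)).
exists (b (q, n)); first by split=> //; exists (q, n).
move=> y bqy; apply: xeA; rewrite [e]splitr.
apply: (ball_triangle (y := map_mx ratr q : 'rV[R]_2)).
  by apply: ball_sym; apply: le_ball bqx; exact: ltW.
by apply: le_ball bqy; exact: ltW.
Qed.

Lemma is_derive_coord (k : 'I_2) (x v : 'rV[R]_2) :
  is_derive x v (fun y : 'rV[R]_2 => y 0 k) (v 0 k).
Proof.
have cv : (fun h : R =>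
    h^-1 *: ((h *: v + x) 0 k - x 0 k)) @ 0^' --> v 0 k.
  apply: cvg_near_cst; near=> h.
  rewrite !mxE addrK -[_ *: _]/(h^-1 * (h * v 0 k)) mulKf//.
  by near: h; exact: nbhs_dnbhs_neq.
by split; [apply/cvg_ex; exists (v 0 k); exact: cv | exact: cvg_lim cv].
Unshelve. all: by end_near. Qed.

Lemma partial_coord (i k : 'I_2) :
  partial i (fun x : 'rV[R]_2 => x 0 k) = cst (i == k)%:R.
Proof.
apply/funext => x; rewrite /partial.
by rewrite (@derive_val _ _ _ _ _ _ _ (is_derive_coord k x _)) mxE eqxx eq_sym.
Qed.

Lemma partial_cst (i : 'I_2) (c : R) : partial i (cst c) = cst 0.
Proof. by apply/funext => x; exact: derive_cst. Qed.

Lemma sub_Ck n (U V : set 'rV[R]_2) (f : 'rV[R]_2 -> R) :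
  U `<=` V -> Ck n V f -> Ck n U f.
Proof.
move=> UV; elim: n f => [|n IH] f /= [cf df]; (split; first by move=> x /UV/cf) => // i.
by have [df1 df2] := df i; split=> [x /UV/df1//|]; exact: IH.
Qed.

Lemma smooth_cst U (c : R) : smooth U (cst c).
Proof.
move=> n; elim: n c => [|n IH] c /=; (split=> [x _|]; first exact: cst_continuous) => // i.
split=> [x _|]; first exact: derivable_cst.
by rewrite partial_cst.
Qed.

Lemma smooth_coord U (k : 'I_2) : smooth U (fun x : 'rV[R]_2 => x 0 k).
Proof.
have cont x : {for x, continuous (fun x : 'rV[R]_2 => x 0 k)}.
  exact: coord_continuous.
case=> [|n] /=; split=> // i; split=> [x _|]; last first.
  by rewrite partial_coord; exact: smooth_cst.
exact: (@ex_derive _ _ _ _ _ _ _ (is_derive_coord k x _)).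
Qed.

Lemma intertwines_id U (G : christoffel R) : intertwines U G G id.
Proof.
have pE i k x : partial i (component id k) x = (i == k)%:R :> R.
  by rewrite [partial i _]partial_coord.
move=> x _ i j k; rewrite [partial j _]partial_coord partial_cst/= add0r.
rewrite [RHS](bigD1 i)//= [X in _ + X]big1 ?addr0; last first.
  move=> p pi; rewrite big1// => q _.
  by rewrite pE eq_sym (negbTE pi) mulr0 mul0r.
rewrite [RHS](bigD1 j)//= [X in _ + X]big1 ?addr0; last first.
  by move=> q qj; rewrite !pE eqxx eq_sym (negbTE qj) mulr0.
rewrite !pE !eqxx !mulr1 (bigD1 k)//= pE eqxx mulr1 big1 ?addr0//.
by move=> l lk; rewrite pE (negbTE lk) mulr0.
Qed.

Lemma plane_image_open : open (id @` [set: 'rV[R]_2]).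
Proof. by rewrite image_id; exact: openT. Qed.

End PlaneLemmas.

Section Planes.
Variable R : realType.
Implicit Types M : plane_connection R.

Lemma plane_gamma_smooth M (A : set 'rV[R]_2) i j k :
  smooth (id @` A) (Gam M i j k).
Proof. by move=> n; apply: (@sub_Ck R n _ setT); [|exact: Gam_smooth]. Qed.

(* (R^2, \nabla), with the identity as its only chart. *)
Definition plane M : affine_surface R :=
  @AffineSurface R 'rV[R]_2 (@norm_hausdorff R 'rV[R]_2)
    (@plane_second_countable R) unit
    (fun=> setT) (fun=> id) (fun=> id) (fun=> Gam M)
    (fun=> openT) (fun=> ex_intro _ tt I) (fun=> @plane_image_open R)
    (fun _ _ _ => erefl) (fun _ _ _ => cvg_id)
    (fun _ _ _ => cvg_id)
    (fun _ _ => @smooth_coord R _) (fun _ a b k x _ => Gam_sym M a b k x)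
    (fun _ => plane_gamma_smooth M _) (fun _ _ => @intertwines_id R _ (Gam M)).

(* \nabla_X Y for vector fields X, Y on R^2. *)
Definition nabla M (X Y : 'rV[R]_2 -> 'rV[R]_2) : 'rV[R]_2 -> 'rV[R]_2 :=
  fun x => \row_k ('D_(X x) (component Y k) x +
                   \sum_i \sum_j Gam M i j k x * X x 0 i * Y x 0 j).

Definition bracket (X Y : 'rV[R]_2 -> 'rV[R]_2) : 'rV[R]_2 -> 'rV[R]_2 :=
  fun x => \row_k ('D_(X x) (component Y k) x - 'D_(Y x) (component X k) x).

Definition curvature M (X Y Z : 'rV[R]_2 -> 'rV[R]_2) :
    'rV[R]_2 -> 'rV[R]_2 :=
  fun x => nabla M X (nabla M Y Z) x - nabla M Y (nabla M X Z) x
           - nabla M (bracket X Y) Z x.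

Definition flat M : Prop :=
  forall X Y Z, smooth_map setT X -> smooth_map setT Y -> smooth_map setT Z ->
  forall x, curvature M X Y Z x = 0.

Definition coord_field (i : 'I_2) : 'rV[R]_2 -> 'rV[R]_2 :=
  cst (delta_mx 0 i).

(* Row k of the matrix is R(\partial_k, X) Y. *)
Definition ricci M (X Y : 'rV[R]_2 -> 'rV[R]_2) (x : 'rV[R]_2) : R :=
  \tr (\matrix_(k, l) curvature M (coord_field k) X Y x 0 l).

Definition ricci_rank M (r : nat) : Prop :=
  forall x, \rank (\matrix_(i, j) ricci M (coord_field i) (coord_field j) x)
            = r.

Definition type_A M : Prop :=
  forall i j k, exists c : R, forall x, Gam M i j k x = c.

Definition linearly_equivalent M M' : Prop :=
  exists2 A : 'M[R]_2, A \in unitmx &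
    intertwines setT (Gam M) (Gam M') (mulmxr A).

Definition symbols (a b c d e f : R) (i j k : 'I_2) : R :=
  if (i == 0) && (j == 0) then (if k == 0 then a else b)
  else if (i != 0) && (j != 0) then (if k == 0 then e else f)
  else (if k == 0 then c else d).

Lemma symbolsC a b c d e f i j k :
  symbols a b c d e f i j k = symbols a b c d e f j i k.
Proof. by rewrite /symbols andbC [(i != 0) && _]andbC. Qed.

(* \mathcal{M}(a, b, c, d, e, f) *)
Definition model (a b c d e f : R) : plane_connection R :=
  @PlaneConnection R (fun i j k => cst (symbols a b c d e f i j k))
    (fun i j k _ => symbolsC a b c d e f i j k)
    (fun _ _ _ => @smooth_cst R _ _).

(* Mr_k is \mathcal{M}_k^r, at the parameter -1/2, -1/2, 0, (-1, b2) for
   M1_3, M1_2, M1_5, M2_2 respectively. *)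
Definition M0_0 := model 0 0 0 0 0 0.
Definition M0_4 := model 0 0 0 0 1 0.
Definition M1_3 := model 0 0 (- 2^-1) 0 0 0.
Definition M1_2 := model (- 1) 0 (- 2^-1) 0 0 0.
Definition M1_5 := model 1 0 0 0 1 0.
Definition M2_2 (b2 : R) := model 0 0 b2 1 (- ((1 + b2 ^+ 2) / 2)) 0.

(* \Gamma_{22}^1 = x^1 is the only non-zero symbol. *)
Definition symbolsN (i j k : 'I_2) : 'rV[R]_2 -> R :=
  if [&& i == 1, j == 1 & k == 0] then fun x => x 0 0 else cst 0.

Lemma symbolsN_sym i j k x : symbolsN i j k x = symbolsN j i k x.
Proof. by rewrite /symbolsN andbCA. Qed.

Lemma symbolsN_smooth i j k : smooth setT (symbolsN i j k).
Proof.
by rewrite /symbolsN; case: ifP => _; [exact: smooth_coord|exact: smooth_cst].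
Qed.

Definition modelN : plane_connection R :=
  PlaneConnection symbolsN_sym symbolsN_smooth.

End Planes.

(* Main.v *)
Require Import Defs.
From mathcomp Require Import all_boot all_order all_algebra.
From mathcomp Require Import all_classical all_reals all_analysis.
From mathcomp Require Import ring lra.

(* Write v . w for the constant vector with components Gamma_ij^k v^i w^j. A cubic equation gives
   a direction v with v . v = l v; if l != 0 then (ln t / l) v, t > 0, is a geodesic that does not
   extend to t = 0, and a short case analysis in a basis starting with v settles the normal forms.
   An affine embedding into a homogeneous complete surface T preserves rho and nabla rho, whose
   values at any two points of T correspond linearly. This gives three obstructions to completion:
   along a geodesic of M, rho(s', s') is unbounded near a finite time; or t (nabla_s' rho)(s', .)
   is a nonzero multiple of rho(s', .) with rho nondegenerate, which forces s' = 0 at t = 0; or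
   (nabla_v rho)(v, v)^2 = k rho(v, v)^3 with k > 0 on M, hence on T, so that r = rho(s', s')
   satisfies r'^2 = k r^3, which has no nonzero global solution. For the remaining models the
   geodesics are found explicitly, except for M_2^2(-1, b), where the slope solves an autonomous
   equation. The two completions are x |-> (exp (+/- x^1), x^2). *)

Set Implicit Arguments.
Unset Strict Implicit.
Unset Printing Implicit Defensive.
Import Order.TTheory GRing.Theory Num.Theory.
Import numFieldNormedType.Exports.
Local Open Scope classical_set_scope.
Local Open Scope ring_scope.

(** * Calculus on the plane *)

Section Calculus.
Variable R : realType.
Implicit Types (f g : 'rV[R]_2 -> R) (U V : set 'rV[R]_2) (x y z v : 'rV[R]_2).

(** An eigendirection v with l != 0 gives blow-up only if rho(v, v) != 0, and this decides which
    obstruction is used. If rho has rank 2 and rho(v, v) = 0, then rho(v, .) is still nonzero and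
    nabla rho detects the ray. If v spans the kernel of a rho of rank 1, rho and nabla rho show
    nothing along the ray; when there is no other eigendirection the cubic relation takes over. In
    the normal form Gamma_11^1 = 1, Gamma_22^1 = g, Gamma_22^2 = f its constant is k = 4 f^2 / g. It
    degenerates at f = 0, which is where the two incomplete but completable models sit: M_5^1(0) for
    g > 0 and M_2^1(-1/2) for g < 0. The extended geodesic may leave the image of M, so facts about
    rho known on M have to be carried to points known only as points of T; homogeneity does this.
    Completeness is obtained without general existence theory: a global geodesic is exhibited for
    all initial values, and uniqueness comes from a linear Gronwall estimate. *)

Lemma I2_ind (P : 'I_2 -> Prop) : P 0 -> P 1 -> forall i, P i.
Proof.
move=> P0 P1 [[|[|//]] i]; first by rewrite (_ : Ordinal i = 0)//; exact/val_inj.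
by rewrite (_ : Ordinal i = 1)//; exact/val_inj.
Qed.

Lemma sum2 (V : nmodType) (F : 'I_2 -> V) : \sum_i F i = F 0 + F 1.
Proof. by rewrite !big_ord_recl big_ord0 addr0; congr (_ + F _); exact/val_inj. Qed.

Lemma rV2P x y : x 0 0 = y 0 0 -> x 0 1 = y 0 1 -> x = y.
Proof. by move=> h0 h1; apply/rowP; apply: I2_ind. Qed.

Lemma cvg_rV2 (T : topologicalType) (F : T -> 'rV[R]_2) (t : T) :
  (forall k, {for t, continuous (fun u => F u 0 k)}) -> {for t, continuous F}.
Proof.
move=> cF; apply/cvgrPdist_le => e e0.
near=> u; rewrite [leLHS]/Num.Def.normr/= mx_normrE (bigmax_le _ (ltW e0))//= => -[i j] _.
rewrite (ord1 i) !mxE/=; move: j; near: u; apply: filter_forall => j.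
exact: ((cvgrPdist_le _ _).1 (cF j)).
Unshelve. all: by end_near. Qed.

Lemma cvg_rV2_coord (T : topologicalType) (F : T -> 'rV[R]_2) (t : T) k :
  {for t, continuous F} -> {for t, continuous (fun u => F u 0 k)}.
Proof.
move=> cF; apply: (@continuous_comp _ _ _ F (fun z : 'rV[R]_2 => z 0 k)) => //.
exact: coord_continuous.
Qed.

Lemma coord_norm x k : `|x 0 k| <= `|x|.
Proof. by rewrite [leRHS]/Num.Def.normr/= mx_normrE; exact: (le_bigmax _ _ (0, k)). Qed.

Lemma norm_rV2 x (e : R) : 0 <= e -> (forall k, `|x 0 k| <= e) -> `|x| <= e.
Proof.
move=> e0 h; rewrite [leLHS]/Num.Def.normr/= mx_normrE.
by apply: bigmax_le => // -[i j] _ /=; rewrite (ord1 i).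
Qed.

Lemma is_derive_line f x v (h d : R) :
  is_derive (h *: v + x) v f d -> is_derive h (1 : R) (fun k => f (k *: v + x)) d.
Proof.
move=> [df <-].
have E : (fun k : R => k^-1 *: (((fun u => f (u *: v + x)) \o shift h) (k *: (1 : R))
      - f (h *: v + x))) =
    (fun k => k^-1 *: ((f \o shift (h *: v + x)) (k *: v) - f (h *: v + x))).
  by apply/funext => k /=; rewrite [_%:A]mulr1 scalerDl addrA.
by split; rewrite ?/derivable ?/derive E.
Qed.

Lemma line_is_derive f x v (d : R) :
  is_derive (0 : R) (1 : R) (fun k => f (k *: v + x)) d -> is_derive x v f d.
Proof.
have E : (fun h : R => h^-1 *: ((f \o shift x) (h *: v) - f x)) =
    (fun k : R => k^-1 *: (((fun u => f (u *: v + x)) \o shift 0) (k *: (1 : R))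
      - f (0 *: v + x))).
  by apply/funext => k /=; rewrite addr0 scale0r add0r [_%:A]mulr1.
by move=> [df <-]; split; rewrite ?/derivable ?/derive E.
Qed.

Lemma mean_value_line f x v (h : R) :
  (forall k, `|k| <= `|h| -> derivable f (k *: v + x) v) ->
  exists2 k, `|k| <= `|h| & f (h *: v + x) - f x = h * 'D_v f (k *: v + x).
Proof.
move=> df; pose phi (k : R) := f (k *: v + x).
pose dphi (k : R) := 'D_v f (k *: v + x).
have dg (k : R) : `|k| <= `|h| -> is_derive k (1 : R) phi (dphi k).
  by move=> kh; apply: is_derive_line; apply: derivableP; exact: df.
have mv (a b : R) : a <= b -> (forall k : R, k \in `[a, b] -> `|k| <= `|h|) ->
    exists2 k, k \in `[a, b] & phi b - phi a = dphi k * (b - a).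
  move=> ab abh; apply: MVT_segment ab _ _ => [k /subset_itv_oo_cc /abh/dg//|].
  apply: derivable_within_continuous => k /abh kh.
  exact: (@ex_derive _ _ _ _ _ _ _ (dg k kh)).
rewrite -[X in _ - f X]add0r -[in X in _ - f X](scale0r v) -/(phi _) -/(phi 0).
have [h0|h0] := leP 0 h.
  have hh (k : R) : k \in `[0, h] -> `|k| <= `|h|.
    by rewrite in_itv/= => /andP[k0 kh]; rewrite !ger0_norm.
  by have [k kh E] := mv _ _ h0 hh; exists k; rewrite ?hh// E subr0 mulrC.
have hh (k : R) : k \in `[h, 0] -> `|k| <= `|h|.
  by rewrite in_itv/= => /andP[k0 kh]; rewrite (ltr0_norm h0) ler0_norm// lerN2.
have [k kh E] := mv _ _ (ltW h0) hh; exists k; first exact: hh.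
by rewrite -opprB E sub0r mulrN opprK mulrC.
Qed.

Lemma Ck0 n U f x : Ck n U f -> U x -> {for x, continuous f}.
Proof. by case: n => [|n] [cf _]; exact: cf. Qed.

Lemma CkS n U f i : Ck n.+1 U f -> Ck n U (partial i f).
Proof. by move=> [_ /(_ i)[]]. Qed.

Lemma Ck_derivable n U f i x : Ck n.+1 U f -> U x ->
  is_derive x (delta_mx 0 i) f (partial i f x).
Proof. by move=> [_ /(_ i)[df _]] Ux; apply: derivableP; exact: df. Qed.

Lemma Ck_le n U f : Ck n.+1 U f -> Ck n U f.
Proof.
elim: n f => [|n IH] f [cf df]; first by split.
by split=> // i; have [? ?] := df i; split=> //; exact: IH.
Qed.

Lemma near_continuous (T T' : topologicalType) (F G : T -> T') (t : T) :
  (\near t, F t = G t) -> {for t, continuous F} -> {for t, continuous G}.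
Proof.
move=> FG cF; rewrite /prop_for /continuous_at -(nbhs_singleton FG).
apply: cvg_trans cF; apply: near_eq_cvg; near=> z.
by near: z.
Unshelve. all: by end_near. Qed.

(** A partial derivative at a point depends on a neighbourhood of it, so equality on U passes to
    derivatives because U is open. *)
Lemma eq_Ck n U f g : open U -> (forall x, U x -> f x = g x) -> Ck n U f -> Ck n U g.
Proof.
move=> oU; have nfg (f' g' : 'rV[R]_2 -> R) x : (forall x, U x -> f' x = g' x) -> U x ->
    \near x, f' x = g' x.
  by move=> fg Ux; near=> y; apply: fg; near: y; exact: open_nbhs_nbhs.
elim: n f g => [|n IH] f g fg /= [cf df].
  by split=> // x Ux; apply: near_continuous (nfg _ _ _ fg Ux) (cf _ Ux).
split=> [x Ux|i]; first exact: near_continuous (nfg _ _ _ fg Ux) (cf _ Ux).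
have [df1 df2] := df i; split=> [x Ux|].
  exact: near_eq_derivable (nfg _ _ _ fg Ux) (df1 _ Ux).
by apply: IH df2 => x Ux; exact: near_eq_derive (nfg _ _ _ fg Ux).
Unshelve. all: by end_near. Qed.

End Calculus.

(** * Chain rule and symmetry of second derivatives *)

Section ChainRule.
Variable R : realType.
Implicit Types (f g : 'rV[R]_2 -> R) (U V : set 'rV[R]_2) (x y z v : 'rV[R]_2).

Lemma open_ball U x : open U -> U x ->
  exists2 e : R, 0 < e & forall z, `|z - x| < e -> U z.
Proof.
move=> oU Ux; have /nbhs_ballP[e e0 he] : nbhs x U by exact: open_nbhs_nbhs.
by exists e => // z ze; apply: he; rewrite -ball_normE/= distrC.
Qed.

Lemma line_coord (k : R) (i j : 'I_2) x :
  (k *: delta_mx 0 i + x) 0 j = (if i == j then k else 0) + x 0 j.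
Proof. by rewrite !mxE eqxx eq_sym /=; case: eqP; rewrite ?mulr1 ?mulr0. Qed.

(* The increment is split along the two sides of a coordinate rectangle. *)
Lemma increment U f x : open U -> Ck 1 U f -> U x ->
  exists2 e : R, 0 < e & forall z, `|z - x| < e -> exists p : 'rV[R]_2 * 'rV[R]_2,
    [/\ `|p.1 - x| <= `|z - x|, `|p.2 - x| <= `|z - x| &
    f z - f x = (z 0 0 - x 0 0) * partial 0 f p.1 + (z 0 1 - x 0 1) * partial 1 f p.2].
Proof.
move=> oU f1 Ux; have [e e0 eU] := open_ball oU Ux; exists e => // z ze.
pose m := (z 0 0 - x 0 0) *: delta_mx 0 0 + x.
have zm : z = (z 0 1 - x 0 1) *: delta_mx 0 1 + m.
  by apply: rV2P; rewrite !line_coord/= ?add0r subrK.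
have n0 k : `|k| <= `|z 0 0 - x 0 0| -> `|k *: delta_mx 0 0 + x - x| <= `|z - x|.
  move=> kz; apply: norm_rV2 => //; apply: I2_ind; rewrite mxE line_coord !mxE/= addrK.
    by apply: le_trans kz _; have := coord_norm (z - x) 0; rewrite !mxE.
  by rewrite normr0.
have n1 k : `|k| <= `|z 0 1 - x 0 1| -> `|k *: delta_mx 0 1 + m - x| <= `|z - x|.
  move=> kz; apply: norm_rV2 => //; apply: I2_ind; rewrite mxE line_coord line_coord !mxE/=.
    by rewrite add0r addrK; have := coord_norm (z - x) 0; rewrite !mxE.
  by rewrite add0r addrK; apply: le_trans kz _; have := coord_norm (z - x) 1; rewrite !mxE.
have d i p : `|p - x| <= `|z - x| -> derivable f p (delta_mx 0 i).
  move=> pz; apply: (@ex_derive _ _ _ _ _ _ _ (Ck_derivable i f1 _)).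
  by apply: eU; exact: le_lt_trans ze.
have [k0 k0z E0] := mean_value_line (fun k kz => d 0 _ (n0 k kz)).
have [k1 k1z E1] := mean_value_line (fun k kz => d 1 _ (n1 k kz)).
exists (k0 *: delta_mx 0 0 + x, k1 *: delta_mx 0 1 + m); split=> /=; [exact: n0|exact: n1|].
by rewrite /partial -E0 -E1 -zm -/m; ring.
Qed.

(** [Ck 1] gives continuous partial derivatives but no total differential, so the rule is derived
    from [increment] in Carathéodory form: f (c u) - f (c t) is u - t times a factor continuous at
    t. *)
Lemma chain_curve U f (c : R -> 'rV[R]_2) (t a0 a1 : R) :
  open U -> Ck 1 U f -> U (c t) ->
  is_derive t (1 : R) (fun u => c u 0 0) a0 -> is_derive t (1 : R) (fun u => c u 0 1) a1 ->
  is_derive t (1 : R) (fun u => f (c u)) (partial 0 f (c t) * a0 + partial 1 f (c t) * a1).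
Proof.
move=> oU f1 Ut d0 d1; set x := c t in Ut *.
have [e e0 he] := increment oU f1 Ut.
have {he} /choice[p hp] : forall z, exists p : 'rV[R]_2 * 'rV[R]_2,
    [/\ `|p.1 - x| <= `|z - x|, `|p.2 - x| <= `|z - x| & `|z - x| < e ->
    f z - f x = (z 0 0 - x 0 0) * partial 0 f p.1 + (z 0 1 - x 0 1) * partial 1 f p.2].
  move=> z; have [/he[q [q1 q2 qE]]|ze] := ltP `|z - x| e; first by exists q.
  (* Outside the ball the pair (x, x) is a default. It keeps the two distance bounds, which alone
     give continuity of the intermediate points at x. *)
  by exists (x, x); rewrite subrr normr0; split.
have px1 : (p x).1 = x.
  by apply/eqP; rewrite -subr_eq0 -normr_le0; have [+ _ _] := hp x; rewrite subrr normr0.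
have px2 : (p x).2 = x.
  by apply/eqP; rewrite -subr_eq0 -normr_le0; have [_ + _] := hp x; rewrite subrr normr0.
have cc : {for t, continuous c}.
  apply: cvg_rV2; apply: I2_ind; apply/differentiable_continuous/derivable1_diffP;
  exact: (@ex_derive _ _ _ _ _ _ _ _).
have lim (q : 'rV[R]_2 -> 'rV[R]_2) i : q x = x -> (forall z, `|q z - x| <= `|z - x|) ->
    {for t, continuous (fun u => partial i f (q (c u)))}.
  move=> qx qz; have cq : {for x, continuous q}.
    rewrite /prop_for /continuous_at qx; apply/(@cvgrPdist_le _ _ _ (nbhs x)) => r r0.
    apply/nbhs_ballP; exists r => // z; rewrite -ball_normE/= => /ltW zr.
    by rewrite distrC (le_trans (qz z))// distrC.
  apply: (@continuous_comp _ _ _ c (fun z => partial i f (q z))) => //.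
  apply: (@continuous_comp _ _ _ q (partial i f)) => //.
  by rewrite qx; apply: (Ck0 (CkS i f1)).
have {lim} [l0 l1] : {for t, continuous (fun u => partial 0 f (p (c u)).1)} /\
    {for t, continuous (fun u => partial 1 f (p (c u)).2)}.
  split; first by apply: (lim (fun z => (p z).1) 0 px1) => z; have [] := hp z.
  by apply: (lim (fun z => (p z).2) 1 px2) => z; have [] := hp z.
have [h0 [E0 c0 h0t]] := (is_derive1_caratheodory _ _ _).1 d0.
have [h1 [E1 c1 h1t]] := (is_derive1_caratheodory _ _ _).1 d1.
pose g u := partial 0 f (p (c u)).1 * h0 u + partial 1 f (p (c u)).2 * h1 u.
apply: (@near_eq_is_derive _ _ _ (fun u => f x + g u * (u - t))).
  near=> u; have [_ _ /(_ _)E] := hp (c u).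
  apply/esym/eqP; rewrite addrC -subr_eq E; first by rewrite E0 E1 /g; apply/eqP; ring.
  by rewrite distrC; near: u; move/cvgrPdist_lt: cc; exact.
apply/is_derive1_caratheodory; exists g; split.
- by move=> u; rewrite subrr mulr0 addr0 addrC addKr.
- by apply: continuousD; apply: continuousM.
- by rewrite /g px1 px2 h0t h1t.
Unshelve. all: by end_near. Qed.

(** The second difference of f over a square of side h is symmetric in the two directions, and
    equals h^2 times either mixed derivative at some nearby point; continuity of both mixed
    derivatives then identifies them. *)
Lemma schwarz U f x i j : open U -> Ck 2 U f -> U x ->
  partial i (partial j f) x = partial j (partial i f) x.
Proof.
move=> oU f2 Ux.
have f1 := Ck_le f2.
have [e e0 eU] := open_ball oU Ux.
have nrm (k l h : R) a b : `|k| <= h -> `|l| <= h -> 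
    `|k *: delta_mx 0 a + (l *: delta_mx 0 b + x) - x : 'rV[R]_2| <= h + h.
  move=> kh lh; have h0 := le_trans (normr_ge0 _) kh.
  apply: norm_rV2 => [|c]; first exact: addr_ge0.
  rewrite !mxE addrA addrK (le_trans (ler_normD _ _))// lerD// normrM;
  by apply: le_trans (ler_piMr _ _) _; rewrite ?normr_ge0//; 
    case: (_ && _); rewrite ?normr1 ?normr0.
(* Mean value theorem twice: along a for the difference [g] of f over a step in direction b, then
   along b for [partial a f]. *)
have mixed a b (h : R) : 0 < h -> h + h < e -> exists2 z : 'rV[R]_2, `|z - x| <= h + h &
    f (h *: delta_mx 0 a + (h *: delta_mx 0 b + x)) - f (h *: delta_mx 0 a + x)
    - (f (h *: delta_mx 0 b + x) - f x) = h * (h * partial b (partial a f) z).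
  move=> h0 he; pose g z := f (h *: delta_mx 0 b + z) - f z.
  have hh : `|h| <= h by rewrite gtr0_norm.
  have dg k : `|k| <= `|h| -> is_derive (k *: delta_mx 0 a + x) (delta_mx 0 a) g
     (partial a f (h *: delta_mx 0 b + (k *: delta_mx 0 a + x)) -
      partial a f (k *: delta_mx 0 a + x)).
    rewrite (gtr0_norm h0) => kh; apply: is_deriveB; last first.
      apply: Ck_derivable f1 _; apply: eU.
      rewrite -[_ *: _ + x]add0r -(scale0r (delta_mx 0 b)).
      by apply: le_lt_trans he; apply: nrm => //; rewrite normr0 ltW.
    have : is_derive (h *: delta_mx 0 b + (k *: delta_mx 0 a + x)) (delta_mx 0 a) f
      (partial a f (h *: delta_mx 0 b + (k *: delta_mx 0 a + x))).
      by apply: Ck_derivable f1 _; apply: eU; apply: le_lt_trans he; apply: nrm.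
    move=> [df <-]; set w := k *: _ + x.
    have E : (fun l : R => l^-1 *: (((fun z => f (h *: delta_mx 0 b + z)) \o shift w)
          (l *: delta_mx 0 a) - f (h *: delta_mx 0 b + w))) =
        (fun l : R => l^-1 *: ((f \o shift (h *: delta_mx 0 b + w)) (l *: delta_mx 0 a) -
          f (h *: delta_mx 0 b + w))).
      by apply/funext => l /=; rewrite addrCA.
    by split; rewrite ?/derivable ?/derive E.
  have [k kh] := @mean_value_line _ g x (delta_mx 0 a) h (fun k kh => @ex_derive _ _ _ _ _ _ _ (dg k kh)).
  rewrite (@derive_val _ _ _ _ _ _ _ (dg k kh)) => E0.
  rewrite (gtr0_norm h0) in kh.
  have [|l lh E] := @mean_value_line _ (partial a f) (k *: delta_mx 0 a + x) (delta_mx 0 b) h.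
    move=> l lh; rewrite (gtr0_norm h0) in lh.
    apply: (@ex_derive _ _ _ _ _ _ _ (Ck_derivable b (CkS a f2) _)).
    by apply: eU; apply: le_lt_trans he; apply: nrm.
  rewrite E /g in E0; exists (l *: delta_mx 0 b + (k *: delta_mx 0 a + x)).
    by rewrite (gtr0_norm h0) in lh; exact: nrm.
  rewrite /partial -E0 [_ *: delta_mx 0 a + (_ + _)]addrCA; ring.
have swap (p q r s : R) : p - q - (r - s) = p - r - (q - s) by ring.
have h3 (h : R) : 0 < h -> h + h < h * 3 by lra.
have close (a b c : R) : a != b -> `|a - c| < `|a - b| / 2 -> `|b - c| < `|a - b| / 2 -> False.
  move=> ab ac bc; suff : `|a - b| < `|a - b| by rewrite ltxx.
  rewrite {2}[`|a - b|]splitr; apply: le_lt_trans (ltrD ac bc).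
  by rewrite (distrC b c) -{1}(subrKA c) ler_normD.
apply/eqP/negPn/negP => AB; move/(_ _ _ _ AB): close.
have : 0 < `|partial i (partial j f) x - partial j (partial i f) x| / 2.
  by rewrite divr_gt0// normr_gt0 subr_eq0.
move: (`|_ - _| / 2) => r r0 close.
have near_x a b : exists2 d : R, 0 < d & forall z, `|z - x| < d ->
    `|partial a (partial b f) x - partial a (partial b f) z| < r.
  have := Ck0 (CkS a (CkS b f2)) Ux.
  move=> /cvgrPdist_lt/(_ _ r0)/nbhs_ballP[d d0 dz]; exists d => // z zd.
  by apply: dz; rewrite -ball_normE/= distrC.
have [d1 d10 hd1] := near_x i j.
have [d2 d20 hd2] := near_x j i.
have [h [h0 he hd1' hd2']] : exists h : R, [/\ 0 < h, h + h < e, h + h < d1 & h + h < d2].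
  exists (Num.min e (Num.min d1 d2) / 3).
  have m0 : 0 < Num.min e (Num.min d1 d2) by rewrite !lt_min e0 d10 d20.
  have h0 : 0 < Num.min e (Num.min d1 d2) / 3 by rewrite divr_gt0.
  by have := h3 _ h0; rewrite divfK// !lt_min => /and3P[].
have [z1 z1h E1] := mixed j i h h0 he.
have [z2 z2h E2] := mixed i j h h0 he.
have E : partial i (partial j f) z1 = partial j (partial i f) z2.
  apply: (mulfI (lt0r_neq0 h0)); apply: (mulfI (lt0r_neq0 h0)).
  apply: etrans (esym E1) _; apply: etrans E2.
  by rewrite swap [_ *: delta_mx 0 j + (_ + _)]addrCA.
apply: (close _ (hd1 _ (le_lt_trans z1h hd1'))); rewrite E.
exact: hd2 (le_lt_trans z2h hd2').
Qed.

End ChainRule.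

(** * Affine invariance of the Ricci tensor and of its derivative *)

Section CurvatureAlgebra.
Variable R : fieldType.
Implicit Types (a b i j k l m p q r : 'I_2).

(** The coordinate formula of the Ricci tensor with formal arrays as arguments, [dG m i j k]
    standing for the m-th derivative of Gamma_ij^k. Invariance then becomes a polynomial
    identity. *)
Definition ricci_expr (G : 'I_2 -> 'I_2 -> 'I_2 -> R) (dG : 'I_2 -> 'I_2 -> 'I_2 -> 'I_2 -> R) a b :=
  \sum_k (dG k a b k - dG a k b k + \sum_l (G a b l * G k l k - G k b l * G a l k)).

Definition nabla_expr (G : 'I_2 -> 'I_2 -> 'I_2 -> R) (rho : 'I_2 -> 'I_2 -> R)
    (drho : 'I_2 -> 'I_2 -> 'I_2 -> R) m a b :=
  drho m a b - \sum_l (G m a l * rho l b + G m b l * rho a l).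

(** [P] and [S] stand for the first and second derivatives of an affine map at a point, [G] and [H]
    for the symbols there and at its image. The intertwining relation [hS] expresses [S] through the
    others. *)
Variables (P : 'I_2 -> 'I_2 -> R) (S G H : 'I_2 -> 'I_2 -> 'I_2 -> R).
Hypothesis hS : forall i j k,
  \sum_l G i j l * P l k = S i j k + \sum_p \sum_q H p q k * P i p * P j q.

Let SE i j k : S i j k = G i j 0 * P 0 k + G i j 1 * P 1 k -
  (H 0 0 k * P i 0 * P j 0 + H 0 1 k * P i 0 * P j 1
   + (H 1 0 k * P i 1 * P j 0 + H 1 1 k * P i 1 * P j 1)).
Proof. by have := hS i j k; rewrite !sum2 => ->; rewrite addrK. Qed.

Lemma eq_combination (x y a b c d : R) : a = b -> c = d -> x - y = c - d - (a - b) -> x = y.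
Proof. by move=> -> ->; rewrite !subrr => /subr0_eq. Qed.

(** In dimension 2, R(d_0, d_1) d_b = rho_1b d_0 - rho_0b d_1, so rho carries the whole curvature.
    The last identity assumed is the derivative of the intertwining relation; antisymmetrising it in
    its first two indices eliminates the third derivatives [T]. *)
Lemma ricci_expr_invariant (dG dH T : 'I_2 -> 'I_2 -> 'I_2 -> 'I_2 -> R) a b :
  (forall i j k, G i j k = G j i k) -> (forall i j k, H i j k = H j i k) ->
  (forall m i j k, T m i j k = T i m j k) ->
  (forall m i j k, \sum_l (dG m i j l * P l k + G i j l * S m l k) =
    T m i j k + \sum_p \sum_q ((\sum_r dH r p q k * P m r) * P i p * P j q +
      H p q k * S m i p * P j q + H p q k * P i p * S m j q)) ->
  P 0 0 * P 1 1 - P 0 1 * P 1 0 != 0 ->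
  ricci_expr G dG a b = \sum_p \sum_q ricci_expr H dH p q * P a p * P b q.
Proof.
move=> Gs Hs Ts hT d0.
(* The differential [P] sends R(d_0, d_1) d_b to det P times the curvature of [H] applied to the
   image of d_b. *)
have E k : ricci_expr G dG 1 b * P 0 k - ricci_expr G dG 0 b * P 1 k =
    (P 0 0 * P 1 1 - P 0 1 * P 1 0) * \sum_q (if k == 0 then ricci_expr H dH 1 q else
      - ricci_expr H dH 0 q) * P b q.
  have E2 := hT 0 1 b k; have E1 := hT 1 0 b k; move: E1 E2; rewrite (Ts 1 0).
  rewrite !sum2 !SE /ricci_expr !sum2 ![G 1 0 _]Gs ![H 1 0 _]Hs.
  move: (T 0 1 b k) => t; move: k; apply: I2_ind => /= E1 E2.
    by apply: (eq_combination E1 E2); ring.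
  by apply: (eq_combination E1 E2); ring.
(* Cramer's rule recovers rho_0b and rho_1b from the combination in [E]. *)
apply: (mulfI d0); move: a; apply: I2_ind.
  transitivity ((ricci_expr G dG 1 b * P 0 0 - ricci_expr G dG 0 b * P 1 0) * P 0 1
    - (ricci_expr G dG 1 b * P 0 1 - ricci_expr G dG 0 b * P 1 1) * P 0 0); first by ring.
  by rewrite !E !sum2/=; ring.
transitivity ((ricci_expr G dG 1 b * P 0 0 - ricci_expr G dG 0 b * P 1 0) * P 1 1
  - (ricci_expr G dG 1 b * P 0 1 - ricci_expr G dG 0 b * P 1 1) * P 1 0); first by ring.
by rewrite !E !sum2/=; ring.
Qed.

Lemma nabla_expr_invariant rho rho' drho drho' m a b :
  (forall a b, rho a b = \sum_p \sum_q rho' p q * P a p * P b q) ->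
  (drho m a b = \sum_p \sum_q ((\sum_r drho' r p q * P m r) * P a p * P b q +
     rho' p q * S m a p * P b q + rho' p q * P a p * S m b q)) ->
  nabla_expr G rho drho m a b =
    \sum_r \sum_p \sum_q nabla_expr H rho' drho' r p q * P m r * P a p * P b q.
Proof.
move=> hr; rewrite /nabla_expr => ->; rewrite !sum2 !hr !sum2 !SE; ring.
Qed.

End CurvatureAlgebra.

Section DerivativeRules.
Variables (R : realType) (V : normedModType R).
Implicit Types (f g : V -> R) (x v : V).

Lemma derive_add f g x v df dg : is_derive x v f df -> is_derive x v g dg ->
  is_derive x v (fun y => f y + g y) (df + dg).
Proof. by move=> hf hg; apply: is_deriveD. Qed.

Lemma derive_sub f g x v df dg : is_derive x v f df -> is_derive x v g dg ->
  is_derive x v (fun y => f y - g y) (df - dg).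
Proof. by move=> hf hg; apply: is_deriveB. Qed.

Lemma derive_mul f g x v df dg : is_derive x v f df -> is_derive x v g dg ->
  is_derive x v (fun y => f y * g y) (df * g x + f x * dg).
Proof.
move=> hf hg; apply: is_derive_eq (is_deriveM hf hg) _.
by rewrite /GRing.scale/= addrC [g x * _]mulrC.
Qed.

Lemma derive_sum (h : 'I_2 -> V -> R) x v (dh : 'I_2 -> R) :
  (forall i, is_derive x v (h i) (dh i)) ->
  is_derive x v (fun y => \sum_i h i y) (\sum_i dh i).
Proof.
move=> hh; rewrite sum2 (_ : (fun _ => _) = fun y => h 0 y + h 1 y).
  by apply: derive_add.
by apply/funext => y; rewrite sum2.
Qed.

Lemma derive_unique f g x v df dg : is_derive x v f df -> is_derive x v g dg ->
  (\near x, f x = g x) -> df = dg.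
Proof. by move=> [_ <-] [_ <-] fg; exact: near_eq_derive. Qed.

End DerivativeRules.

Section SmoothAlgebra.
Variable R : realType.
Implicit Types (f g : 'rV[R]_2 -> R) (U V : set 'rV[R]_2) (x y z v : 'rV[R]_2).

Lemma Ck_add n U f g : open U -> Ck n U f -> Ck n U g -> Ck n U (fun x => f x + g x).
Proof.
move=> oU; elim: n f g => [|n IH] f g [cf df] [cg dg].
  by split=> // x Ux; apply: continuousD; [exact: cf|exact: cg].
split=> [x Ux|i]; first by apply: continuousD; [exact: cf|exact: cg].
have [df1 df2] := df i; have [dg1 dg2] := dg i.
have dfg x : U x -> is_derive x (delta_mx 0 i) (fun x => f x + g x) (partial i f x + partial i g x).
  by move=> Ux; apply: derive_add; apply: derivableP; [exact: df1|exact: dg1].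
split=> [x /dfg[]//|].
apply: eq_Ck oU _ (IH _ _ df2 dg2) => x Ux.
by rewrite /partial (@derive_val _ _ _ _ _ _ _ (dfg x Ux)).
Qed.

Lemma Ck_mul n U f g : open U -> Ck n U f -> Ck n U g -> Ck n U (fun x => f x * g x).
Proof.
move=> oU; elim: n f g => [|n IH] f g; first move=> [cf df] [cg dg].
  by split=> // x Ux; apply: continuousM; [exact: cf|exact: cg].
move=> Cf Cg; have := Ck_le Cf; have := Ck_le Cg => Cg' Cf'.
case: Cf Cg => [cf df] [cg dg].
split=> [x Ux|i]; first by apply: continuousM; [exact: cf|exact: cg].
have [df1 df2] := df i; have [dg1 dg2] := dg i.
have dfg x : U x -> is_derive x (delta_mx 0 i) (fun x => f x * g x)
    (partial i f x * g x + f x * partial i g x).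
  by move=> Ux; apply: derive_mul; apply: derivableP; [exact: df1|exact: dg1].
split=> [x /dfg[]//|].
apply: eq_Ck oU _ (Ck_add oU (IH _ _ df2 Cg') (IH _ _ Cf' dg2)) => x Ux.
by rewrite /partial (@derive_val _ _ _ _ _ _ _ (dfg x Ux)).
Qed.

Lemma Ck_sub n U f g : open U -> Ck n U f -> Ck n U g -> Ck n U (fun x => f x - g x).
Proof.
move=> oU Cf Cg; apply: Ck_add => //.
apply: (@eq_Ck _ _ _ (fun x => (cst (- 1) x) * g x)) => // [x _|]; first by rewrite mulN1r.
by apply: Ck_mul => //; exact: smooth_cst.
Qed.

Lemma Ck_sum n U (h : 'I_2 -> 'rV[R]_2 -> R) : open U -> (forall i, Ck n U (h i)) ->
  Ck n U (fun x => \sum_i h i x).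
Proof.
move=> oU Ch; apply: (@eq_Ck _ _ _ (fun x => h 0 x + h 1 x)) => // [x _|]; first by rewrite sum2.
exact: Ck_add.
Qed.

End SmoothAlgebra.

Section CurvatureInvariance.
Variable R : realType.
Implicit Types (f g : 'rV[R]_2 -> R) (U V : set 'rV[R]_2) (x y z v : 'rV[R]_2).
Implicit Types (G H : christoffel R) (F : 'rV[R]_2 -> 'rV[R]_2).

Definition Ric G (a b : 'I_2) x : R :=
  ricci_expr (fun i j k => G i j k x) (fun m i j k => partial m (G i j k) x) a b.

Definition nablaRic G (m a b : 'I_2) x : R :=
  nabla_expr (fun i j k => G i j k x) (fun a b => Ric G a b x)
    (fun m a b => partial m (Ric G a b) x) m a b.

Lemma Ck_Ric n U G a b : open U -> (forall i j k, Ck n.+1 U (G i j k)) -> Ck n U (Ric G a b).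
Proof.
move=> oU CG; have CG' i j k := Ck_le (CG i j k).
apply: Ck_sum => // k; apply: Ck_add => //.
  by apply: Ck_sub => //; exact: CkS.
by apply: Ck_sum => // l; apply: Ck_sub => //; exact: Ck_mul.
Qed.

Lemma continuous_nablaRic U G m a b x : open U -> (forall i j k, Ck 2 U (G i j k)) -> U x ->
  {for x, continuous (nablaRic G m a b)}.
Proof.
move=> oU CG Ux; suff C0 : Ck 0 U (nablaRic G m a b) by exact: Ck0 C0 Ux.
have CG' i j k : Ck 0 U (G i j k) by do 2 apply: Ck_le; exact: CG.
have CR c d : Ck 1 U (Ric G c d) by exact: Ck_Ric.
have CR' c d : Ck 0 U (Ric G c d) by apply: Ck_le.
apply: Ck_sub => //; first exact: CkS.
by apply: Ck_sum => // l; apply: Ck_add => //; exact: Ck_mul.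
Qed.

(** An affine map read in two charts, detached from the surfaces, so that the tensor calculus takes
    place between open sets of R^2. *)
Record local_affine U V G H F : Prop := LocalAffine {
  la_dom : open U;
  la_cod : open V;
  la_map : forall x, U x -> V (F x);
  la_smooth : smooth_map U F;
  la_smooth_dom : forall i j k, smooth U (G i j k);
  la_smooth_cod : forall i j k, smooth V (H i j k);
  la_sym_dom : forall i j k x, U x -> G i j k x = G j i k x;
  la_sym_cod : forall i j k x, V x -> H i j k x = H j i k x;
  la_intertwines : intertwines U G H F }.

Lemma chain_partial V f F i x : open V -> Ck 1 V f -> V (F x) ->
  (forall k, is_derive x (delta_mx 0 i) (component F k) (partial i (component F k) x)) ->
  is_derive x (delta_mx 0 i) (fun y => f (F y))
    (\sum_r partial r f (F x) * partial i (component F r) x).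
Proof.
move=> oV f1 VFx dF; apply: line_is_derive; rewrite sum2.
have Fx : F (0 *: delta_mx 0 i + x) = F x by rewrite scale0r add0r.
rewrite -!Fx; apply: (@chain_curve _ V f (fun u : R => F (u *: delta_mx 0 i + x))) => //.
- by rewrite Fx.
- by apply: (@is_derive_line _ (component F 0)); rewrite scale0r add0r; exact: dF.
- by apply: (@is_derive_line _ (component F 1)); rewrite scale0r add0r; exact: dF.
Qed.

Lemma det_mx2 (A : 'M[R]_2) : \det A = A 0 0 * A 1 1 - A 0 1 * A 1 0.
Proof.
rewrite (expand_det_row _ 0) sum2 /cofactor !det_mx11 !mxE /= expr0 expr1.
rewrite (_ : lift 0 0 = 1 :> 'I_2); last exact/val_inj.
rewrite (_ : lift 1 0 = 0 :> 'I_2); last exact/val_inj.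
by rewrite mul1r mulN1r mulrN.
Qed.

Section LocalAffine.
Variables (U V : set 'rV[R]_2) (G H : christoffel R) (F : 'rV[R]_2 -> 'rV[R]_2).
Hypothesis A : local_affine U V G H F.

Lemma la_derive i k x : U x ->
  is_derive x (delta_mx 0 i) (component F k) (partial i (component F k) x).
Proof. by move=> Ux; exact: (Ck_derivable i (la_smooth A k 1) Ux). Qed.

Lemma la_derive2 i j k x : U x -> is_derive x (delta_mx 0 i)
  (partial j (component F k)) (partial i (partial j (component F k)) x).
Proof. by move=> Ux; exact: (Ck_derivable i (CkS j (la_smooth A k 2)) Ux). Qed.

Lemma Ric_local_affine a b x : U x -> jacobian_mx F x \in unitmx ->
  Ric G a b x = \sum_p \sum_q Ric H p q (F x) * partial a (component F p) x
    * partial b (component F q) x.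
Proof.
move=> Ux; rewrite unitmxE unitfE det_mx2 !mxE => J0.
apply: (@ricci_expr_invariant _ (fun l k => partial l (component F k) x)
  (fun i j k => partial i (partial j (component F k)) x)
  (fun i j k => G i j k x) (fun i j k => H i j k (F x)) _
  (fun m i j k => partial m (G i j k) x) (fun m i j k => partial m (H i j k) (F x))
  (fun m i j k => partial m (partial i (partial j (component F k))) x));
  last exact: J0.
- by move=> i j k; exact: (la_intertwines A).
- by move=> i j k; exact: (la_sym_dom A).
- by move=> i j k; apply: (la_sym_cod A); exact: (la_map A).
- by move=> m i j k; apply: schwarz (la_dom A) _ Ux; exact: (CkS j (la_smooth A k 3)).
move=> m i j k.
have near_x : \forall y \near x, U y by apply: open_nbhs_nbhs; split; [exact: la_dom A|].
apply: (@derive_unique _ _ (fun y => \sum_l G i j l y * partial l (component F k) y)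
  (fun y => partial i (partial j (component F k)) y + \sum_p \sum_q H p q k (F y) *
      partial i (component F p) y * partial j (component F q) y) x (delta_mx 0 m)).
- apply: derive_sum => l; apply: derive_mul; last exact: la_derive2.
  exact: (Ck_derivable m (la_smooth_dom A i j l 1) Ux).
- apply: derive_add.
    exact: (Ck_derivable m (CkS i (CkS j (la_smooth A k 3))) Ux).
  apply: derive_sum => p; apply: derive_sum => q.
  apply: is_derive_eq; first (apply: derive_mul; [apply: derive_mul|exact: la_derive2]).
  + apply: (chain_partial (la_cod A) (la_smooth_cod A p q k 1) (la_map A Ux)) => r.
    exact: la_derive.
  + exact: la_derive2.
  + by rewrite mulrDl.
- by near=> y; apply: (la_intertwines A); near: y.
Unshelve. all: by end_near. Qed.

Hypothesis J : forall x, U x -> jacobian_mx F x \in unitmx.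

(** Obtained by differentiating the transformation law of rho, which must therefore hold on all of
    U; hence invertibility of the Jacobian is assumed on U and not only at x. *)
Lemma nablaRic_local_affine m a b x : U x ->
  nablaRic G m a b x = \sum_r \sum_p \sum_q nablaRic H r p q (F x) *
    partial m (component F r) x * partial a (component F p) x * partial b (component F q) x.
Proof.
move=> Ux.
apply: (@nabla_expr_invariant _ (fun l k => partial l (component F k) x)
  (fun i j k => partial i (partial j (component F k)) x)
  (fun i j k => G i j k x) (fun i j k => H i j k (F x)) _
  (fun a b => Ric G a b x) (fun a b => Ric H a b (F x))
  (fun m a b => partial m (Ric G a b) x) (fun m a b => partial m (Ric H a b) (F x))).
- by move=> i j k; exact: (la_intertwines A).
- by move=> c d; apply: Ric_local_affine => //; exact: J.
have near_x : \forall y \near x, U y by apply: open_nbhs_nbhs; split; [exact: la_dom A|].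
apply: (@derive_unique _ _ (Ric G a b) (fun y => \sum_p \sum_q Ric H p q (F y) *
      partial a (component F p) y * partial b (component F q) y) x (delta_mx 0 m)).
- apply: (@Ck_derivable _ 0 U) => //; apply: Ck_Ric (la_dom A) _ => i j k.
  exact: (la_smooth_dom A).
- apply: derive_sum => p; apply: derive_sum => q.
  apply: is_derive_eq; first (apply: derive_mul; [apply: derive_mul|exact: la_derive2]).
  + apply: (chain_partial (la_cod A) _ (la_map A Ux)); last by move=> r; exact: la_derive.
    by apply: Ck_Ric (la_cod A) _ => i j k; exact: (la_smooth_cod A).
  + exact: la_derive2.
  + by rewrite mulrDl.
- by near=> y; apply: Ric_local_affine; [|apply: J]; near: y.
Unshelve. all: by end_near. Qed.

End LocalAffine.
End CurvatureInvariance.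

(** * Tensors evaluated on velocities of curves *)

Section CurvesAndTensors.
Variable R : realType.
Implicit Types (U V : set 'rV[R]_2) (x y v w : 'rV[R]_2).
Implicit Types (G H : christoffel R) (F : 'rV[R]_2 -> 'rV[R]_2) (c : R -> 'rV[R]_2).

(** Tangent vectors are rows and column k of [jacobian_mx] belongs to the k-th component of the map,
    so a differential acts by multiplication on the right. *)
Lemma bilinear_push (rho rho' : 'I_2 -> 'I_2 -> R) (J : 'M[R]_2) v w :
  (forall a b, rho a b = \sum_p \sum_q rho' p q * J a p * J b q) ->
  \sum_a \sum_b rho a b * v 0 a * w 0 b =
  \sum_a \sum_b rho' a b * (v *m J) 0 a * (w *m J) 0 b.
Proof. by move=> E; rewrite !sum2 !E !mxE !sum2; ring. Qed.

Lemma trilinear_push (nu nu' : 'I_2 -> 'I_2 -> 'I_2 -> R) (J : 'M[R]_2) (u v w : 'rV[R]_2) :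
  (forall m a b, nu m a b = \sum_r \sum_p \sum_q nu' r p q * J m r * J a p * J b q) ->
  \sum_m \sum_a \sum_b nu m a b * u 0 m * v 0 a * w 0 b =
  \sum_m \sum_a \sum_b nu' m a b * (u *m J) 0 m * (v *m J) 0 a * (w *m J) 0 b.
Proof. by move=> E; rewrite !sum2 !E !mxE !sum2; ring. Qed.

(** The second derivative of the image curve: once the acceleration is -Gamma(v, v) and the second
    derivatives [Q] are replaced through the intertwining relation, the symbols of the source
    cancel. *)
Lemma acceleration_algebra (P : 'I_2 -> 'I_2 -> R) (g h : 'I_2 -> 'I_2 -> 'I_2 -> R)
    (v a w : 'I_2 -> R) (Q : 'I_2 -> 'I_2 -> 'I_2 -> R) k :
  (forall l, a l = - \sum_p \sum_q g p q l * v p * v q) ->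
  (forall m l, Q m l k = \sum_r g m l r * P r k - \sum_p \sum_q h p q k * P m p * P l q) ->
  (forall p, w p = \sum_l v l * P l p) ->
  \sum_l (a l * P l k + v l * \sum_m Q m l k * v m)
  + \sum_p \sum_q h p q k * w p * w q = 0.
Proof. by move=> aE QE wE; rewrite !sum2 !aE !QE !wE !sum2; ring. Qed.

(** Along a geodesic the acceleration terms are the connection terms of nabla rho, so the derivative
    of rho(v, v) is (nabla_v rho)(v, v). *)
Lemma derivative_algebra (g dr : 'I_2 -> 'I_2 -> 'I_2 -> R) (rho : 'I_2 -> 'I_2 -> R)
    (v a : 'I_2 -> R) : (forall l, a l = - \sum_p \sum_q g p q l * v p * v q) ->
  \sum_p \sum_q (((dr 0 p q * v 0 + dr 1 p q * v 1) * v p + rho p q * a p) * v q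
     + rho p q * v p * a q) =
  \sum_m \sum_p \sum_q nabla_expr g rho dr m p q * v m * v p * v q.
Proof. by move=> aE; rewrite /nabla_expr !sum2 !aE !sum2; ring. Qed.

Definition ric_form G x v w : R := \sum_a \sum_b Ric G a b x * v 0 a * w 0 b.

Definition nablaric_form G x (u v w : 'rV[R]_2) : R :=
  \sum_m \sum_a \sum_b nablaRic G m a b x * u 0 m * v 0 a * w 0 b.

Definition velocity c (t : R) : 'rV[R]_2 := \row_k derive1 (fun u => c u 0 k) t.

Lemma velocity_is_derive c t v :
  (forall k, is_derive t (1 : R) (fun u => c u 0 k) (v 0 k)) -> velocity c t = v.
Proof. by move=> dc; apply/rowP => k; rewrite mxE derive1E; have [_ ->] := dc k. Qed.

Lemma is_derive_velocity c t : (forall k, derivable (fun u => c u 0 k) t (1 : R)) ->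
  forall k, is_derive t (1 : R) (fun u => c u 0 k) (velocity c t 0 k).
Proof. by move=> dc k; rewrite mxE derive1E; apply: derivableP. Qed.

Section Push.
Variables (U V : set 'rV[R]_2) (G H : christoffel R) (F : 'rV[R]_2 -> 'rV[R]_2).
Hypothesis A : local_affine U V G H F.

Lemma ric_form_push x v w : U x -> jacobian_mx F x \in unitmx ->
  ric_form G x v w = ric_form H (F x) (v *m jacobian_mx F x) (w *m jacobian_mx F x).
Proof.
move=> Ux J; apply: bilinear_push => a b; rewrite (Ric_local_affine A)//.
by apply: eq_bigr => p _; apply: eq_bigr => q _; rewrite 2![jacobian_mx _ _ _ _]mxE.
Qed.

Lemma nablaric_form_push x (u v w : 'rV[R]_2) :
  (forall x, U x -> jacobian_mx F x \in unitmx) -> U x ->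
  nablaric_form G x u v w = nablaric_form H (F x)
    (u *m jacobian_mx F x) (v *m jacobian_mx F x) (w *m jacobian_mx F x).
Proof.
move=> J Ux; apply: trilinear_push => m a b; rewrite (nablaRic_local_affine A)//.
apply: eq_bigr => r _; apply: eq_bigr => p _; apply: eq_bigr => q _.
by rewrite 3![jacobian_mx _ _ _ _]mxE.
Qed.

Lemma velocity_push c t : U (c t) -> (forall k, derivable (fun u => c u 0 k) t (1 : R)) ->
  forall k, is_derive t (1 : R) (fun u => F (c u) 0 k) ((velocity c t *m jacobian_mx F (c t)) 0 k).
Proof.
move=> Ut dc k; rewrite mxE sum2 2![jacobian_mx _ _ _ _]mxE mulrC [_ * partial 1 _ _]mulrC.
by apply: (chain_curve (la_dom A) (la_smooth A k 1) Ut); exact: is_derive_velocity.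
Qed.

Lemma acceleration_push c (t : R) (a : 'I_2 -> R) : U (c t) ->
  (\forall u \near t, U (c u) /\ forall k, derivable (fun u => c u 0 k) u (1 : R)) ->
  (forall k, is_derive t (1 : R) (fun u => velocity c u 0 k) (a k)) ->
  (forall k, a k + \sum_p \sum_q G p q k (c t) * velocity c t 0 p * velocity c t 0 q = 0) ->
  forall k, exists2 b, is_derive t (1 : R) (fun u => velocity (F \o c) u 0 k) b &
    b + \sum_p \sum_q H p q k (F (c t)) * velocity (F \o c) t 0 p * velocity (F \o c) t 0 q = 0.
Proof.
move=> Ut near_t da ga k.
have vE u : U (c u) -> (forall k, derivable (fun u => c u 0 k) u (1 : R)) ->
    velocity (F \o c) u = velocity c u *m jacobian_mx F (c u).
  by move=> Uu du; apply: velocity_is_derive => j; exact: velocity_push.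
have dc : forall k, derivable (fun u => c u 0 k) t (1 : R).
  by have [_] := nbhs_singleton near_t.
pose P l r := partial l (component F r) (c t).
pose Q m l r := partial m (partial l (component F r)) (c t).
exists (\sum_l (a l * P l k + velocity c t 0 l * \sum_m Q m l k * velocity c t 0 m)).
  apply: (@near_eq_is_derive _ _ _ (fun u => \sum_l velocity c u 0 l * partial l (component F k) (c u))).
    near=> u; rewrite vE; [|by case: (near near_t u _)..].
    by rewrite [RHS]mxE; apply: eq_bigr => l _; rewrite [jacobian_mx _ _ _ _]mxE.
  apply: derive_sum => l; apply: derive_mul => //; rewrite sum2.
  apply: (chain_curve (la_dom A) (CkS l (la_smooth A k 2)) Ut); exact: is_derive_velocity.
rewrite vE//.
have aE l : a l = - \sum_p \sum_q G p q l (c t) * velocity c t 0 p * velocity c t 0 q.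
  by apply/eqP; rewrite -addr_eq0 ga.
have QE m l : Q m l k = \sum_r G m l r (c t) * P r k -
    \sum_p \sum_q H p q k (F (c t)) * P m p * P l q.
  by rewrite (la_intertwines A)// addrK.
have JE p : (velocity c t *m jacobian_mx F (c t)) 0 p = \sum_l velocity c t 0 l * P l p.
  by rewrite [LHS]mxE; apply: eq_bigr => l _; rewrite [jacobian_mx _ _ _ _]mxE.
exact: (@acceleration_algebra P (fun p q k => G p q k (c t)) (fun p q k => H p q k (F (c t)))
  (fun p => velocity c t 0 p) a _ Q k aE QE JE).
Unshelve. all: by end_near. Qed.

End Push.

Lemma continuous_velocity c t (a : 'I_2 -> R) :
  (forall k, is_derive t (1 : R) (fun u => velocity c u 0 k) (a k)) ->
  {for t, continuous (velocity c)}.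
Proof.
move=> da; apply: cvg_rV2 => k; apply/differentiable_continuous/derivable1_diffP.
by have [] := da k.
Qed.

Lemma continuous_ric_form U G (c v w : R -> 'rV[R]_2) t :
  open U -> (forall i j k, smooth U (G i j k)) -> U (c t) ->
  {for t, continuous c} -> {for t, continuous v} -> {for t, continuous w} ->
  {for t, continuous (fun u => ric_form G (c u) (v u) (w u))}.
Proof.
move=> oU sG Ut cc cv cw.
have cR a b : {for t, continuous (fun u => Ric G a b (c u))}.
  apply: (@continuous_comp _ _ _ c (Ric G a b)) => //.
  by apply: (@Ck0 _ 0 U) => //; apply: Ck_Ric => // i j k; exact: sG.
rewrite /ric_form (_ : (fun u => _) = fun u =>
  Ric G 0 0 (c u) * v u 0 0 * w u 0 0 + Ric G 0 1 (c u) * v u 0 0 * w u 0 1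
  + (Ric G 1 0 (c u) * v u 0 1 * w u 0 0 + Ric G 1 1 (c u) * v u 0 1 * w u 0 1)); last first.
  by apply/funext => u; rewrite !sum2.
have cM a b : {for t, continuous (fun u => Ric G a b (c u) * v u 0 a * w u 0 b)}.
  apply: continuousM; last exact: cvg_rV2_coord.
  by apply: continuousM; [exact: cR|exact: cvg_rV2_coord].
by apply: continuousD; apply: continuousD; exact: cM.
Qed.

Lemma continuous_nablaric_form U G (c u v w : R -> 'rV[R]_2) t :
  open U -> (forall i j k, smooth U (G i j k)) -> U (c t) ->
  {for t, continuous c} -> {for t, continuous u} -> {for t, continuous v} ->
  {for t, continuous w} ->
  {for t, continuous (fun s => nablaric_form G (c s) (u s) (v s) (w s))}.
Proof.
move=> oU sG Ut cc cu cv cw.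
have cM m a b : {for t, continuous (fun s => nablaRic G m a b (c s) * u s 0 m * v s 0 a * w s 0 b)}.
  apply: continuousM; last exact: cvg_rV2_coord.
  apply: continuousM; last exact: cvg_rV2_coord.
  apply: continuousM; last exact: cvg_rV2_coord.
  apply: (@continuous_comp _ _ _ c (nablaRic G m a b)) => //.
  by apply: continuous_nablaRic oU _ Ut => i j k; exact: sG.
pose f m a b s := nablaRic G m a b (c s) * u s 0 m * v s 0 a * w s 0 b.
rewrite /nablaric_form (_ : (fun s => _) = fun s =>
  f 0 0 0 s + f 0 0 1 s + (f 0 1 0 s + f 0 1 1 s)
  + (f 1 0 0 s + f 1 0 1 s + (f 1 1 0 s + f 1 1 1 s))); last first.
  by apply/funext => s; rewrite !sum2.
by apply: continuousD; apply: continuousD; apply: continuousD; exact: cM.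
Qed.

(** This turns a pointwise relation between rho and nabla rho into a differential equation for
    rho(s', s'). *)
Lemma derive_ric_form U G c t (a : 'I_2 -> R) :
  open U -> (forall i j k, smooth U (G i j k)) -> U (c t) ->
  (forall k, derivable (fun u => c u 0 k) t (1 : R)) ->
  (forall k, is_derive t (1 : R) (fun u => velocity c u 0 k) (a k)) ->
  (forall k, a k + \sum_p \sum_q G p q k (c t) * velocity c t 0 p * velocity c t 0 q = 0) ->
  is_derive t (1 : R) (fun u => ric_form G (c u) (velocity c u) (velocity c u))
    (nablaric_form G (c t) (velocity c t) (velocity c t) (velocity c t)).
Proof.
move=> oU sG Ut dc da ga.
have CR p q : Ck 1 U (Ric G p q) by apply: Ck_Ric => // i j k; exact: sG.
have aE l : a l = - \sum_p \sum_q G p q l (c t) * velocity c t 0 p * velocity c t 0 q.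
  by apply/eqP; rewrite -addr_eq0 ga.
have := @derivative_algebra (fun p q k => G p q k (c t))
  (fun m p q => partial m (Ric G p q) (c t)) (fun p q => Ric G p q (c t))
  (fun p => velocity c t 0 p) a aE.
rewrite -[RHS]/(nablaric_form G (c t) (velocity c t) (velocity c t) (velocity c t)) => <-.
rewrite /ric_form; apply: derive_sum => p; apply: derive_sum => q.
apply: derive_mul; apply: derive_mul.
by apply: (chain_curve oU (CR p q) Ut); exact: is_derive_velocity.
Qed.

End CurvesAndTensors.

(** * Affine maps between surfaces, read in charts *)

Section AffineMaps.
Variable R : realType.
Implicit Types S T : affine_surface R.

Lemma local_dom_open S T (F : S -> T) i j : continuous F -> open (local_dom F i j).
Proof.
move=> cF; rewrite openE => _ [p [pi Fpj] <-].
have Op := @chart_open R S i.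
have ip : (chart i @` dom i) (chart i p) by exists p.
have ci : {for chart i p, continuous (chart_inv i)} by exact: chart_inv_continuous.
have : \forall x \near chart i p, (chart i @` dom i) x /\ dom j (F (chart_inv i x)).
  near=> x; split; near: x; first exact: open_nbhs_nbhs.
  have : {for chart i p, continuous (F \o chart_inv i)}.
    by apply: continuous_comp => //; exact: cF.
  apply; rewrite /= chartK//; apply: open_nbhs_nbhs; split=> //; exact: (@dom_open R _ _).
apply: filterS => x [[q qi <-]]; rewrite chartK// => Fq.
by exists q.
Unshelve. all: by end_near. Qed.

Lemma local_dom_chart S T (F : S -> T) i j p : dom i p -> dom j (F p) ->
  local_dom F i j (chart i p).
Proof. by move=> pi Fpj; exists p. Qed.

Lemma local_expr_chart S T (F : S -> T) i j p : dom i p ->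
  local_expr F i j (chart i p) = chart j (F p).
Proof. by move=> pi; rewrite /local_expr/= chartK. Qed.

Lemma affine_map_local S T (F : S -> T) i j : affine_map F ->
  local_affine (local_dom F i j) (chart j @` dom j) (@gamma R S i) (@gamma R T j) (local_expr F i j).
Proof.
move=> [cF aF]; have [sF iF] := aF i j.
have sub : local_dom F i j `<=` chart i @` dom i by move=> _ [p [pi _] <-]; exists p.
split=> //.
- exact: local_dom_open.
- exact: (@chart_open R T j).
- by move=> _ [p [pi Fpj] <-]; rewrite local_expr_chart//; exists (F p).
- by move=> a b k n; apply: sub_Ck sub _; exact: gamma_smooth.
- exact: gamma_smooth.
- by move=> a b k x /sub; exact: gamma_sym.
- by move=> a b k x; exact: gamma_sym.
Qed.

(** Differentiating the chart expression of [F' \o F = id] makes the two Jacobians inverse to each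
    other. *)
Lemma affine_diffeomorphism_immersion S (F : S -> S) :
  affine_diffeomorphism F -> affine_map F /\ immersion F.
Proof.
move=> [F' [FK F'K aF aF']]; split=> // i j x xd.
have A := affine_map_local i j aF; have A' := affine_map_local j i aF'.
have inv y : local_dom F i j y -> local_expr F' j i (local_expr F i j y) = y.
  by move=> [p [pi Fpj] <-]; rewrite !local_expr_chart// FK.
have Fx : local_dom F' j i (local_expr F i j x).
  case: xd => p [pi Fpj] <-; rewrite local_expr_chart//.
  by apply: local_dom_chart => //; rewrite FK.
suff : jacobian_mx (local_expr F i j) x *m jacobian_mx (local_expr F' j i) (local_expr F i j x)
    = 1%:M by move=> /mulmx1_unit[].
apply/matrixP => a k; rewrite mxE.
under eq_bigr do rewrite 2!(mxE matrix_key).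
apply: (@derive_unique _ _ (fun y => component (local_expr F' j i) k (local_expr F i j y))
   (fun y => y 0 k) x (delta_mx 0 a)).
- under eq_bigr do rewrite mulrC.
  apply: (chain_partial (la_dom A') (la_smooth A' k 1) Fx) => r; exact: la_derive A _ _ _ xd.
- apply: is_derive_eq; first exact: is_derive_coord.
  by rewrite !mxE eqxx/= eq_sym.
- near=> y; rewrite /component inv//; near: y.
  by apply: open_nbhs_nbhs; split=> //; exact: la_dom A.
Unshelve. all: by end_near. Qed.

(** Read in two different charts the identity is a change of chart, so independence of the chart
    becomes a case of invariance under affine maps. *)
Lemma id_affine_diffeomorphism S : affine_diffeomorphism (@id S).
Proof.
have a : affine_map (@id S).
  split; first by move=> x; exact: cvg_id.
  by move=> i j; split; [exact: transition_smooth|exact: gamma_transition].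
by exists id; split.
Qed.

Definition tensors_agree S T (i : atlas S) (p : S) (j : atlas T) (q : T) (J : 'M[R]_2) : Prop :=
  (forall v w, ric_form (@gamma R S i) (chart i p) v w =
    ric_form (@gamma R T j) (chart j q) (v *m J) (w *m J)) /\
  (forall u v w, nablaric_form (@gamma R S i) (chart i p) u v w =
    nablaric_form (@gamma R T j) (chart j q) (u *m J) (v *m J) (w *m J)).

Lemma affine_tensors S T (F : S -> T) i p j :
  affine_map F -> immersion F -> dom i p -> dom j (F p) ->
  tensors_agree i p j (F p) (jacobian_mx (local_expr F i j) (chart i p)).
Proof.
move=> aF iF pi Fpj; have A := affine_map_local i j aF.
have xd := local_dom_chart pi Fpj.
rewrite /tensors_agree -(@local_expr_chart S T F i j p pi).
split=> [v w|u v w]; first exact: (ric_form_push A _ _ xd (iF _ _ _ xd)).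
exact: (nablaric_form_push A _ _ _ (iF i j) xd).
Qed.

(* By homogeneity the tensors at any point of T are those at one point of S. *)
Lemma homogeneous_tensors S T (F : S -> T) i p q j :
  homogeneous T -> affine_map F -> immersion F -> dom i p -> dom j q ->
  exists2 J, J \in unitmx & @tensors_agree S T i p j q J.
Proof.
move=> hT aF iF pi qj; have [k Fpk] := dom_cover (F p).
have [D dD Dq] := hT (F p) q; have [aD iD] := affine_diffeomorphism_immersion dD.
have DFj : dom j (D (F p)) by rewrite Dq.
have [r1 n1] := affine_tensors aF iF pi Fpk.
have [r2 n2] := affine_tensors aD iD Fpk DFj.
rewrite Dq in r2 n2.
exists (jacobian_mx (local_expr F i k) (chart i p) *m
  jacobian_mx (local_expr D k j) (chart k (F p))).
  by rewrite unitmx_mul iF ?iD//; apply: local_dom_chart.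
by split=> *; rewrite ?(r1, n1, r2, n2) !mulmxA.
Qed.

End AffineMaps.

(** * Geodesics in charts and their images under affine maps *)

Section Geodesics.
Variable R : realType.
Implicit Types S T : affine_surface R.

Lemma geodesic_near S (J : set R) (s : R -> S) i t : open J -> geodesic_on J s ->
  J t -> dom i (s t) -> \forall u \near t, J u /\ dom i (s u).
Proof.
move=> oJ [cs _] Jt ti; near=> u; split; near: u; first exact: open_nbhs_nbhs.
by apply: (cs t Jt); apply: open_nbhs_nbhs; split=> //; exact: (@dom_open R _ _).
Unshelve. all: by end_near. Qed.

Lemma velocityE (c : R -> 'rV[R]_2) k : (fun u => velocity c u 0 k) = derive1 (fun u => c u 0 k).
Proof. by apply/funext => u; rewrite mxE. Qed.

Lemma geodesic_data S (J : set R) (s : R -> S) i t : open J -> geodesic_on J s ->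
  J t -> dom i (s t) -> let c u := chart i (s u) in
  [/\ {for t, continuous c},
      \forall u \near t, forall k, derivable (fun u => c u 0 k) u (1 : R),
      forall k, derivable (fun u => velocity c u 0 k) t (1 : R) &
      forall k, 'D_1 (fun u => velocity c u 0 k) t + \sum_p \sum_q @gamma R S i p q k (c t) *
          velocity c t 0 p * velocity c t 0 q = 0].
Proof.
move=> oJ gs Jt ti c; have [cs es] := gs.
split.
- apply: (@continuous_comp _ _ _ s (chart i)); first exact: cs.
  exact: chart_continuous.
- near=> u; have [Ju ui] : J u /\ dom i (s u) by near: u; exact: geodesic_near gs _ _.
  by move=> k; have [] := es i u Ju ui k.
- by move=> k; have [_ + _] := es i t Jt ti k; rewrite velocityE.
move=> k; have [_ _] := es i t Jt ti k; rewrite derive1E -velocityE => {3}<-; congr (_ + _).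
by apply: eq_bigr => p _; apply: eq_bigr => q _; rewrite 2!(mxE matrix_key).
Unshelve. all: by end_near. Qed.

Lemma geodesic_image S T (F : S -> T) (J : set R) (s : R -> S) :
  affine_map F -> open J -> geodesic_on J s -> geodesic_on J (F \o s).
Proof.
move=> aF oJ gs; have [cs es] := gs; have [cF _] := aF; split.
  by move=> t Jt; apply: continuous_comp; [exact: cs|exact: cF].
move=> j t Jt tj x k; have [i ti] := dom_cover (s t).
have [cc dc dv gv] := geodesic_data oJ gs Jt ti.
set c := fun u => chart i (s u) in cc dc dv gv.
have A := affine_map_local i j aF.
have dt : local_dom F i j (c t) by exact: local_dom_chart.
have near_t : \forall u \near t, local_dom F i j (c u) /\
    forall k, derivable (fun u => c u 0 k) u (1 : R).
  near=> u; split; last by near: u.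
  near: u; apply: cc; apply: open_nbhs_nbhs; split=> //; exact: la_dom A.
have near_e : \forall u \near t, chart j (F (s u)) = local_expr F i j (c u).
  near=> u; have [_ ui] : J u /\ dom i (s u) by near: u; exact: geodesic_near gs _ _.
  by rewrite local_expr_chart.
have [b db eb] := acceleration_push A dt near_t (fun k => derivableP (dv k)) gv k.
have near_v : \forall u \near t, velocity (fun u => chart j (F (s u))) u =
    velocity (local_expr F i j \o c) u.
  near=> u; apply/rowP => l; rewrite !mxE !derive1E; apply: near_eq_derive.
  have : \forall u \near u, chart j (F (s u)) = local_expr F i j (c u) by near: u; exact: (near_join near_e).
  by apply: filterS => z ->.
have near_vk l : \forall u \near t, velocity (local_expr F i j \o c) u 0 l = derive1 (x l) u.
  by near=> u; rewrite -(near near_v u)// mxE.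
have {}db : is_derive t (1 : R) (derive1 (x k)) b := near_eq_is_derive (near_vk k) db.
split.
- apply: (@near_eq_derivable _ _ _ (fun u => local_expr F i j (c u) 0 k)).
    by apply: filterS near_e => u E; rewrite /x /= E.
  by have [] := velocity_push A dt (fun k => (nbhs_singleton near_t).2 k) k.
- by case: db.
- rewrite [X in X + _]derive1E; have [_ ->] := db; apply: etrans eb; congr (_ + _).
  apply: eq_bigr => p _; apply: eq_bigr => q _.
  by rewrite [chart j _](nbhs_singleton near_e) !(nbhs_singleton (near_vk _)).
Unshelve. all: by end_near. Qed.

End Geodesics.

(** * Obstructions to a geodesic completion *)

Section RealOde.
Variable R : realType.
Implicit Types (f g : R -> R) (t u : R).

(** The order of the endpoints is left open, so that uniqueness holds forwards and backwards in
    time. *)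
Definition between t0 t1 u := (t0 <= u <= t1) || (t1 <= u <= t0).

(** The product E(u) exp(-K u) is nonincreasing. *)
Lemma gronwall_ge0 (E dE : R -> R) (K t0 t1 : R) : t0 <= t1 ->
  (forall u, t0 <= u <= t1 -> is_derive u (1 : R) E (dE u)) ->
  (forall u, t0 <= u <= t1 -> dE u <= K * E u) -> E t0 <= 0 -> E t1 <= 0.
Proof.
move=> t01 hE hK E0.
pose h u := E u * expR (- K * u).
have dh u : t0 <= u <= t1 -> is_derive u (1 : R) h ((dE u - K * E u) * expR (- K * u)).
  move=> ut; have hu := hE u ut.
  have he : is_derive u (1 : R) (fun u => expR (- K * u)) (expR (- K * u) * (- K)).
    apply: (@is_derive1_comp _ expR (fun u => - K * u)).
    by apply: is_derive_eq; rewrite /GRing.scale/= mulr1.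
  by apply: is_derive_eq (derive_mul hu he) _; ring.
have : h t1 <= h t0.
  apply: (@ler0_derive1_le_cc _ h t0 t1); rewrite ?lexx//=; last first.
  - by rewrite in_itv/= t01 lexx.
  - by rewrite in_itv/= t01 lexx.
  - apply: derivable_within_continuous => u; rewrite in_itv/= => /dh[] //.
  - move=> u; rewrite in_itv/= => /andP[/ltW a /ltW b]; rewrite derive1E.
    have [_ ->] := dh u (introT andP (conj a b)).
    by rewrite pmulr_lle0 ?expR_gt0// subr_le0 hK// a b.
  - by move=> u; rewrite in_itv/= => /andP[/ltW a /ltW b]; have [] := dh u (introT andP (conj a b)).
rewrite /h => hh; have : E t1 * expR (- K * t1) <= 0.
  by apply: le_trans hh _; rewrite pmulr_lle0 ?expR_gt0.
by rewrite pmulr_lle0 ?expR_gt0.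
Qed.

(** The energy E = f0^2 + f1^2 satisfies E' <= 4 K E. Backward time is reduced to forward time by
    the reflection u |-> -u. *)
Lemma gronwall (f0 f1 g0 g1 : R -> R) (K t0 t1 : R) :
  (forall u, between t0 t1 u -> is_derive u (1 : R) f0 (g0 u)) ->
  (forall u, between t0 t1 u -> is_derive u (1 : R) f1 (g1 u)) ->
  (forall u, between t0 t1 u -> `|g0 u| <= K * (`|f0 u| + `|f1 u|)) ->
  (forall u, between t0 t1 u -> `|g1 u| <= K * (`|f0 u| + `|f1 u|)) ->
  f0 t0 = 0 -> f1 t0 = 0 -> f0 t1 = 0 /\ f1 t1 = 0.
Proof.
wlog t01 : f0 f1 g0 g1 t0 t1 / t0 <= t1 => [hw|].
  have [|t10] := leP t0 t1; first exact: hw.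
  move=> d0 d1 b0 b1 z0 z1.
  have btw u : between (- t0) (- t1) u -> between t0 t1 (- u).
    rewrite /between => /orP[]/andP[a b]; apply/orP; [right|left];
    by apply/andP; split; lra.
  have dN f g u : is_derive (- u) (1 : R) f (g (- u)) ->
      is_derive u (1 : R) (fun u => f (- u)) (- g (- u)).
    by move=> df; rewrite -mulrN1; apply: (@is_derive1_comp _ f (fun u => - u)).
  have := hw (fun u => f0 (- u)) (fun u => f1 (- u)) (fun u => - g0 (- u)) (fun u => - g1 (- u))
    (- t0) (- t1); rewrite !opprK; apply=> //.
  - by rewrite lerN2 ltW.
  - by move=> u /btw/d0/dN.
  - by move=> u /btw/d1/dN.
  - by move=> u /btw/b0; rewrite normrN.
  - by move=> u /btw/b1; rewrite normrN.
have btw u : t0 <= u <= t1 -> between t0 t1 u by rewrite /between => ->.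
move=> d0 d1 b0 b1 z0 z1.
pose E u := f0 u * f0 u + f1 u * f1 u.
have E0 : E t1 <= 0.
  apply: (@gronwall_ge0 E (fun u => g0 u * f0 u + f0 u * g0 u + (g1 u * f1 u + f1 u * g1 u)) (4 * K) t0) => //.
  - move=> u /btw ub; have h0 := d0 u ub; have h1 := d1 u ub.
    by apply: derive_add; apply: derive_mul.
  - move=> u /btw ub; have := b0 u ub; have := b1 u ub.
    have e0 : E u = `|f0 u| ^+ 2 + `|f1 u| ^+ 2 by rewrite !real_normK ?num_real// !expr2.
    have := ler_norm (g0 u * f0 u); have := ler_norm (g1 u * f1 u).
    rewrite e0 !normrM; have := normr_ge0 (f0 u); have := normr_ge0 (f1 u).
    have := normr_ge0 (g0 u); have := normr_ge0 (g1 u).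
    rewrite ![f0 u * g0 u]mulrC ![f1 u * g1 u]mulrC.
    move: (g0 u * f0 u) (g1 u * f1 u) `|g0 u| `|g1 u| `|f0 u| `|f1 u| => p q G0 G1 F0 F1.
    move=> G10 G00 F10 F00 hq hp hG1 hG0.
    have K0 : 0 <= K * (F0 + F1) by apply: le_trans hG0.
    have a0 : G0 * F0 <= K * (F0 + F1) * F0 by exact: ler_wpM2r.
    have a1 : G1 * F1 <= K * (F0 + F1) * F1 by exact: ler_wpM2r.
    have [K1|K1] := leP 0 K.
      have : 0 <= K * (F0 - F1) ^+ 2 by rewrite mulr_ge0// sqr_ge0.
      by lra.
    have F01 : F0 + F1 <= 0 by rewrite -(nmulr_rge0 _ K1).
    have [F0z F1z] : F0 = 0 /\ F1 = 0 by split; lra.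
    by move: hp hq; rewrite F0z F1z; lra.
  - by rewrite /E z0 z1 !mul0r addr0.
have := E0; rewrite /E -!expr2 => {}E0.
by split; apply/eqP; rewrite -sqrf_eq0; apply/eqP; have := sqr_ge0 (f0 t1); have := sqr_ge0 (f1 t1); lra.
Qed.

Lemma continuous_bounded_between g t0 t1 :
  (forall u, between t0 t1 u -> {for u, continuous g}) ->
  exists K : R, forall u, between t0 t1 u -> `|g u| <= K.
Proof.
wlog t01 : t0 t1 / t0 <= t1 => [hw|cg].
  have [|t10] := leP t0 t1; first exact: hw.
  have sym u : between t0 t1 u = between t1 t0 u by rewrite /between orbC.
  move=> cg; have [|K hK] := hw t1 t0 (ltW t10); first by move=> u; rewrite -sym; exact: cg.
  by exists K => u; rewrite sym; exact: hK.
have cn : {within `[t0, t1], continuous (fun u => `|g u|)}.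
  apply: continuous_in_subspaceT => u; rewrite inE/= in_itv/= => ut.
  by apply: continuous_comp; [apply: cg; rewrite /between ut|exact: norm_continuous].
have [c _ hc] := EVT_max t01 cn; exists `|g c| => u.
rewrite /between => /orP[ut|/andP[a b]]; first by apply: hc; rewrite in_itv.
by apply: hc; rewrite in_itv/=; apply/andP; split; lra.
Qed.

(** The source of all uniqueness statements below. With zero coefficients it says that a function
    with zero derivative and a zero vanishes. *)
Lemma linear_ode_zero (A : 'I_2 -> 'I_2 -> R -> R) (f : 'I_2 -> R -> R) t0 t1 :
  (forall k u, between t0 t1 u -> is_derive u (1 : R) (f k) (\sum_l A k l u * f l u)) ->
  (forall k l u, between t0 t1 u -> {for u, continuous (A k l)}) ->
  (forall k, f k t0 = 0) -> forall k, f k t1 = 0.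
Proof.
move=> df cA f0.
have bd k l : exists K : R, forall u, between t0 t1 u -> `|A k l u| <= K.
  by apply: continuous_bounded_between => u; exact: cA.
have [K00 h00] := bd 0 0; have [K01 h01] := bd 0 1.
have [K10 h10] := bd 1 0; have [K11 h11] := bd 1 1.
have [K hK] : exists K : R, forall k l u, between t0 t1 u -> `|A k l u| <= K.
  exists (`|K00| + `|K01| + `|K10| + `|K11|) => k l u ub.
  have nn (x : R) : 0 <= `|x| /\ x <= `|x| by rewrite normr_ge0 ler_norm.
  have := h00 u ub; have := h01 u ub; have := h10 u ub; have := h11 u ub.
  have [] := nn K00; have [] := nn K01; have [] := nn K10; have [] := nn K11.
  by move: k l; apply: I2_ind; apply: I2_ind; lra.
have [] := @gronwall (f 0) (f 1) (fun u => \sum_l A 0 l u * f l u)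
  (fun u => \sum_l A 1 l u * f l u) K t0 t1 (df 0) (df 1) _ _ (f0 0) (f0 1).
- move=> u ub; rewrite sum2 (le_trans (ler_normD _ _))// mulrDr !normrM.
  by apply: lerD; apply: ler_wpM2r; rewrite ?normr_ge0//; exact: hK.
- move=> u ub; rewrite sum2 (le_trans (ler_normD _ _))// mulrDr !normrM.
  by apply: lerD; apply: ler_wpM2r; rewrite ?normr_ge0//; exact: hK.
by move=> z0 z1; apply: I2_ind.
Qed.

(* A nonzero solution of r'^2 = k r^3 is k^-1 (2 / (t - t1))^2, which is not global. *)
Lemma no_global_solution (r n : R -> R) (k t0 : R) : 0 < k ->
  (forall t, is_derive t (1 : R) r (n t)) -> (forall t, n t ^+ 2 = k * r t ^+ 3) -> r t0 = 0.
Proof.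
move=> k0 dr nr.
have r0 t : 0 <= r t.
  have : 0 <= r t ^+ 3 by rewrite -(pmulr_rge0 _ k0) -nr sqr_ge0.
  by rewrite exprn_odd_ge0.
apply/eqP/negPn/negP => rt0.
have cr u : {for u, continuous r} by apply/differentiable_continuous/derivable1_diffP; have [] := dr u.
have rp t : 0 < r t.
  (* A zero of r would spread: n^2 = (k r) r^2 bounds |r'| by a multiple of r on the compact
     interval, and Gronwall gives r t0 = 0. *)
  rewrite lt_def r0 andbT; apply/negP => /eqP rt; move/negP: rt0; apply.
  have [K hK] := @continuous_bounded_between (fun u => k * r u) t t0
    (fun u _ => continuousM (@cst_continuous _ _ k _) (cr u)).
  have [] // := @gronwall r (fun=> 0) n (fun=> 0) (1 + K) t t0 (fun u _ => dr u)
    (fun u _ => is_derive_cst _ _ _) _ _ rt erefl; last by move=> ->.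
    move=> u ub; rewrite normr0 addr0 (ger0_norm (r0 u)).
    have := hK u ub; rewrite ger0_norm; last by rewrite mulr_ge0// ltW.
    move=> rK; have K0 : 0 <= 1 + K by rewrite addr_ge0// (le_trans _ rK)// mulr_ge0// ltW.
    rewrite -ler_sqr ?nnegrE ?mulr_ge0// real_normK ?num_real// nr exprS mulrA exprMn.
    apply: ler_wpM2r; first exact: sqr_ge0.
    have : 0 <= K by apply: le_trans rK; rewrite mulr_ge0// ltW.
    by move: (k * r u) rK => x; nra.
  by move=> u ub; rewrite normr0 addr0 mulr_ge0// (le_trans (normr_ge0 (k * r u)))// addrC ler_wpDr// hK.
(* The function r^(-1/2) linearises the equation: its derivative has constant absolute value sqrt k
   / 2. *)
pose g t := (Num.sqrt (r t))^-1.
have gp t : 0 < g t by rewrite invr_gt0 sqrtr_gt0.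
pose dg t := - (Num.sqrt (r t)) ^- 2 * ((2 * Num.sqrt (r t))^-1 * n t).
have hg t : is_derive t (1 : R) g (dg t).
  apply: is_deriveV; first by rewrite gt_eqF// sqrtr_gt0.
  apply: (@is_derive1_comp _ Num.sqrt r); exact: is_derive1_sqrt.
pose L := Num.sqrt k / 2.
have L0 : 0 < L by rewrite divr_gt0// sqrtr_gt0.
have dgE t : `|dg t| = L.
  have s0 : 0 < Num.sqrt (r t) by rewrite sqrtr_gt0.
  have sE : Num.sqrt (r t) ^+ 2 = r t by rewrite sqr_sqrtr.
  have nE := nr t; rewrite -sE in nE.
  apply/eqP; rewrite -(eqrXn2 (n := 2))// ?(ltW L0)// real_normK ?num_real//.
  rewrite /dg /L; move: (Num.sqrt (r t)) s0 nE => s s0 nE.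
  have -> : (- s ^- 2 * ((2 * s)^-1 * n t)) ^+ 2 = n t ^+ 2 / (4 * s ^+ 6).
    by field; rewrite gt_eqF.
  rewrite nE expr_div_n sqr_sqrtr ?(ltW k0)//; apply/eqP; field.
  by rewrite gt_eqF.
have iso t u : t < u -> `|g u - g t| = L * (u - t).
  move=> tu; have [|c _ ->] := MVT tu (fun x _ => hg x).
    by apply: derivable_within_continuous => x _; have [] := hg x.
  by rewrite normrM dgE gtr0_norm// subr_gt0.
(* A decrease of L a = g 0 + L would make g negative, so g increases by that amount from 0 to a and
   also from 0 to -a. The values at a and -a are then equal, against [iso] between these two
   points. *)
pose a := g 0 / L + 1.
have a0 : 0 < a by rewrite addr_gt0// divr_gt0.
have La : L * a = g 0 + L by rewrite /a mulrDr mulr1 mulrCA divff ?mulr1// gt_eqF.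
have Na0 : - a < 0 by rewrite oppr_lt0.
have h1 := iso _ _ a0; have h2 := iso _ _ Na0; have h3 := iso _ _ (lt_trans Na0 a0).
rewrite subr0 La in h1; rewrite sub0r opprK La in h2; rewrite opprK mulrDr La in h3.
have : 0 < L := L0; move: (L) h1 h2 h3 => L' h1 h2 h3 L'0.
move: h1 h2 h3; have := gp a; have := gp (- a); have := gp 0; move: (g 0) (g a) (g (- a)) => x y z x0 z0 y0.
by do 3 case: (ler0P (_ - _)) => _; lra.
Qed.

End RealOde.

Section PlaneGeodesics.
Variable R : realType.
Implicit Types (M : plane_connection R) (s : R -> 'rV[R]_2) (J : set R).

Lemma plane_geodesic M J s (v a : 'I_2 -> R -> R) : open J ->
  (forall k t, J t -> is_derive t (1 : R) (fun u => s u 0 k) (v k t)) ->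
  (forall k t, J t -> is_derive t (1 : R) (v k) (a k t)) ->
  (forall k t, J t -> a k t + \sum_p \sum_q Gam M p q k (s t) * v p t * v q t = 0) ->
  geodesic_on J (s : R -> plane M).
Proof.
move=> oJ ds dv eqn; split.
  move=> t Jt; apply: cvg_rV2 => k; apply/differentiable_continuous/derivable1_diffP.
  by have [] := ds k t Jt.
move=> i t Jt _ x k.
have xE l u : J u -> derive1 (x l) u = v l u.
  by move=> Ju; rewrite derive1E; have [_ <-] := ds l u Ju.
have dx : is_derive t (1 : R) (derive1 (x k)) (a k t).
  apply: near_eq_is_derive (dv k t Jt); near=> u; rewrite xE//; near: u.
  exact: open_nbhs_nbhs.
split; [by have [] := ds k t Jt|by case: dx|].
rewrite derive1E; have [_ ->] := dx; apply: etrans (eqn k t Jt); congr (_ + _).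
by apply: eq_bigr => p _; apply: eq_bigr => q _; rewrite !xE.
Unshelve. all: by end_near. Qed.

Lemma plane_geodesicE M J s : open J -> geodesic_on J (s : R -> plane M) ->
  exists a : 'I_2 -> R -> R,
  [/\ forall k t, J t -> is_derive t (1 : R) (fun u => s u 0 k) (velocity s t 0 k),
      forall k t, J t -> is_derive t (1 : R) (fun u => velocity s u 0 k) (a k t) &
      forall k t, J t -> a k t + \sum_p \sum_q Gam M p q k (s t) * velocity s t 0 p * velocity s t 0 q = 0].
Proof.
move=> oJ gs; exists (fun k t => 'D_1 (fun u => velocity s u 0 k) t); split=> k t Jt;
have [_ dc dv gv] := @geodesic_data R (plane M) J s tt t oJ gs Jt I.
- by apply: is_derive_velocity => l; exact: (nbhs_singleton dc).
- exact: derivableP.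
- exact: gv.
Qed.

Lemma plane_velocity J s (v : 'I_2 -> R -> R) t :
  (forall k t, J t -> is_derive t (1 : R) (fun u => s u 0 k) (v k t)) -> J t ->
  velocity s t = \row_k v k t.
Proof. by move=> ds Jt; apply: velocity_is_derive => k; rewrite mxE; exact: ds. Qed.

End PlaneGeodesics.

(** * Three criteria for essential incompleteness *)

Section EssentialIncompleteness.
Variable R : realType.
Implicit Types (M : plane_connection R) (S T : affine_surface R) (J : set R).

Lemma extended_geodesic S T (F : S -> T) J (s : R -> S) :
  affine_map F -> geodesically_complete T -> open J -> is_interval J -> J !=set0 ->
  geodesic_on J s -> exists2 c : R -> T, geodesic_on setT c & forall t, J t -> c t = F (s t).
Proof. by move=> aF cT oJ iJ J0 gs; apply: cT => //; exact: geodesic_image. Qed.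

(** Reads the tensors on the velocity of the extension [c] as tensors on the velocity of [s],
    through the Jacobian [L] of the embedding. *)
Lemma geodesic_pullback S T (F : S -> T) J (s : R -> S) (c : R -> T) i j t :
  affine_map F -> immersion F -> open J -> geodesic_on J s ->
  (forall t, J t -> c t = F (s t)) -> J t -> dom i (s t) -> dom j (c t) ->
  exists L : 'M[R]_2, [/\ L \in unitmx, tensors_agree i (s t) j (c t) L &
    velocity (fun u => chart j (c u)) t = velocity (fun u => chart i (s u)) t *m L].
Proof.
move=> aF iF oJ gs cs Jt ti tj.
have tj' : dom j (F (s t)) by rewrite -cs.
have A := affine_map_local i j aF.
exists (jacobian_mx (local_expr F i j) (chart i (s t))); split.
- by apply: iF; exact: local_dom_chart.
- by rewrite cs//; exact: affine_tensors.
have [_ dc _ _] := geodesic_data oJ gs Jt ti.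
have Ut : local_dom F i j (chart i (s t)) by exact: local_dom_chart.
have dF := velocity_push A Ut (nbhs_singleton dc).
apply: velocity_is_derive => k; apply: near_eq_is_derive (dF k).
near=> u; have [Ju ui] : J u /\ dom i (s u) by near: u; exact: geodesic_near gs _ _.
by rewrite local_expr_chart// cs.
Unshelve. all: by end_near. Qed.

Lemma ray_open : open [set t : R | 0 < t]. Proof. exact: open_gt. Qed.

Lemma ray_itv : is_interval [set t : R | 0 < t].
Proof. by move=> x y x0 y0 z /andP[xz _]; exact: lt_le_trans xz. Qed.

Lemma ray0 : [set t : R | 0 < t] !=set0. Proof. by exists 1; exact: ltr01. Qed.

(** The extended geodesic c crosses t = 0 inside one chart, where rho(c', c') is continuous and
    hence bounded, yet for t > 0 it equals rho(s', s'). *)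
Lemma ricci_blow_up M (s : R -> 'rV[R]_2) :
  geodesic_on [set t | 0 < t] (s : R -> plane M) ->
  (forall B e : R, 0 < e -> exists2 t, 0 < t < e &
     B < `|ric_form (Gam M) (s t) (velocity s t) (velocity s t)|) ->
  essentially_incomplete (plane M).
Proof.
move=> gs unb [T [_ cT [F [aF iF _]]]].
have [c gc cs] := extended_geodesic aF cT ray_open ray_itv ray0 gs.
have [j c0j] := dom_cover (c 0).
have [cc dc dv gv] := geodesic_data openT gc I c0j.
set y := fun u => chart j (c u) in cc dc dv gv.
have cv := continuous_velocity (fun k => derivableP (dv k)).
pose r u := ric_form (@gamma R T j) (y u) (velocity y u) (velocity y u).
have cr : {for (0 : R), continuous r}.
  apply: (@continuous_ric_form _ (chart j @` dom j)) => //; first exact: (@chart_open R T j).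
    by move=> a b k; exact: (@gamma_smooth R T j a b k).
  by exists (c 0).
have near0 : \forall u \near (0 : R), `|r u| <= `|r 0| + 1 /\ dom j (c u).
  have [h1 h2] : (\forall u \near (0 : R), `|r 0 - r u| <= 1) /\ (\forall u \near (0 : R), dom j (c u)).
    split; first by move/cvgrPdist_le: cr; apply.
    by have := geodesic_near openT gc I c0j; apply: filterS => u [].
  near=> u; split; last by near: u.
  have : `|r 0 - r u| <= 1 by near: u.
  move=> h; rewrite -[r u](subKr (r 0)) (le_trans (ler_normB _ _))// lerD2l//.
move/nbhs_ballP: near0 => [e e0 he].
have [t /andP[t0 te]] := unb (`|r 0| + 1) e e0.
have [rt tj] : `|r t| <= `|r 0| + 1 /\ dom j (c t).
  by apply: he; rewrite -ball_normE/= sub0r normrN gtr0_norm.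
have [L [_ [E _] vE]] := @geodesic_pullback _ _ F _ s c tt j t aF iF ray_open gs cs t0 I tj.
have -> : ric_form (Gam M) (s t) (velocity s t) (velocity s t) = r t by rewrite /r /y vE -E.
by rewrite ltNge rt.
Unshelve. all: by end_near. Qed.

Lemma continuous_eq0_right (h : R -> R) e : 0 < e -> {for (0 : R), continuous h} ->
  (forall t, 0 < t < e -> h t = 0) -> h 0 = 0.
Proof.
move=> e0 ch hz; apply/eqP/negPn/negP => h0.
have : 0 < `|h 0| by rewrite normr_gt0.
move/cvgrPdist_lt: ch => /[apply] /nbhs_ballP[d d0 hd].
pose t := Num.min d e / 2.
have m0 : 0 < Num.min d e by rewrite lt_min d0.
have t0 : 0 < t by rewrite divr_gt0.
have : t < Num.min d e by rewrite /t ltr_pdivrMr// ltr_pMr// ltr1n.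
rewrite lt_min => /andP[td te].
have := hd t; rewrite -ball_normE/= sub0r normrN gtr0_norm// => /(_ td).
by rewrite (hz t) ?t0// subr0 ltxx.
Qed.

(* On the completion the geodesic passes through t = 0, where t (nabla_v rho)(v, w) vanishes;
   nondegeneracy of rho then makes the velocity zero there. *)
Lemma isotropic_ray M (s : R -> 'rV[R]_2) (k : R) (x0 : 'rV[R]_2) : k != 0 ->
  geodesic_on [set t | 0 < t] (s : R -> plane M) ->
  (forall t w, 0 < t -> t * nablaric_form (Gam M) (s t) (velocity s t) (velocity s t) w =
     k * ric_form (Gam M) (s t) (velocity s t) w) ->
  (forall t, 0 < t -> velocity s t != 0) ->
  (forall v, (forall w, ric_form (Gam M) x0 v w = 0) -> v = 0) ->
  essentially_incomplete (plane M).
Proof.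
move=> k0 gs iso v0 nd [T [hT cT [F [aF iF _]]]].
have [c gc cs] := extended_geodesic aF cT ray_open ray_itv ray0 gs.
have [j c0j] := dom_cover (c 0).
have [cc dc dv gv] := geodesic_data openT gc I c0j.
set y := fun u => chart j (c u) in cc dc dv gv.
have cv := continuous_velocity (fun k => derivableP (dv k)).
have /nbhs_ballP[e e0 he] := geodesic_near openT gc I c0j.
have {}he u : `|u| < e -> dom j (c u).
  by move=> ue; have [] // := he u; rewrite -ball_normE/= sub0r normrN.
pose vc (w : 'rV[R]_2) := fun _ : R => w.
have kv w : k * ric_form (@gamma R T j) (y 0) (velocity y 0) w = 0.
  have cw : {for (0 : R), continuous (vc w)} by exact: cst_continuous.
  pose r u := ric_form (@gamma R T j) (y u) (velocity y u) (vc w u).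
  pose n u := nablaric_form (@gamma R T j) (y u) (velocity y u) (velocity y u) (vc w u).
  have cr : {for (0 : R), continuous r}.
    apply: (@continuous_ric_form _ (chart j @` dom j)) => //; first exact: (@chart_open R T j).
      by move=> a b m; exact: (@gamma_smooth R T j a b m).
    by exists (c 0).
  have cn : {for (0 : R), continuous n}.
    apply: (@continuous_nablaric_form _ (chart j @` dom j)) => //; first exact: (@chart_open R T j).
      by move=> a b m; exact: (@gamma_smooth R T j a b m).
    by exists (c 0).
  have ch : {for (0 : R), continuous (fun t : R => t * n t - k * r t : R)}.
    by apply: continuousB; apply: continuousM => //; exact: cst_continuous.
  have := continuous_eq0_right e0 ch; rewrite mul0r sub0r => /(_ _)/eqP.
  rewrite oppr_eq0 => h; apply/eqP/h => {h} t /andP[t0 te].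
  have tj : dom j (c t) by apply: he; rewrite gtr0_norm.
  have [L [uL [E N] vE]] := @geodesic_pullback _ _ F _ s c tt j t aF iF ray_open gs cs t0 I tj.
  have := iso t (w *m invmx L) t0; rewrite [ric_form _ _ _ _]E [nablaric_form _ _ _ _ _]N.
  by rewrite mulmxKV// -vE => /eqP; rewrite -subr_eq0 => /eqP.
(* The point c 0 need not lie in the image of F; homogeneity transfers to it the nondegeneracy of
   rho at [x0]. *)
have y0 : velocity y 0 = 0.
  have [L uL [E _]] := @homogeneous_tensors R (plane M) T F tt x0 (c 0) j hT aF iF I c0j.
  suff : velocity y 0 *m invmx L = 0 by move/(congr1 (mulmx^~ L)); rewrite mulmxKV// mul0mx.
  apply: nd => w; rewrite [LHS]E mulmxKV//.
  by apply: (mulfI k0); rewrite mulr0; exact: kv.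
pose t := e / 2.
have t0 : 0 < t by rewrite divr_gt0.
have te : t < e by rewrite /t ltr_pdivrMr// ltr_pMr// ltr1n.
have ub u : between 0 t u -> dom j (c u).
  move=> /orP[/andP[u0 ut]|/andP[tu u0]]; apply: he; last by have := le_lt_trans (le_trans tu u0) t0; rewrite ltxx.
  by rewrite ger0_norm// (le_lt_trans ut).

(* Along c the geodesic equation is a linear system v' = -Gamma(v, .) v for the velocity, so its
   vanishing at 0 persists to a time t > 0 at which the velocity comes from s. *)
have yt : velocity y t = 0.
  apply/rowP => l; rewrite [RHS]mxE.
  apply: (@linear_ode_zero _ (fun k l u => - \sum_p @gamma R T j p l k (y u) * velocity y u 0 p)
    (fun k u => velocity y u 0 k) 0 t) => [m u /ub uj|m q u /ub uj|m]; last by rewrite y0 mxE.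
  - have [_ _ dv' gv'] := geodesic_data openT gc I uj.
    apply: is_derive_eq (derivableP (dv' m)) _.
    have := gv' m; move/eqP; rewrite addr_eq0 => /eqP ->.
    by rewrite -/y !sum2; ring.
  have [cc' _ dv' _] := geodesic_data openT gc I uj.
  have cv' := continuous_velocity (fun k => derivableP (dv' k)).
  have cg p : {for u, continuous (fun u => @gamma R T j p q m (y u) * velocity y u 0 p)}.
    apply: continuousM; last exact: cvg_rV2_coord.
    apply: (@continuous_comp _ _ _ y (@gamma R T j p q m)) => //.
    by apply: (Ck0 (@gamma_smooth R T j p q m 0)); exists (c u).
  apply: continuousN; rewrite (_ : (fun u => \sum_p _) = fun u =>
    @gamma R T j 0 q m (y u) * velocity y u 0 0 + @gamma R T j 1 q m (y u) * velocity y u 0 1).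
    by apply: continuousD; exact: cg.
  by apply/funext => z; rewrite sum2.
have tj : dom j (c t) by apply: he; rewrite gtr0_norm.
have [L [uL _ vE]] := @geodesic_pullback _ _ F _ s c tt j t aF iF ray_open gs cs t0 I tj.
move/eqP: (v0 t t0); apply.
by rewrite -[velocity s t](mulmxK uL) -[_ *m L]vE -/y yt mul0mx.
Qed.

(** The relation for all vectors at the single point [x0] reaches every point of T by homogeneity.
    One chart need not cover the whole extension, so r = rho(c', c') and its derivative are read in
    a chart chosen at each time; [indep] makes the choice harmless. *)
Lemma cubic_relation M J (s : R -> 'rV[R]_2) (k t0 : R) (x0 : 'rV[R]_2) : 0 < k ->
  open J -> is_interval J -> J t0 -> geodesic_on J (s : R -> plane M) ->
  (forall v, nablaric_form (Gam M) x0 v v v ^+ 2 = k * ric_form (Gam M) x0 v v ^+ 3) ->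
  ric_form (Gam M) (s t0) (velocity s t0) (velocity s t0) != 0 ->
  essentially_incomplete (plane M).
Proof.
move=> k0 oJ iJ Jt0 gs cub r0 [T [hT cT [F [aF iF _]]]].
have [c gc cs] := extended_geodesic aF cT oJ iJ (ex_intro _ _ Jt0) gs.
have [aid iid] := affine_diffeomorphism_immersion (id_affine_diffeomorphism T).
pose y i u := chart i (c u).
pose rho i u := ric_form (@gamma R T i) (y i u) (velocity (y i) u) (velocity (y i) u).
pose nu i u := nablaric_form (@gamma R T i) (y i u) (velocity (y i) u) (velocity (y i) u)
  (velocity (y i) u).
have indep i j u : dom i (c u) -> dom j (c u) -> rho i u = rho j u.
  move=> ui uj; have [L [_ [E _] vE]] := @geodesic_pullback T T id setT c c i j u aid iid openT gc
    (fun _ _ => erefl) I ui uj.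
  by rewrite /rho E /y -vE.
have ch u : {i | dom i (c u)} by apply: cid; exact: dom_cover.
pose r u := rho (sval (ch u)) u.
pose n u := nu (sval (ch u)) u.
have dr u : is_derive u (1 : R) r (n u).
  rewrite /n; case: (ch u) => i ui /=.
  have [cc dc dv gv] := geodesic_data openT gc I ui.
  apply: (@near_eq_is_derive _ _ _ (rho i)).
    have := geodesic_near openT gc I ui; apply: filterS => z [_ zi].
    by apply: indep => //; exact: (svalP (ch z)).
  apply: (@derive_ric_form _ (chart i @` dom i) _ _ _ (fun k => 'D_1 (fun u => velocity (y i) u 0 k) u)) => //.
  - exact: (@chart_open R T i).
  - by move=> a b m; exact: (@gamma_smooth R T i a b m).
  - by exists (c u).
  - by move=> m; exact: (nbhs_singleton dc).
have nr u : n u ^+ 2 = k * r u ^+ 3.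
  rewrite /n /r; case: (ch u) => i ui /=.
  have [L uL [E N]] := @homogeneous_tensors R (plane M) T F tt x0 (c u) i hT aF iF I ui.
  have := cub (velocity (y i) u *m invmx L).
  by rewrite [ric_form _ _ _ _]E [nablaric_form _ _ _ _ _]N !mulmxKV.
have := no_global_solution t0 k0 dr nr; rewrite /r; case: (ch t0) => i ti /= rz.
have [L [_ [E _] vE]] := @geodesic_pullback _ _ F J s c tt i t0 aF iF oJ gs cs Jt0 I ti.
move/eqP: r0; apply; rewrite -rz /rho /y vE; exact: E.
Qed.

End EssentialIncompleteness.

(** * Linear equivalence and completeness of the models *)

Section LinearMaps.
Variable R : realType.
Implicit Types (M N : plane_connection R) (G H : christoffel R) (A B : 'M[R]_2).
Implicit Types (x v w : 'rV[R]_2).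

Definition product G x v w : 'rV[R]_2 :=
  \row_k \sum_i \sum_j G i j k x * v 0 i * w 0 j.

Lemma partial_linear A l k : partial l (component (mulmxr A) k) = cst (A l k).
Proof.
apply/funext => x.
have d : is_derive x (delta_mx 0 l) (component (mulmxr A) k) (A l k).
  rewrite (_ : component _ _ = fun y : 'rV[R]_2 => \sum_i y 0 i * A i k); last first.
    by apply/funext => y; rewrite /component /= mxE.
  apply: is_derive_eq.
    by apply: derive_sum => i; apply: derive_mul; exact: is_derive_coord.
  rewrite sum2 !mxE !eqxx; move: l; apply: I2_ind => /=; ring.
by rewrite /partial (@derive_val _ _ _ _ _ _ _ d).
Qed.

(** Second derivatives of a linear map vanish, so intertwining means being a homomorphism of the
    products. Type A models up to linear equivalence are thus commutative, not necessarily
    associative, algebra structures on R^2 up to isomorphism. *)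
Lemma intertwines_linear G H A : intertwines setT G H (mulmxr A) <->
  forall x v w, product G x v w *m A = product H (x *m A) (v *m A) (w *m A).
Proof.
have E x i j k : partial i (partial j (component (mulmxr A) k)) x +
    \sum_p \sum_q H p q k (mulmxr A x) * partial i (component (mulmxr A) p) x *
      partial j (component (mulmxr A) q) x = \sum_p \sum_q H p q k (x *m A) * A i p * A j q.
  rewrite [partial j _]partial_linear partial_cst add0r.
  by apply: eq_bigr => p _; apply: eq_bigr => q _; rewrite !partial_linear.
have E' x i j k : \sum_l G i j l x * partial l (component (mulmxr A) k) x =
    \sum_l G i j l x * A l k by apply: eq_bigr => l _; rewrite partial_linear.
split=> [h x v w|h x _ i j k].
  have {}h i j k : \sum_l G i j l x * A l k = \sum_p \sum_q H p q k (x *m A) * A i p * A j q.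
    by rewrite -E -E' h.
  apply/rowP => k; rewrite !mxE.
  under eq_bigr do rewrite mxE.
  transitivity (\sum_i \sum_j (\sum_l G i j l x * A l k) * v 0 i * w 0 j).
    by rewrite !sum2; ring.
  by under eq_bigr do under eq_bigr do rewrite h; rewrite !sum2 !mxE !sum2; ring.
rewrite E E'; have := h x (delta_mx 0 i) (delta_mx 0 j) => /rowP/(_ k).
rewrite !mxE; under eq_bigr do rewrite mxE.
rewrite !sum2 !mxE !sum2 !mxE !eqxx.
by move: i j; apply: I2_ind; apply: I2_ind => /=; rewrite ?mulr0 ?mulr1 ?addr0 ?add0r ?mul1r ?mul0r ?addr0 ?add0r.
Qed.

Lemma linearly_equivalent_sym M N : linearly_equivalent M N -> linearly_equivalent N M.
Proof.
move=> [A uA /intertwines_linear h]; exists (invmx A); first by rewrite unitmx_inv.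
apply/intertwines_linear => x v w.
by rewrite -{1}[x](mulmxKV uA) -{1}[v](mulmxKV uA) -{1}[w](mulmxKV uA) -h mulmxK.
Qed.

Lemma linearly_equivalent_trans M N P :
  linearly_equivalent M N -> linearly_equivalent N P -> linearly_equivalent M P.
Proof.
move=> [A uA /intertwines_linear h] [B uB /intertwines_linear h'].
exists (A *m B); first by rewrite unitmx_mul uA.
by apply/intertwines_linear => x v w; rewrite !mulmxA h h'.
Qed.

Lemma Ck_linear n A k : Ck n setT (component (mulmxr A) k : 'rV[R]_2 -> R).
Proof.
rewrite (_ : component _ _ = fun y : 'rV[R]_2 => \sum_i (y 0 i * (cst (A i k) y))); last first.
  by apply/funext => y; rewrite /component /= mxE.
apply: Ck_sum => [|i]; first exact: openT.
apply: Ck_mul; [exact: openT|exact: smooth_coord|exact: smooth_cst].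
Qed.

Lemma plane_affine_map M N (F : 'rV[R]_2 -> 'rV[R]_2) :
  smooth_map setT F -> intertwines setT (Gam M) (Gam N) F ->
  affine_map (F : plane M -> plane N).
Proof.
move=> sF iF; split.
  by move=> x; apply: cvg_rV2 => k; apply: Ck0 (sF k 0) _.
move=> i j; split=> [k n|x _]; last exact: iF.
by apply: (@sub_Ck _ _ _ setT) => //; exact: sF.
Qed.

Lemma linear_affine_map M N A : intertwines setT (Gam M) (Gam N) (mulmxr A) ->
  affine_map (mulmxr A : plane M -> plane N).
Proof. by move=> h; apply: plane_affine_map => // k n; exact: Ck_linear. Qed.

Lemma jacobian_linear A x : jacobian_mx (mulmxr A) x = A.
Proof. by apply/matrixP => i k; rewrite mxE partial_linear. Qed.

Lemma linear_immersion M N A : A \in unitmx -> immersion (mulmxr A : plane M -> plane N).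
Proof. by move=> uA i j x _; rewrite [jacobian_mx _ _]jacobian_linear. Qed.

Lemma linear_tensors M N A x : A \in unitmx -> intertwines setT (Gam M) (Gam N) (mulmxr A) ->
  (forall v w, ric_form (Gam M) x v w = ric_form (Gam N) (x *m A) (v *m A) (w *m A)) /\
  (forall u v w, nablaric_form (Gam M) x u v w =
     nablaric_form (Gam N) (x *m A) (u *m A) (v *m A) (w *m A)).
Proof.
move=> uA h; have := @affine_tensors R (plane M) (plane N) (mulmxr A) tt x tt
  (linear_affine_map h) (linear_immersion uA) I I.
by rewrite /tensors_agree [jacobian_mx _ _]jacobian_linear.
Qed.

Lemma linear_geodesic M N A J (s : R -> 'rV[R]_2) : open J -> A \in unitmx ->
  intertwines setT (Gam M) (Gam N) (mulmxr A) -> geodesic_on J (s : R -> plane M) ->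
  geodesic_on J ((fun t => s t *m A) : R -> plane N) /\
  forall t, J t -> velocity (fun t => s t *m A) t = velocity s t *m A.
Proof.
move=> oJ uA h gs; split; first exact: (geodesic_image (linear_affine_map h) oJ gs).
move=> t Jt; have [a [ds _ _]] := plane_geodesicE oJ gs.
apply: velocity_is_derive => k; rewrite mxE.
rewrite (_ : (fun u => _) = fun u => \sum_l s u 0 l * (cst (A l k) u)); last first.
  by apply/funext => u; rewrite mxE.
apply: is_derive_eq; first by apply: derive_sum => l; apply: derive_mul; exact: ds.
by apply: eq_bigr => l _ /=; rewrite mulr0 addr0.
Qed.

Lemma linearly_equivalent_complete M N : linearly_equivalent M N ->
  geodesically_complete (plane N) -> geodesically_complete (plane M).
Proof.
move=> MN cN J s oJ iJ J0 gs; have [A uA h] := MN.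
have [gs' _] := linear_geodesic oJ uA h gs.
have [c gc cs] := cN J _ oJ iJ J0 gs'.
have h' : intertwines setT (Gam N) (Gam M) (mulmxr (invmx A)).
  move/intertwines_linear: h => h; apply/intertwines_linear => x v w.
  by rewrite -{1}[x](mulmxKV uA) -{1}[v](mulmxKV uA) -{1}[w](mulmxKV uA) -h mulmxK.
exists (fun t => c t *m invmx A).
  by have [] := linear_geodesic openT (etrans (unitmx_inv A) uA) h' gc.
by move=> t Jt; rewrite cs// mulmxK.
Qed.

End LinearMaps.

(** * Uniqueness of geodesics and explicit complete models *)

Section Completeness.
Variable R : realType.
Implicit Types (M : plane_connection R) (s : R -> 'rV[R]_2) (J : set R).

Definition vec2 (x y : R) : 'rV[R]_2 := \row_k (if k == 0 then x else y).

Lemma vec2_0 x y : vec2 x y 0 0 = x. Proof. by rewrite mxE. Qed.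

Lemma vec2_1 x y : vec2 x y 0 1 = y. Proof. by rewrite mxE. Qed.

Lemma vec2E (v : 'rV[R]_2) : v = vec2 (v 0 0) (v 0 1).
Proof. by apply: rV2P; rewrite !mxE. Qed.

Lemma curve_geodesic M J (x y vx vy ax ay : R -> R) : open J ->
  (forall t, J t -> [/\ is_derive t (1 : R) x (vx t), is_derive t (1 : R) y (vy t),
    is_derive t (1 : R) vx (ax t) & is_derive t (1 : R) vy (ay t)]) ->
  (forall t, J t -> let g i j k := Gam M i j k (vec2 (x t) (y t)) in
    ax t + (g 0 0 0 * vx t ^+ 2 + 2 * g 0 1 0 * vx t * vy t + g 1 1 0 * vy t ^+ 2) = 0 /\
    ay t + (g 0 0 1 * vx t ^+ 2 + 2 * g 0 1 1 * vx t * vy t + g 1 1 1 * vy t ^+ 2) = 0) ->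
  geodesic_on J ((fun t => vec2 (x t) (y t)) : R -> plane M) /\
  forall t, J t -> velocity (fun t => vec2 (x t) (y t)) t = vec2 (vx t) (vy t).
Proof.
move=> oJ d eqn.
have ds k t : J t -> is_derive t (1 : R) (fun u => vec2 (x u) (y u) 0 k)
    (if k == 0 then vx t else vy t).
  move=> /d[d1 d2 _ _]; move: k; apply: I2_ind => /=.
    by rewrite (_ : (fun _ => _) = x)//; apply/funext => u; rewrite vec2_0.
  by rewrite (_ : (fun _ => _) = y)//; apply/funext => u; rewrite vec2_1.
split; last by move=> t Jt; exact: (plane_velocity ds).
apply: (plane_geodesic (v := fun k t => if k == 0 then vx t else vy t)
  (a := fun k t => if k == 0 then ax t else ay t)) => //.
- by apply: I2_ind => t /d[].
move=> k t /eqn[]; rewrite !sum2 /= (Gam_sym M 1 0) => e0 e1.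
by move: k; apply: I2_ind => /=; [apply: etrans e0|apply: etrans e1]; ring.
Qed.

Lemma model_geodesic a b c d e f J (x y vx vy ax ay : R -> R) : open J ->
  (forall t, J t -> [/\ is_derive t (1 : R) x (vx t), is_derive t (1 : R) y (vy t),
    is_derive t (1 : R) vx (ax t) & is_derive t (1 : R) vy (ay t)]) ->
  (forall t, J t ->
    ax t + (a * vx t ^+ 2 + 2 * c * vx t * vy t + e * vy t ^+ 2) = 0 /\
    ay t + (b * vx t ^+ 2 + 2 * d * vx t * vy t + f * vy t ^+ 2) = 0) ->
  geodesic_on J ((fun t => vec2 (x t) (y t)) : R -> plane (model a b c d e f)) /\
  forall t, J t -> velocity (fun t => vec2 (x t) (y t)) t = vec2 (vx t) (vy t).
Proof. by move=> oJ ds eqn; exact: (@curve_geodesic (model a b c d e f) J x y vx vy ax ay). Qed.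

Lemma between_interval J t0 t u : is_interval J -> J t0 -> J t -> between t0 t u -> J u.
Proof. by move=> iJ J0 Jt /orP[] ut; apply: iJ ut. Qed.

Definition unique_geodesics M := forall J s s' t0, open J -> is_interval J -> J t0 ->
  geodesic_on J (s : R -> plane M) -> geodesic_on J (s' : R -> plane M) ->
  s t0 = s' t0 -> velocity s t0 = velocity s' t0 -> forall t, J t -> s t = s' t.

Lemma type_A_unique M : type_A M -> unique_geodesics M.
Proof.
move=> hM J s s' t0 oJ iJ J0 gs gs' p0 v0.
have GE i j k x : Gam M i j k x = Gam M i j k 0.
  by have [c hc] := hM i j k; rewrite !hc.
have [a [ds dv eqn]] := plane_geodesicE oJ gs.
have [a' [ds' dv' eqn']] := plane_geodesicE oJ gs'.
have cv c b : (forall k t, J t -> is_derive t (1 : R) (fun u => velocity c u 0 k) (b k t)) ->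
    forall u k, J u -> {for u, continuous (fun u => velocity c u 0 k)}.
  move=> dc u k Ju; apply/differentiable_continuous/derivable1_diffP.
  by have [] := dc k u Ju.
have vE t k : J t -> velocity s t 0 k - velocity s' t 0 k = 0.
  move=> Jt; have btw u := between_interval (u := u) iJ J0 Jt.
  (* For constant symbols Gamma(v, v) - Gamma(v', v') = Gamma(v + v', v - v'), which makes the
     difference of the two velocities a solution of a linear system. *)
  apply: (@linear_ode_zero _ (fun k l u => - (Gam M 0 l k 0 * (velocity s u 0 0 + velocity s' u 0 0)
     + Gam M 1 l k 0 * (velocity s u 0 1 + velocity s' u 0 1)))
    (fun k u => velocity s u 0 k - velocity s' u 0 k) t0 t) => [m u /btw Ju|m l u /btw Ju|m].
  - apply: is_derive_eq (derive_sub (dv m u Ju) (dv' m u Ju)) _.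
    have := eqn m u Ju; have := eqn' m u Ju.
    rewrite !sum2 !(GE _ _ _ (s _)) !(GE _ _ _ (s' _)) (Gam_sym M 1 0).
    by move=> /eqP; rewrite addr_eq0 => /eqP-> /eqP; rewrite addr_eq0 => /eqP->; ring.
  - apply: continuousN; apply: continuousD; apply: continuousM;
    by [exact: cst_continuous|apply: continuousD; [exact: (cv _ _ dv)|exact: (cv _ _ dv')]].
  - by rewrite v0 subrr.
move=> t Jt; have btw u := between_interval (u := u) iJ J0 Jt.
apply/rowP => k; apply/eqP; rewrite -subr_eq0; apply/eqP.
apply: (@linear_ode_zero _ (fun k l u => 0) (fun k u => s u 0 k - s' u 0 k) t0 t)
  => [m u /btw Ju|m l u _|m]; last by rewrite p0 subrr.
  apply: is_derive_eq (derive_sub (ds m u Ju) (ds' m u Ju)) _.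
  by rewrite sum2 !mul0r addr0; exact: vE.
exact: cst_continuous.
Qed.

Lemma model_type_A a b c d e f : type_A (model a b c d e f : plane_connection R).
Proof. by move=> i j k; exists (symbols a b c d e f i j k). Qed.

(** A geodesic on J is compared with the global geodesic that has the same position and velocity at
    one time of J. *)
Lemma complete_criterion M : unique_geodesics M ->
  (forall (t0 : R) (p v : 'rV[R]_2), exists s,
    [/\ geodesic_on setT (s : R -> plane M), s t0 = p & velocity s t0 = v]) ->
  geodesically_complete (plane M).
Proof.
move=> uM gM J s oJ iJ [t0 J0] gs.
have [s' [gs' p0 v0]] := gM t0 (s t0) (velocity s t0).
exists s' => // t Jt; apply: (uM J s' s t0) => //.
by have [c1 c2] := gs'; split=> [u _|i u _]; [exact: c1|exact: c2].
Qed.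

Lemma M0_0_complete : geodesically_complete (plane (M0_0 R)).
Proof.
apply: complete_criterion; first exact/type_A_unique/model_type_A.
move=> t0 p v; have [||gs vs] := @model_geodesic 0 0 0 0 0 0 setT
  (fun t => p 0 0 + v 0 0 * (t - t0)) (fun t => p 0 1 + v 0 1 * (t - t0))
  (fun=> v 0 0) (fun=> v 0 1) (fun=> 0) (fun=> 0) openT.
- by move=> t _; split; apply: is_derive_eq; rewrite /GRing.scale/=; ring.
- by move=> t _; split; ring.
eexists; split; [exact: gs| |by rewrite vs// -vec2E].
by rewrite /= subrr !mulr0 !addr0 -vec2E.
Qed.

Lemma M0_4_complete : geodesically_complete (plane (M0_4 R)).
Proof.
apply: complete_criterion; first exact/type_A_unique/model_type_A.
move=> t0 p v; have [||gs vs] := @model_geodesic 0 0 0 0 1 0 setT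
  (fun t => p 0 0 + v 0 0 * (t - t0) - v 0 1 ^+ 2 / 2 * (t - t0) ^+ 2)
  (fun t => p 0 1 + v 0 1 * (t - t0))
  (fun t => v 0 0 - v 0 1 ^+ 2 * (t - t0)) (fun=> v 0 1) (fun=> - v 0 1 ^+ 2) (fun=> 0) openT.
- by move=> t _; split; apply: is_derive_eq; rewrite /GRing.scale/=; field.
- by move=> t _; split; ring.
eexists; split; [exact: gs| |by rewrite vs// subrr mulr0 subr0 -vec2E].
by rewrite /= subrr expr0n /= !mulr0 !addr0 subr0 -vec2E.
Qed.

(** The equations are x'' = x' y' and y'' = 0, so x' is an exponential of rate y'; the case y' = 0
    is apart because integrating x' divides by y'. *)
Lemma M1_3_complete : geodesically_complete (plane (M1_3 R)).
Proof.
apply: complete_criterion; first exact/type_A_unique/model_type_A.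
move=> t0 p v; have [v0|v0] := eqVneq (v 0 1) 0.
  have [||gs vs] := @model_geodesic 0 0 (- 2^-1) 0 0 0 setT
    (fun t => p 0 0 + v 0 0 * (t - t0)) (fun t => p 0 1)
    (fun=> v 0 0) (fun=> v 0 1) (fun=> 0) (fun=> 0) openT.
  - by move=> t _; split; apply: is_derive_eq; rewrite /GRing.scale/= ?v0; ring.
  - by move=> t _; rewrite v0; split; ring.
  eexists; split; [exact: gs| |by rewrite vs// -vec2E].
  by rewrite /= subrr !mulr0 !addr0 -vec2E.
have [||gs vs] := @model_geodesic 0 0 (- 2^-1) 0 0 0 setT
  (fun t => p 0 0 + v 0 0 / v 0 1 * (expR (v 0 1 * (t - t0)) - 1))
  (fun t => p 0 1 + v 0 1 * (t - t0))
  (fun t => v 0 0 * expR (v 0 1 * (t - t0))) (fun=> v 0 1)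
  (fun t => v 0 0 * v 0 1 * expR (v 0 1 * (t - t0))) (fun=> 0) openT.
- move=> t _; split; apply: is_derive_eq; rewrite /GRing.scale/=; try ring.
  by field.
- by move=> t _; split; [field|ring].
eexists; split; [exact: gs| |by rewrite vs// subrr mulr0 expR0 mulr1 -vec2E].
by rewrite /= subrr !mulr0 expR0 subrr mulr0 !addr0 -vec2E.
Qed.

(** The symbols are not constant here, but y'' = 0 makes y' constant, after which x'' = - y'^2 x is
    linear. *)
Lemma modelN_unique : unique_geodesics (modelN R).
Proof.
move=> J s s' t0 oJ iJ J0 gs gs' p0 v0.
have [a [ds dv eqn]] := plane_geodesicE oJ gs.
have [a' [ds' dv' eqn']] := plane_geodesicE oJ gs'.
have accE (c : R -> 'rV[R]_2) b : (forall k t, J t -> b k t + \sum_p \sum_q Gam (modelN R) p q k (c t) *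
    velocity c t 0 p * velocity c t 0 q = 0) -> forall t, J t ->
    b 0 t = - c t 0 0 * velocity c t 0 1 ^+ 2 /\ b 1 t = 0.
  move=> h t Jt; have := h 0 t Jt; have := h 1 t Jt; rewrite !sum2 /= /symbolsN /=.
  by rewrite !mul0r !addr0 !add0r => -> /eqP; rewrite addr_eq0 => /eqP ->; split=> //; ring.
have vy t (c : R -> 'rV[R]_2) b :
    (forall k t, J t -> is_derive t (1 : R) (fun u => velocity c u 0 k) (b k t)) ->
    (forall t, J t -> b 1 t = 0) -> J t -> velocity c t 0 1 = velocity c t0 0 1.
  move=> dc b0 Jt; have btw u := between_interval (u := u) iJ J0 Jt.
  apply/eqP; rewrite -subr_eq0; apply/eqP.
  apply: (@linear_ode_zero _ (fun k l u => 0) (fun k u => velocity c u 0 1 - velocity c t0 0 1) t0 t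
    _ _ _ 0) => [m u /btw Ju|m l u _|m]; last by rewrite subrr.
    apply: is_derive_eq (derive_sub (dc 1 u Ju) (is_derive_cst _ _ _)) _.
    by rewrite b0// sum2 !mul0r subr0 addr0.
  exact: cst_continuous.
have vs t : J t -> velocity s t 0 1 = velocity s t0 0 1.
  by apply: vy dv _ => u Ju; have [] := accE _ _ eqn u Ju.
have vs' t : J t -> velocity s' t 0 1 = velocity s t0 0 1.
  by rewrite v0; apply: vy dv' _ => u Ju; have [] := accE _ _ eqn' u Ju.
move=> t Jt; have btw u := between_interval (u := u) iJ J0 Jt.
apply: rV2P; apply/eqP; rewrite -subr_eq0; apply/eqP.
  (* The unknowns are the difference of the first coordinates (index 0) and of their derivatives
     (index 1). *)
  apply: (@linear_ode_zero _ (fun k l u => if k == 0 then (if l == 0 then 0 else 1) else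
      (if l == 0 then - velocity s t0 0 1 ^+ 2 else 0))
    (fun k u => if k == 0 then s u 0 0 - s' u 0 0 else velocity s u 0 0 - velocity s' u 0 0) t0 t
    _ _ _ 0) => [m u /btw Ju|m l u _|m].
  - move: m; apply: I2_ind => /=; rewrite sum2/=.
      apply: is_derive_eq (derive_sub (ds 0 u Ju) (ds' 0 u Ju)) _; ring.
    apply: is_derive_eq (derive_sub (dv 0 u Ju) (dv' 0 u Ju)) _.
    by rewrite (accE _ _ eqn u Ju).1 (accE _ _ eqn' u Ju).1 vs// vs'//; ring.
  - exact: cst_continuous.
  - by move: m; apply: I2_ind => /=; rewrite ?p0 ?v0 subrr.
apply: (@linear_ode_zero _ (fun k l u => 0) (fun k u => s u 0 1 - s' u 0 1) t0 t
    _ _ _ 0) => [m u /btw Ju|m l u _|m]; last by rewrite p0 subrr.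
  apply: is_derive_eq (derive_sub (ds 1 u Ju) (ds' 1 u Ju)) _.
  by rewrite vs// vs'// sum2; ring.
exact: cst_continuous.
Qed.

(** The first coordinate is a harmonic oscillator of frequency y'. *)
Lemma modelN_complete : geodesically_complete (plane (modelN R)).
Proof.
apply: complete_criterion; first exact: modelN_unique.
move=> t0 p v; have [v0|v0] := eqVneq (v 0 1) 0.
  have [||gs vs] := @curve_geodesic (modelN R) setT
    (fun t => p 0 0 + v 0 0 * (t - t0)) (fun t => p 0 1)
    (fun=> v 0 0) (fun=> v 0 1) (fun=> 0) (fun=> 0) openT.
  - by move=> t _; split; apply: is_derive_eq; rewrite /GRing.scale/= ?v0; ring.
  - by move=> t _; rewrite /= /symbolsN /= v0; split; ring.
  eexists; split; [exact: gs| |by rewrite vs// -vec2E].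
  by rewrite /= subrr !mulr0 !addr0 -vec2E.
have [||gs vs] := @curve_geodesic (modelN R) setT
  (fun t => p 0 0 * cos (v 0 1 * (t - t0)) + v 0 0 / v 0 1 * sin (v 0 1 * (t - t0)))
  (fun t => p 0 1 + v 0 1 * (t - t0))
  (fun t => - p 0 0 * v 0 1 * sin (v 0 1 * (t - t0)) + v 0 0 * cos (v 0 1 * (t - t0)))
  (fun=> v 0 1)
  (fun t => - p 0 0 * v 0 1 ^+ 2 * cos (v 0 1 * (t - t0)) - v 0 0 * v 0 1 * sin (v 0 1 * (t - t0)))
  (fun=> 0) openT.
- move=> t _; split; apply: is_derive_eq; rewrite /GRing.scale/=; try ring.
  by field.
- by move=> t _; rewrite /= /symbolsN /= vec2_0; split; [field|ring].
eexists; split; [exact: gs| |by rewrite vs// subrr mulr0 sin0 cos0 mulr0 add0r mulr1 -vec2E].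
by rewrite /= subrr !mulr0 sin0 cos0 mulr0 mulr1 !addr0 -vec2E.
Qed.

End Completeness.

(** * Autonomous equations and completeness of M_2^2(-1, b) *)

Section AutonomousOde.
Variable R : realType.
Implicit Types (h : R -> R).

(** Integration starts at -1 rather than 0 so that this primitive and the reflected one overlap
    around 0, where they are glued. *)
Lemma antiderivative_right h : continuous h ->
  exists H : R -> R, forall s : R, - 1 < s -> is_derive s (1 : R) H (h s).
Proof.
move=> ch.
exists (fun x => (\int[@lebesgue_measure R]_(t in [set` `[(- 1), x]]) (h t))%R) => s s1.
have intg : (@lebesgue_measure R).-integrable `[(- 1), s + 1] (EFin \o h).
  apply: continuous_compact_integrable; first exact: segment_compact.
  exact: continuous_subspaceT.
have [|dF FE] := continuous_FTC1_closed (f := h) _ intg s1 (ch s); first by rewrite ltrDl.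
by split; [exact: dF|rewrite -derive1E FE].
Qed.

(* The integral starts at a finite bound, so the two half-lines are glued at 0. *)
Lemma antiderivative h : continuous h ->
  exists H : R -> R, forall s : R, is_derive s (1 : R) H (h s).
Proof.
move=> ch; have [A dA] := antiderivative_right ch.
have ch' : continuous (fun s => h (- s)).
  by move=> s; apply: continuous_comp; [exact: opp_continuous|exact: ch].
have [B dB] := antiderivative_right ch'.
pose A1 s := A s - A 0; pose B1 s := - (B (- s) - B 0).
have dA1 (s : R) : - 1 < s -> is_derive s (1 : R) A1 (h s).
  move=> s1; apply: is_derive_eq (derive_sub (dA s s1) (is_derive_cst _ _ _)) _.
  by rewrite subr0.
have dB1 (s : R) : s < 1 -> is_derive s (1 : R) B1 (h s).
  move=> s1; have s1' : - 1 < - s by rewrite ltrN2.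
  have d : is_derive s (1 : R) (fun u => B (- u)) (h (- - s) * (- 1)).
    by apply: (@is_derive1_comp _ B (fun u => - u)); exact: dB.
  by apply: is_derive_eq; rewrite opprK; ring.
have AB (s : R) : - 1 < s < 1 -> A1 s = B1 s.
  move=> /andP[s1 s2]; apply/eqP; rewrite -subr_eq0; apply/eqP.
  have btw (u : R) : between 0 s u -> - 1 < u < 1.
    by move=> /orP[]/andP[u1 u2]; apply/andP; split; lra.
  apply: (@linear_ode_zero _ (fun k l u => 0) (fun k u => A1 u - B1 u) 0 s _ _ _ 0)
    => [m u /btw/andP[u1 u2]|m l u _|m].
  - apply: is_derive_eq (derive_sub (dA1 u u1) (dB1 u u2)) _.
    by rewrite subrr sum2 !mul0r addr0.
  - exact: cst_continuous.
  - by rewrite /A1 /B1 oppr0 !subrr oppr0 subr0.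
exists (fun s => if 0 <= s then A1 s else B1 s) => s.
have [s0|s0] := ltP (- 1) s.
  apply: (@near_eq_is_derive _ _ _ A1); last exact: dA1.
  have : \forall u \near s, - 1 < u by apply: open_nbhs_nbhs; split => //; exact: open_gt.
  apply: filterS => u u1; case: (leP 0 u) => // u0.
  by apply: AB; rewrite u1 (lt_trans u0).
apply: (@near_eq_is_derive _ _ _ B1); last by apply: dB1; lra.
have : \forall u \near s, u < 0.
  by apply: open_nbhs_nbhs; split; [exact: open_lt|rewrite /=; lra].
by apply: filterS => u u0; rewrite leNgt u0.
Qed.

(** S inverts the primitive G of h that vanishes at s0. The bound h >= m > 0 makes G increasing and
    onto R, so S is defined for all times. *)
Lemma autonomous_ode h (m s0 : R) : continuous h -> 0 < m -> (forall s, m <= h s) ->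
  exists2 S : R -> R, S 0 = s0 & forall t : R, is_derive t (1 : R) S (h (S t))^-1.
Proof.
move=> ch m0 hm; have [H dH] := antiderivative ch.
pose G s := H s - H s0.
have dG s : is_derive s (1 : R) G (h s).
  by apply: is_derive_eq (derive_sub (dH s) (is_derive_cst _ _ _)) _; rewrite subr0.
have cG : continuous G.
  by move=> s; apply/differentiable_continuous/derivable1_diffP; case: (dG s).
have grow a b : a <= b -> m * (b - a) <= G b - G a.
  move=> ab; have [|c _ ->] := MVT_segment ab (fun x _ => dG x); first exact: continuous_subspaceT.
  by apply: ler_wpM2r; [rewrite subr_ge0|exact: hm].
have G0 : G s0 = 0 by rewrite /G subrr.
have surj v : exists s, G s = v.
  pose r := `|v| / m.
  have r0 : 0 <= r by rewrite divr_ge0// ltW.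
  have mr : m * r = `|v| by rewrite /r mulrCA divff ?mulr1// gt_eqF.
  have hi : v <= G (s0 + r).
    have := grow s0 (s0 + r); rewrite lerDl r0 G0 subr0 addrAC subrr add0r mr => /(_ isT).
    exact: le_trans (ler_norm _).
  have lo : G (s0 - r) <= v.
    have := grow (s0 - r) s0; rewrite gerBl r0 G0 sub0r opprB addrC subrK mr => /(_ isT).
    by rewrite lerNr => /le_trans; apply; rewrite lerNl -normrN ler_norm.
  have [|||s _ <-] := @IVT R G (s0 - r) (s0 + r) v; last by exists s.
  - by rewrite lerD2l (le_trans _ r0)// oppr_le0.
  - exact: continuous_subspaceT.
  - by rewrite ge_min lo /= le_max hi orbT.
have [S SE] := choice surj.
have inj a b : G a = G b -> a = b.
  wlog ab : a b / a <= b => [hw E|E].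
    by have [/hw|/ltW/hw/(_ (esym E))] := leP a b; [exact|].
  have := grow a b ab; rewrite E subrr pmulr_rle0// subr_le0 => ba.
  by apply/eqP; rewrite eq_le ab.
have GK s : S (G s) = s by apply: inj; rewrite SE.
exists S; first by rewrite -G0 GK.
move=> t; rewrite -{1}(SE t); apply: is_derive_inverse.
- by near=> z.
- by near=> z; exact: cG.
- by rewrite gt_eqF// (lt_le_trans m0).
Unshelve. all: by end_near. Qed.

(* e = exp s, and V = s' is a multiple of exp (- 2 c atan e). *)
Lemma M2_2_profile (c t0 E K : R) : 0 < E -> exists s V e : R -> R,
  [/\ s t0 = ln E, V t0 = K & e t0 = E] /\
  [/\ forall t, 0 < e t, forall t : R, is_derive t (1 : R) s (V t),
      forall t : R, is_derive t (1 : R) e (e t * V t) &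
      forall t : R, is_derive t (1 : R) V (- 2 * c * e t * V t ^+ 2 / (1 + e t ^+ 2))].
Proof.
move=> E0; pose h s := expR (2 * c * atan (expR s)).
have ch : continuous h.
  move=> s; apply/differentiable_continuous/derivable1_diffP.
  suff : is_derive s (1 : R) h (h s * (2 * c * ((1 + expR s ^+ 2)^-1 * expR s))) by case.
  by apply: is_derive_eq.
(* The bound is uniform because |atan| < pi / 2; this is what makes the solutions global. *)
have hm s : expR (- (`|c| * pi)) <= h s.
  rewrite ler_expR lerNl -mulNr; have a1 := atan_ltpi2 (expR s); have a2 := atan_gtNpi2 (expR s).
  apply: le_trans (ler_norm _) _; rewrite normrM normrN normrM ger0_norm//.
  have : `|atan (expR s)| <= pi / 2 by rewrite ler_norml (ltW a1) (ltW a2).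
  have := normr_ge0 c; move: `|c| `|atan _| => x y; nra.
have [S S0 dS] := autonomous_ode (ln E) ch (expR_gt0 _) hm.
(* The equation is solved at unit scale and time is rescaled by k, which prescribes s' = K at t0
   whatever the sign of K. *)
pose k := K * h (ln E).
pose s t := S (k * (t - t0)).
have s0 : s t0 = ln E by rewrite /s subrr mulr0.
have [V VE] : exists V, forall t, V t = k * expR (- (2 * c) * atan (expR (s t))) by eexists.
have ds t : is_derive t (1 : R) s (V t).
  have d1 := dS (k * (t - t0)).
  have d2 : is_derive t (1 : R) (fun t => k * (t - t0)) k.
    by apply: is_derive_eq; rewrite /GRing.scale/=; ring.
  rewrite VE mulNr expRN mulrC.
  exact: (@is_derive1_comp _ S (fun t => k * (t - t0)) _ _ _ d1 d2).
have V0 : V t0 = K by rewrite VE s0 mulNr expRN /k mulfK// gt_eqF// expR_gt0.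
exists s, V, (fun t => expR (s t)); split; first by split => //; rewrite s0 lnK.
split=> [t|//|t|t]; first exact: expR_gt0.
  by have := ds t => dst; apply: is_derive_eq.
have dst := ds t.
have dX : is_derive t (1 : R) (fun t => k * expR (- (2 * c) * atan (expR (s t))))
    (k * (expR (- (2 * c) * atan (expR (s t))) *
    (- (2 * c) * ((1 + expR (s t) ^+ 2)^-1 * (expR (s t) * V t))))).
  by apply: is_derive_eq.
rewrite (_ : V = fun t => k * expR (- (2 * c) * atan (expR (s t)))); last exact/funext.
apply: is_derive_eq dX _; rewrite VE.
have alg (X z : R) : 1 + z ^+ 2 != 0 ->
    k * (X * (- (2 * c) * ((1 + z ^+ 2)^-1 * (z * (k * X))))) =
    - 2 * c * z * (k * X) ^+ 2 / (1 + z ^+ 2) by move=> z0; field.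
by apply: alg; rewrite gt_eqF// ltr_wpDr// sqr_ge0.
Qed.

(** With w = 2 x' / y' - c the equations read w' = (1 + w^2) y' and y'' = - (w + c) y'^2. Putting w
    = sinh s gives s' = y' cosh s and s'' = - c s'^2 / cosh s, so s' is a constant times exp (- 2 c
    atan (exp s)), a bounded function of s. Geodesics with y' = 0 are straight lines. *)
Lemma M2_2_complete (c : R) : geodesically_complete (plane (M2_2 c)).
Proof.
apply: complete_criterion; first exact/type_A_unique/model_type_A.
move=> t0 p v; have [v0|v0] := eqVneq (v 0 1) 0.
  have [||gs vs] := @model_geodesic R 0 0 c 1 (- ((1 + c ^+ 2) / 2)) 0 setT
    (fun t => p 0 0 + v 0 0 * (t - t0)) (fun t => p 0 1)
    (fun=> v 0 0) (fun=> v 0 1) (fun=> 0) (fun=> 0) openT.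
  - by move=> t _; split; apply: is_derive_eq; rewrite /GRing.scale/= ?v0; ring.
  - by move=> t _; rewrite v0; split; ring.
  eexists; split; [exact: gs| |by rewrite vs// -vec2E].
  by rewrite /= subrr !mulr0 !addr0 -vec2E.
have [w wE] : exists w, w = 2 * (v 0 0 / v 0 1) - c by eexists.
(* E is the value of exp s at t0: the positive solution of (E - E^-1) / 2 = w. *)
have [E [EE E0]] : exists E : R, E ^+ 2 = 1 + 2 * w * E /\ 0 < E.
  exists (w + Num.sqrt (w ^+ 2 + 1)).
  have sq : Num.sqrt (w ^+ 2 + 1) ^+ 2 = w ^+ 2 + 1 by rewrite sqr_sqrtr// addr_ge0// sqr_ge0.
  split; first by rewrite sqrrD sq; ring.
  have wl : `|w| < Num.sqrt (w ^+ 2 + 1).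
    by rewrite -sqrtr_sqr ltr_sqrt ?ltrDl// ltr_wpDl// sqr_ge0.
  by rewrite -ltrBlDl sub0r; apply: le_lt_trans wl; rewrite -normrN ler_norm.
(* The initial value of s' is y' cosh s, with cosh s = (1 + E^2) / (2 E). *)
have [s [V [e [[s0 Vt et] [e0 ds de dV]]]]] :=
  M2_2_profile c t0 (v 0 1 * (1 + E ^+ 2) / (2 * E)) E0.
have p0 t : 0 < 1 + e t ^+ 2 by rewrite ltr_wpDr// sqr_ge0.
have n0 t : 1 + e t ^+ 2 != 0 by rewrite gt_eqF.
have dq t : is_derive t (1 : R) (fun t => 1 + e t ^+ 2) (2 * e t ^+ 2 * V t).
  by have := de t => det; apply: is_derive_eq; rewrite /GRing.scale/=; ring.
have dqV t : is_derive t (1 : R) (fun t => (1 + e t ^+ 2)^-1)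
    (- (2 * e t ^+ 2 * V t) / (1 + e t ^+ 2) ^+ 2).
  have -> : - (2 * e t ^+ 2 * V t) / (1 + e t ^+ 2) ^+ 2 =
      - (1 + e t ^+ 2) ^- 2 *: (2 * e t ^+ 2 * V t).
    by rewrite /GRing.scale/= mulNr mulrC mulNr.
  exact: (@is_deriveV R (fun t => 1 + e t ^+ 2) t _ _ (n0 t) (dq t)).
have dln t : is_derive t (1 : R) (fun t => ln (1 + e t ^+ 2)) (2 * e t ^+ 2 * V t / (1 + e t ^+ 2)).
  have l0 := is_derive1_ln (p0 t); have l1 := dq t.
  have l2 : is_derive t (1 : R) ((@ln R : R -> R) \o (fun t => 1 + e t ^+ 2))
      ((1 + e t ^+ 2)^-1 * (2 * e t ^+ 2 * V t)).
    exact: is_derive1_comp.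
  by rewrite mulrC; exact: l2.
have dat t : is_derive t (1 : R) (fun t => atan (e t)) (e t * V t / (1 + e t ^+ 2)).
  by have := de t => det; apply: is_derive_eq; rewrite mulrC.
(* Integrals of y' = V / cosh s and x' = (w + c) y' / 2, with constants that put the curve at p at
   time t0. *)
have [||gs vs] := @model_geodesic R 0 0 c 1 (- ((1 + c ^+ 2) / 2)) 0 setT
  (fun t => - 2^-1 * (s t - ln (1 + e t ^+ 2) - 2 * c * atan (e t)) +
     (p 0 0 + 2^-1 * (ln E - ln (1 + E ^+ 2) - 2 * c * atan E)))
  (fun t => 2 * atan (e t) + (p 0 1 - 2 * atan E))
  (fun t => - 2^-1 * (V t * (1 - e t ^+ 2 - 2 * c * e t) * (1 + e t ^+ 2)^-1))
  (fun t => 2 * (e t * V t * (1 + e t ^+ 2)^-1))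
  (fun t => V t ^+ 2 / (1 + e t ^+ 2) ^+ 2 *
     (2 * c * e t - 2 * c * e t ^+ 3 - 2 * c ^+ 2 * e t ^+ 2 + 2 * e t ^+ 2))
  (fun t => 2 * e t * V t ^+ 2 / (1 + e t ^+ 2) ^+ 2 * (1 - e t ^+ 2 - 2 * c * e t)) openT.
- move=> t _; have d1 := ds t; have d2 := de t; have d3 := dV t; have d4 := dqV t.
  have d5 := dln t; have d6 := dat t; have q0 := n0 t.
  by split; apply: is_derive_eq; rewrite /GRing.scale/=; field.
- by move=> t _; have q0 := n0 t; split; field.
have E2 : 1 + E ^+ 2 != 0 by rewrite -et.
have EN : E != 0 by rewrite gt_eqF.
eexists; split; [exact: gs| |].
  by apply: rV2P => /=; rewrite ?vec2_0 ?vec2_1 ?s0 et; ring.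
rewrite vs// et Vt; apply: rV2P; rewrite ?vec2_0 ?vec2_1; last by field; rewrite E2 EN.
have -> : 1 - E ^+ 2 - 2 * c * E = - (2 * (w + c)) * E by rewrite EE; ring.
by rewrite wE; field; rewrite EN E2 v0.
Qed.

End AutonomousOde.

(** * The two completions *)

Section Completions.
Variable R : realType.
Implicit Types (M N : plane_connection R) (A : 'M[R]_2) (x v : 'rV[R]_2).

Lemma partial_component_vec2 (f g : 'rV[R]_2 -> R) i :
  partial i (component (fun x => vec2 (f x) (g x)) 0) = partial i f /\
  partial i (component (fun x => vec2 (f x) (g x)) 1) = partial i g.
Proof.
by split; congr partial; apply/funext => x; rewrite /component ?vec2_0 ?vec2_1.
Qed.

Lemma smooth_map_vec2 (f g : 'rV[R]_2 -> R) : smooth setT f -> smooth setT g ->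
  smooth_map setT (fun x => vec2 (f x) (g x)).
Proof.
move=> sf sg; apply: I2_ind => n.
  by rewrite (_ : component _ _ = f)//; apply/funext => x; rewrite /component vec2_0.
by rewrite (_ : component _ _ = g)//; apply/funext => x; rewrite /component vec2_1.
Qed.

Lemma plane_diffeomorphism M (F F' : 'rV[R]_2 -> 'rV[R]_2) :
  cancel F F' -> cancel F' F -> smooth_map setT F -> smooth_map setT F' ->
  intertwines setT (Gam M) (Gam M) F -> intertwines setT (Gam M) (Gam M) F' ->
  affine_diffeomorphism (F : plane M -> plane M).
Proof. by move=> c c' s s' i i'; exists F'; split => //; exact: plane_affine_map. Qed.

Lemma partial_coordD (h : 'rV[R]_2 -> R) (i k : 'I_2) x (d : R) :
  is_derive x (delta_mx 0 i) h d ->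
  partial i (fun y : 'rV[R]_2 => y 0 k + h y) x = (i == k)%:R + d.
Proof.
move=> hd; have d1 := is_derive_coord k x (delta_mx 0 i : 'rV[R]_2).
rewrite /partial (@derive_val _ _ _ _ _ _ _ (derive_add d1 hd)) !mxE eqxx /=.
by rewrite eq_sym.
Qed.

(** Translations are affine, since they have the derivatives of the identity and constant symbols do
    not see the shift. *)
Lemma type_A_homogeneous M : type_A M -> homogeneous (plane M).
Proof.
move=> hM p q.
have tr (w : 'rV[R]_2) : smooth_map setT (fun x => x + w) /\
    intertwines setT (Gam M) (Gam M) (fun x => x + w).
  have cE k : component (fun x => x + w) k = fun x : 'rV[R]_2 => x 0 k + cst (w 0 k) x.
    by apply/funext => x; rewrite /component mxE.
  have pE i k x : partial i (component (fun x => x + w) k) x = (i == k)%:R.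
    by rewrite cE (partial_coordD k (is_derive_cst _ _ _)) addr0.
  split=> [k n|x _ i j k].
    by rewrite cE; apply: Ck_add; [exact: openT|exact: smooth_coord|exact: smooth_cst].
  have := @intertwines_id R setT (Gam M) x I i j k.
  under eq_bigr do rewrite [partial _ _]partial_coord.
  under [X in _ = _ + X -> _]eq_bigr do under eq_bigr do rewrite 2![partial _ _]partial_coord.
  rewrite [partial j _]partial_coord partial_cst => E.
  under eq_bigr do rewrite pE.
  under [X in _ + X]eq_bigr do under eq_bigr do rewrite 2!pE.
  rewrite (_ : partial j _ = cst (j == k)%:R); last by apply/funext => y; rewrite pE.
  rewrite partial_cst E; congr (_ + _).
  by apply: eq_bigr => r _; apply: eq_bigr => s _; have [c hc] := hM r s k; rewrite !hc.
exists (fun x => x + (q - p)); last by rewrite addrC subrK.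
apply: (@plane_diffeomorphism M _ (fun x => x + (p - q))); try by have [] := tr (q - p).
- by move=> x; rewrite -addrA -[q - p]opprB addNr addr0.
- by move=> x; rewrite -addrA -[p - q]opprB addNr addr0.
- by have [] := tr (p - q).
- by have [] := tr (p - q).
Qed.

Lemma is_derive_along_coord (f : R -> R) (l i : 'I_2) x d :
  is_derive (x 0 l) (1 : R) f d ->
  is_derive x (delta_mx 0 i) (fun y : 'rV[R]_2 => f (y 0 l)) (d * (i == l)%:R).
Proof.
move=> df; apply: line_is_derive.
have dl : is_derive (0 : R) (1 : R) (fun k : R => (k *: delta_mx 0 i + x : 'rV[R]_2) 0 l) (i == l)%:R.
  apply: (@is_derive_line _ (fun y : 'rV[R]_2 => y 0 l)); rewrite scale0r add0r.
  by apply: is_derive_eq (is_derive_coord l x _) _; rewrite mxE eqxx eq_sym.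
have df' : is_derive ((0 *: delta_mx 0 i + x : 'rV[R]_2) 0 l) (1 : R) f d.
  by rewrite scale0r add0r.
exact: (@is_derive1_comp _ f (fun k : R => (k *: delta_mx 0 i + x : 'rV[R]_2) 0 l)).
Qed.

(** Both coefficients are kept general because the family is closed under differentiation, which the
    induction on the order needs. *)
Lemma smooth_wave (p q y0 : R) :
  smooth setT (fun x : 'rV[R]_2 => p * cos (x 0 1 - y0) + q * sin (x 0 1 - y0)).
Proof.
move=> n; elim: n p q => [|n IH] p q; have d i x : is_derive x (delta_mx 0 i)
    (fun x : 'rV[R]_2 => p * cos (x 0 1 - y0) + q * sin (x 0 1 - y0))
    ((- p * sin (x 0 1 - y0) + q * cos (x 0 1 - y0)) * (i == 1)%:R).
  1,3: by apply: (@is_derive_along_coord (fun y => p * cos (y - y0) + q * sin (y - y0)));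
    apply: is_derive_eq; rewrite /GRing.scale/=; ring.
all: have c x : {for x, continuous (fun x : 'rV[R]_2 => p * cos (x 0 1 - y0) + q * sin (x 0 1 - y0))}.
  1,3: apply: (@continuous_comp _ _ _ (fun x : 'rV[R]_2 => x 0 1) (fun y => p * cos (y - y0) + q * sin (y - y0)));
    [exact: coord_continuous|apply/differentiable_continuous/derivable1_diffP; apply: ex_derive].
- by split.
split=> // i; split=> [x _|]; first by have [] := d i x.
have [i1|i1] := eqVneq i 1.
  apply: eq_Ck openT _ (IH q (- p)) => x _; rewrite /partial (@derive_val _ _ _ _ _ _ _ (d i x)).
  by rewrite i1 eqxx mulr1 addrC.
apply: eq_Ck openT _ (IH 0 0) => x _; rewrite /partial (@derive_val _ _ _ _ _ _ _ (d i x)).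
by rewrite (negbTE i1) mulr0 !mul0r addr0.
Qed.

(** Adding to x^1 a function u(x^2) with u'' = -u preserves the connection, and so does a
    translation of x^2. A cosine centred at the second coordinate of p shifts p by any prescribed
    amount. *)
Lemma modelN_homogeneous : homogeneous (plane (modelN R)).
Proof.
pose F y0 k b x := vec2 (x 0 0 + (k * cos (x 0 1 - y0) + 0 * sin (x 0 1 - y0))) (x 0 1 + b).
have FK y0 k b : cancel (F y0 k b) (F (y0 + b) (- k) (- b)).
  move=> x; rewrite /F !vec2_0 !vec2_1; apply: rV2P; rewrite ?vec2_0 ?vec2_1; last by rewrite addrK.
  by rewrite (_ : x 0 1 + b - (y0 + b) = x 0 1 - y0); ring.
have sF y0 k b : smooth_map setT (F y0 k b).
  apply: smooth_map_vec2 => n; apply: Ck_add; try exact: openT; try exact: smooth_coord.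
  - exact: smooth_wave.
  - exact: smooth_cst.
have iF y0 k b : intertwines setT (Gam (modelN R)) (Gam (modelN R)) (F y0 k b).
  have dw p q i x : is_derive x (delta_mx 0 i)
      (fun x : 'rV[R]_2 => p * cos (x 0 1 - y0) + q * sin (x 0 1 - y0))
      ((- p * sin (x 0 1 - y0) + q * cos (x 0 1 - y0)) * (i == 1)%:R).
    by apply: (@is_derive_along_coord (fun y => p * cos (y - y0) + q * sin (y - y0)));
    apply: is_derive_eq; rewrite /GRing.scale/=; ring.
  have p0 i x : partial i (component (F y0 k b) 0) x = (i == 0)%:R + (- k * sin (x 0 1 - y0)) * (i == 1)%:R.
    rewrite (partial_component_vec2 _ _ _).1 (partial_coordD 0 (dw k 0 i x)); ring.
  have p1 i x : partial i (component (F y0 k b) 1) x = (i == 1)%:R.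
    rewrite (partial_component_vec2 _ _ _).2 (partial_coordD 1 (is_derive_cst _ _ _)).
    by rewrite addr0.
  have p00 i j x : partial i (partial j (component (F y0 k b) 0)) x =
      - k * cos (x 0 1 - y0) * (i == 1)%:R * (j == 1)%:R.
    rewrite (_ : partial j _ = fun x : 'rV[R]_2 => cst (j == 0)%:R x +
      (0 * cos (x 0 1 - y0) + (- k) * sin (x 0 1 - y0)) * cst (j == 1)%:R x); last first.
      by apply/funext => y; rewrite p0 mul0r add0r.
    have d0 : is_derive x (delta_mx 0 i) (cst (j == 0)%:R : 'rV[R]_2 -> R) 0 by exact: is_derive_cst.
    have d1 : is_derive x (delta_mx 0 i) (cst (j == 1)%:R : 'rV[R]_2 -> R) 0 by exact: is_derive_cst.
    have d := derive_add d0 (derive_mul (dw 0 (- k) i x) d1).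
    by rewrite /partial (@derive_val _ _ _ _ _ _ _ d); ring.
  have p11 i j x : partial i (partial j (component (F y0 k b) 1)) x = 0.
    rewrite (_ : partial j _ = cst (j == 1)%:R) ?partial_cst//.
    by apply/funext => y; rewrite p1.
  move=> x _ i j; apply: I2_ind; rewrite !sum2 /= /symbolsN /= ?p00 ?p11 ?p0 ?p1 /F ?vec2_0;
  move: i j; apply: I2_ind; apply: I2_ind => /=; ring.
move=> p q; exists (F (p 0 1) (q 0 0 - p 0 0) (q 0 1 - p 0 1)).
  apply: (@plane_diffeomorphism (modelN R) _
    (F (p 0 1 + (q 0 1 - p 0 1)) (- (q 0 0 - p 0 0)) (- (q 0 1 - p 0 1)))) => //.
  have := FK (p 0 1 + (q 0 1 - p 0 1)) (- (q 0 0 - p 0 0)) (- (q 0 1 - p 0 1)).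
  by rewrite !opprK addrK.
by apply: rV2P; rewrite /F ?vec2_0 ?vec2_1 ?subrr ?cos0 ?sin0; ring.
Qed.

Lemma id_embedding (S : affine_surface R) : affine_embedding (@id S).
Proof.
have [a i] := affine_diffeomorphism_immersion (id_affine_diffeomorphism S).
split=> //; split=> [//|x|U oU]; first exact: cvg_id.
by exists U => //; rewrite image_id; apply/seteqP; split=> [x Ux|x []//]; split=> //; exists x.
Qed.

(** A complete Type A model is its own geodesic completion. *)
Lemma essentially_incomplete_incomplete M : type_A M ->
  essentially_incomplete (plane M) -> ~ geodesically_complete (plane M).
Proof.
move=> hM eM cM; apply: eM; exists (plane M); split=> //; first exact: type_A_homogeneous.
by exists id; exact: id_embedding.
Qed.

Section ExponentialEmbedding.
Variables (A : 'M[R]_2) (k : R).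
Hypotheses (uA : A \in unitmx) (k0 : k != 0).

Let F x := vec2 (expR (k * (x *m A) 0 0)) ((x *m A) 0 1).

Let dA i l x : is_derive x (delta_mx 0 i) (fun y : 'rV[R]_2 => (y *m A) 0 l) (A i l).
Proof.
have := Ck_derivable i (@Ck_linear R 1 A l) (I : setT x).
by rewrite partial_linear.
Qed.

Let dexp c i x : is_derive x (delta_mx 0 i) (fun y => c * expR (k * (y *m A) 0 0))
  (c * k * A i 0 * expR (k * (x *m A) 0 0)).
Proof.
apply: line_is_derive.
have dl : is_derive (0 : R) (1 : R) (fun u : R => ((u *: delta_mx 0 i + x) *m A) 0 0) (A i 0).
  apply: (@is_derive_line _ (fun y : 'rV[R]_2 => (y *m A) 0 0)); rewrite scale0r add0r; exact: dA.
have x0 : (0 *: delta_mx 0 i + x) = x by rewrite scale0r add0r.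
by apply: is_derive_eq; rewrite /GRing.scale/= x0; ring.
Qed.

Let smooth_exp c : smooth setT (fun y : 'rV[R]_2 => c * expR (k * (y *m A) 0 0)).
Proof.
move=> n; elim: n c => [|n IH] c; have cc x : {for x, continuous (fun y : 'rV[R]_2 => c * expR (k * (y *m A) 0 0))}.
  1,3: apply: (@continuous_comp _ _ _ (fun y : 'rV[R]_2 => (y *m A) 0 0) (fun u => c * expR (k * u)));
    [exact: (Ck0 (@Ck_linear R 0 A 0) I)|
     apply/differentiable_continuous/derivable1_diffP; apply: ex_derive].
- by split.
split=> // i; split=> [x _|]; first by have [] := dexp c i x.
apply: eq_Ck openT _ (IH (c * k * A i 0)) => x _.
by rewrite /partial (@derive_val _ _ _ _ _ _ _ (dexp c i x)).
Qed.

Let smooth_F : smooth_map setT F.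
Proof.
apply: smooth_map_vec2 => n; last exact: (@Ck_linear R n A 1).
apply: eq_Ck openT _ (smooth_exp 1 n) => x _; by rewrite mul1r.
Qed.

Let pF0 i x : partial i (component F 0) x = k * A i 0 * expR (k * (x *m A) 0 0).
Proof.
rewrite (partial_component_vec2 _ _ _).1 (_ : (fun _ => _) = fun y => 1 * expR (k * (y *m A) 0 0)).
  by rewrite /partial (@derive_val _ _ _ _ _ _ _ (dexp 1 i x)) mul1r.
by apply/funext => y; rewrite mul1r.
Qed.

Let pF1 i x : partial i (component F 1) x = A i 1.
Proof. by rewrite (partial_component_vec2 _ _ _).2 /partial (@derive_val _ _ _ _ _ _ _ (dA i 1 x)). Qed.

Let pF00 i j x : partial i (partial j (component F 0)) x =
  k ^+ 2 * A i 0 * A j 0 * expR (k * (x *m A) 0 0).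
Proof.
rewrite (_ : partial j _ = fun y => k * A j 0 * expR (k * (y *m A) 0 0)); last exact/funext/pF0.
by rewrite /partial (@derive_val _ _ _ _ _ _ _ (dexp _ i x)); ring.
Qed.

Let pF11 i j x : partial i (partial j (component F 1)) x = 0.
Proof. by rewrite (_ : partial j _ = cst (A j 1)) ?partial_cst//; exact/funext/pF1. Qed.

(** The hypotheses are the intertwining relation for the two components of [F]. Each derivative of
    the first component carries one exponential factor, counted by the exponent (p == 0) + (q == 0),
    and one factor is divided out. *)
Lemma exponential_embedding M N :
  (forall x i j, \sum_l Gam M i j l x * (k * A l 0) = k ^+ 2 * A i 0 * A j 0 +
    \sum_p \sum_q Gam N p q 0 (F x) * expR (k * (x *m A) 0 0) ^+ ((p == 0) + (q == 0)) *
      (if p == 0 then k * A i p else A i p) * (if q == 0 then k * A j q else A j q)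
      / expR (k * (x *m A) 0 0)) ->
  (forall x i j, \sum_l Gam M i j l x * A l 1 = 0) ->
  (forall x p q, Gam N p q 1 x = 0) ->
  affine_embedding (F : plane M -> plane N).
Proof.
move=> h0 h1 N1; pose e x := expR (k * (x *m A) 0 0).
have e0 x : e x != 0 by rewrite gt_eqF// expR_gt0.
(* The image of [F] is the half-plane z^1 > 0, on which [G] is a continuous inverse; the values of
   [ln] elsewhere do not matter. *)
pose G (z : 'rV[R]_2) := vec2 (k^-1 * ln (z 0 0)) (z 0 1) *m invmx A.
have FG x : G (F x) = x.
  rewrite /G vec2_0 vec2_1 expRK mulKf// -vec2E mulmxK//.
split.
- apply: plane_affine_map => // x _ i j; apply: I2_ind.
    rewrite pF00; under eq_bigr do rewrite pF0.
    transitivity ((\sum_l Gam M i j l x * (k * A l 0)) * e x).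
      by rewrite !sum2 /e; ring.
    by rewrite h0 !sum2 /= !pF0 !pF1 /e; field; exact: e0.
  rewrite pF11; under eq_bigr do rewrite pF1.
  rewrite h1 add0r; apply/esym/big1 => p _; apply: big1 => q _.
  by rewrite [Gam _ _ _ _ _]N1 !mul0r.
- move=> i j x _; rewrite [local_expr _ _ _](_ : _ = F)// unitmxE unitfE det_mx2 !mxE !pF0 !pF1.
  rewrite (_ : _ - _ = k * e x * \det A); last by rewrite det_mx2 /e; ring.
  by rewrite !mulf_neq0// -unitfE -unitmxE.
split.
- exact: can_inj FG.
- by move=> x; apply: cvg_rV2 => l; apply: Ck0 (smooth_F l 0) _.
move=> U oU; exists [set z : 'rV[R]_2 | 0 < z 0 0 /\ U (G z)].
  rewrite openE => z [z0 Uz].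
  have cz l : {for z, continuous (fun z : 'rV[R]_2 => z 0 l)} by exact: coord_continuous.
  have cG : {for z, continuous G}.
    have cH : {for z, continuous (fun z : 'rV[R]_2 => vec2 (k^-1 * ln (z 0 0)) (z 0 1))}.
      apply: cvg_rV2; apply: I2_ind.
        rewrite (_ : (fun _ => _) = fun u : 'rV[R]_2 => k^-1 * ln (u 0 0)).
          apply: (@continuous_comp _ _ _ (fun u : 'rV[R]_2 => u 0 0) (fun y => k^-1 * ln y)) => //.
          have dl := is_derive1_ln z0.
          by apply/differentiable_continuous/derivable1_diffP; apply: ex_derive.
        by apply/funext => u; rewrite vec2_0.
      rewrite (_ : (fun _ => _) = fun u : 'rV[R]_2 => u 0 1)//.
      by apply/funext => u; rewrite vec2_1.
    apply: (@continuous_comp _ _ _ (fun z : 'rV[R]_2 => vec2 (k^-1 * ln (z 0 0)) (z 0 1))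
      (mulmxr (invmx A))); first exact: cH.
    by apply: cvg_rV2 => l; apply: (Ck0 (@Ck_linear R 0 (invmx A) l)).
  have n0 : nbhs (z 0 0) [set y : R | 0 < y] by apply: open_nbhs_nbhs; split=> //; exact: open_gt.
  have nU : nbhs (G z) U by exact: open_nbhs_nbhs.
  by apply: filterI; [exact: (cz 0 _ n0)|exact: (cG _ nU)].
apply/seteqP; split=> [_ [x Ux <-]|z [[_ Ux] [x _ xE]]].
  by split; [rewrite /= vec2_0 expR_gt0 FG|exists x].
by exists x => //; rewrite -(FG x) [F x]xE.
Qed.

End ExponentialEmbedding.

(** In the variable ln x^1 the symbol Gamma_22^1 = x^1 becomes 1, and the second derivative of the
    exponential produces Gamma_11^1 = 1. *)
Lemma M1_5_completion M : linearly_equivalent M (M1_5 R) ->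
  geodesic_completion (plane M) (plane (modelN R)).
Proof.
move=> [A uA h]; split; [exact: modelN_homogeneous|exact: modelN_complete|].
have E x i j k : \sum_l Gam M i j l x * A l k =
    \sum_p \sum_q symbols 1 0 0 0 1 0 p q k * A i p * A j q.
  have := h x I i j k; rewrite [partial j _]partial_linear partial_cst add0r => {}h.
  transitivity (\sum_l Gam M i j l x * partial l (component (mulmxr A) k) x).
    by apply: eq_bigr => l _; rewrite partial_linear.
  by rewrite h; apply: eq_bigr => p _; apply: eq_bigr => q _; rewrite !partial_linear.
exists (fun x => vec2 (expR (1 * (x *m A) 0 0)) ((x *m A) 0 1)).
apply: exponential_embedding => //; rewrite ?oner_eq0//.
- move=> x i j; under eq_bigr do rewrite mul1r.
  rewrite E !sum2 /= /symbolsN /symbols /= vec2_0; field.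
  by rewrite gt_eqF// expR_gt0.
- by move=> x i j; rewrite E !sum2 /symbols /=; ring.
- by move=> x p q; rewrite /= /symbolsN !andbF.
Qed.

(** In the variable - ln x^1 the symbol Gamma_12^1 = -1/2 is unchanged, and the sign in the exponent
    makes Gamma_11^1 = -1. *)
Lemma M1_2_completion M : linearly_equivalent M (M1_2 R) ->
  geodesic_completion (plane M) (plane (M1_3 R)).
Proof.
move=> [A uA h]; split; [exact/type_A_homogeneous/model_type_A|exact: M1_3_complete|].
have E x i j k : \sum_l Gam M i j l x * A l k =
    \sum_p \sum_q symbols (- 1) 0 (- 2^-1) 0 0 0 p q k * A i p * A j q.
  have := h x I i j k; rewrite [partial j _]partial_linear partial_cst add0r => {}h.
  transitivity (\sum_l Gam M i j l x * partial l (component (mulmxr A) k) x).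
    by apply: eq_bigr => l _; rewrite partial_linear.
  by rewrite h; apply: eq_bigr => p _; apply: eq_bigr => q _; rewrite !partial_linear.
exists (fun x => vec2 (expR (- 1 * (x *m A) 0 0)) ((x *m A) 0 1)).
apply: exponential_embedding => //; rewrite ?oppr_eq0 ?oner_eq0//.
- move=> x i j.
  transitivity (- \sum_l Gam M i j l x * A l 0); first by rewrite !sum2; ring.
  rewrite E !sum2 /= /symbols /=; field.
  by rewrite gt_eqF// expR_gt0.
- by move=> x i j; rewrite E !sum2 /symbols /=; ring.
- by move=> x; apply: I2_ind; apply: I2_ind.
Qed.

End Completions.

(** * Classification *)

Section RicciOfModels.
Variable R : realType.
Implicit Types (M N : plane_connection R) (x v w : 'rV[R]_2).

Lemma type_A_const M : type_A M -> forall i j k, Gam M i j k = cst (Gam M i j k 0).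
Proof. by move=> hM i j k; apply/funext => x; have [c hc] := hM i j k; rewrite /cst !hc. Qed.

Lemma type_A_Ric M a b x : type_A M -> Ric (Gam M) a b x =
  \sum_k \sum_l (Gam M a b l 0 * Gam M k l k 0 - Gam M k b l 0 * Gam M a l k 0).
Proof.
move=> hM; rewrite /Ric /ricci_expr; apply: eq_bigr => k _.
rewrite (type_A_const hM a b k) (type_A_const hM k b k) !partial_cst subrr add0r.
have GE i j l : Gam M i j l x = Gam M i j l 0 by rewrite (type_A_const hM).
by apply: eq_bigr => l _; rewrite !GE.
Qed.

(** The components of rho are constant, so only the connection terms of nabla rho remain. *)
Lemma type_A_nablaRic M x (u v w : 'rV[R]_2) : type_A M ->
  nablaric_form (Gam M) x u v w = - ric_form (Gam M) x (product (Gam M) x u v) w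
    - ric_form (Gam M) x v (product (Gam M) x u w).
Proof.
move=> hM; have RC a b : Ric (Gam M) a b = cst (Ric (Gam M) a b x).
  by apply/funext => y; rewrite /cst !type_A_Ric.
have E m a b : nablaRic (Gam M) m a b x = - \sum_l (Gam M m a l x * Ric (Gam M) l b x
    + Gam M m b l x * Ric (Gam M) a l x).
  by rewrite /nablaRic /nabla_expr (RC a b) partial_cst sub0r.
rewrite /nablaric_form; under eq_bigr do under eq_bigr do under eq_bigr do rewrite E.
rewrite /ric_form !sum2 !mxE !sum2.
move: (fun a b => Ric (Gam M) a b x) => rho.
move: (fun a b c => Gam M a b c x) => g.
ring.
Qed.

Lemma model_ric a c d e f x v w : ric_form (Gam (model a 0 c d e f)) x v w =
  d * (a - d) * (v 0 0 * w 0 0) + c * d * (v 0 0 * w 0 1 + v 0 1 * w 0 0) +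
  (a * e - e * d + f * c - c ^+ 2) * (v 0 1 * w 0 1).
Proof.
rewrite /ric_form; under eq_bigr do under eq_bigr do rewrite (type_A_Ric _ _ _ (model_type_A _ _ _ _ _ _)).
by rewrite !sum2 /= /symbols /=; ring.
Qed.

Lemma model_product a b c d e f x v w : product (Gam (model a b c d e f)) x v w =
  vec2 (a * (v 0 0 * w 0 0) + c * (v 0 0 * w 0 1 + v 0 1 * w 0 0) + e * (v 0 1 * w 0 1))
    (b * (v 0 0 * w 0 0) + d * (v 0 0 * w 0 1 + v 0 1 * w 0 0) + f * (v 0 1 * w 0 1)).
Proof.
by apply: rV2P; rewrite ?vec2_0 ?vec2_1 mxE !sum2 /= /symbols /=; ring.
Qed.

Lemma symmetric_form_nondegenerate (p q r : R) :
  (forall v, (forall w, p * (v 0 0 * w 0 0) + q * (v 0 0 * w 0 1 + v 0 1 * w 0 0) +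
     r * (v 0 1 * w 0 1) = 0) -> v = 0) <-> p * r - q ^+ 2 != 0.
Proof.
split=> [h|D v h].
  apply/eqP => D.
  have z0 (x y : R) : p * x + q * y = 0 -> q * x + r * y = 0 -> x = 0 /\ y = 0.
    move=> h1 h2; have := h (vec2 x y) => /(_ _)E.
    have : vec2 x y = 0.
      apply: E => w; rewrite vec2_0 vec2_1.
      transitivity ((p * x + q * y) * w 0 0 + (q * x + r * y) * w 0 1); first by ring.
      by rewrite h1 h2 !mul0r addr0.
    by move=> /rowP E'; have := E' 0; have := E' 1; rewrite vec2_0 vec2_1 !mxE.
  have [q0 p0] : q = 0 /\ - p = 0.
    apply: z0; first by ring.
    by transitivity (- (p * r - q ^+ 2)); [ring|rewrite D oppr0].
  have [r0 _] : r = 0 /\ - q = 0.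
    apply: z0; last by ring.
    by transitivity (p * r - q ^+ 2); first by ring.
  have p0' : p = 0 by apply/eqP; rewrite -oppr_eq0 p0.
  have [||/eqP] := z0 1 0; rewrite ?p0' ?q0 ?mul0r ?mulr0 ?addr0//.
  by rewrite oner_eq0.
have h0 := h (vec2 1 0); have h1 := h (vec2 0 1).
rewrite !vec2_0 !vec2_1 in h0 h1.
apply: rV2P; rewrite mxE; apply: (mulfI D); rewrite mulr0.
  transitivity (r * (p * (v 0 0 * 1) + q * (v 0 0 * 0 + v 0 1 * 1) + r * (v 0 1 * 0))
    - q * (p * (v 0 0 * 0) + q * (v 0 0 * 1 + v 0 1 * 0) + r * (v 0 1 * 1))); first by ring.
  by rewrite h0 h1 !mulr0 subrr.
transitivity (p * (p * (v 0 0 * 0) + q * (v 0 0 * 1 + v 0 1 * 0) + r * (v 0 1 * 1))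
  - q * (p * (v 0 0 * 1) + q * (v 0 0 * 0 + v 0 1 * 1) + r * (v 0 1 * 0))); first by ring.
by rewrite h0 h1 !mulr0 subrr.
Qed.

Lemma nabla_const M (X Y : 'rV[R]_2) x : type_A M ->
  nabla M (cst X) (cst Y) x = product (Gam M) 0 X Y.
Proof.
move=> hM; apply/rowP => k; rewrite !mxE.
rewrite (_ : component (cst Y) k = cst (Y 0 k))// derive_cst add0r.
by apply: eq_bigr => i _; apply: eq_bigr => j _; rewrite (type_A_const hM).
Qed.

Lemma curvature_const M (X Y Z : 'rV[R]_2) x : type_A M ->
  curvature M (cst X) (cst Y) (cst Z) x =
  product (Gam M) 0 X (product (Gam M) 0 Y Z) - product (Gam M) 0 Y (product (Gam M) 0 X Z).
Proof.
move=> hM; rewrite /curvature.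
have nE (V W : 'rV[R]_2) : nabla M (cst V) (cst W) = cst (product (Gam M) 0 V W).
  by apply/funext => y; exact: nabla_const.
have -> : bracket (cst X) (cst Y) = cst (0 : 'rV[R]_2).
  apply/funext => y; apply/rowP => k; rewrite !mxE.
  by rewrite (_ : component (cst Y) k = cst (Y 0 k))// (_ : component (cst X) k = cst (X 0 k))// !derive_cst subrr.
rewrite !nE /cst (_ : product (Gam M) 0 0 Z = 0) ?subr0//.
by apply/rowP => k; rewrite !mxE !sum2 !mxE; ring.
Qed.

(** The bridge from the trace of the curvature of vector fields to the coordinate formula used by
    the tensor calculus. *)
Lemma ricciE M (i j : 'I_2) x : type_A M ->
  ricci M (coord_field i) (coord_field j) x = Ric (Gam M) i j x.
Proof.
move=> hM; rewrite /ricci /mxtrace type_A_Ric//; apply: eq_bigr => k _; rewrite mxE.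
rewrite curvature_const// !mxE !sum2 !mxE !sum2 !mxE !eqxx.
by move: i j k; do 3 apply: I2_ind; rewrite /=; ring.
Qed.

(** The Ricci tensor of a Type A model is constant, so the origin represents all points. The rank
    enters the classification only through this condition and the next. *)
Definition ricci_zero M := forall v w, ric_form (Gam M) 0 v w = 0.

Definition ricci_nondegenerate M :=
  forall v, (forall w, ric_form (Gam M) 0 v w = 0) -> v = 0.

Lemma linearly_equivalent_ric M N : type_A M -> type_A N -> linearly_equivalent M N ->
  exists2 A, A \in unitmx & forall v w,
    ric_form (Gam M) 0 v w = ric_form (Gam N) 0 (v *m A) (w *m A).
Proof.
move=> hM hN [A uA h]; exists A => // v w.
by have [-> _] := linear_tensors 0 uA h; rewrite mul0mx.
Qed.

Lemma ricci_zero_equivalent M N : type_A M -> type_A N -> linearly_equivalent M N ->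
  ricci_zero M -> ricci_zero N.
Proof.
move=> hM hN /(linearly_equivalent_ric hM hN)[A uA E] z v w.
by rewrite -[v](mulmxKV uA) -[w](mulmxKV uA) -E z.
Qed.

Lemma ricci_nondegenerate_equivalent M N : type_A M -> type_A N ->
  linearly_equivalent M N -> ricci_nondegenerate M -> ricci_nondegenerate N.
Proof.
move=> hM hN /(linearly_equivalent_ric hM hN)[A uA E] z v h.
rewrite -[v](mulmxKV uA) (z (v *m invmx A)) ?mul0mx// => w.
by rewrite E mulmxKV.
Qed.

Lemma flat_ricci_zero M : type_A M -> flat M -> ricci_zero M.
Proof.
move=> hM fM v w; rewrite /ric_form; apply: big1 => a _; apply: big1 => b _.
rewrite -ricciE// /ricci /mxtrace big1 ?mul0r// => k _; rewrite mxE.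
by rewrite fM ?mxE// => l n; exact: smooth_cst.
Qed.

Lemma ric_form_mx M v w : ric_form (Gam M) 0 v w =
  (v *m (\matrix_(i, j) Ric (Gam M) i j 0) *m w^T) 0 0.
Proof. by rewrite /ric_form !mxE !sum2 !mxE !sum2 !mxE; ring. Qed.

Lemma ricci_rank_mx M r : type_A M -> ricci_rank M r ->
  \rank (\matrix_(i, j) Ric (Gam M) i j 0) = r.
Proof.
move=> hM /(_ 0) <-; congr (\rank _); apply/matrixP => i j.
by rewrite !mxE ricciE.
Qed.

Lemma ricci_rank1 M : type_A M -> ricci_rank M 1 ->
  ~ ricci_zero M /\ ~ ricci_nondegenerate M.
Proof.
move=> hM /(ricci_rank_mx hM); set A := (\matrix_(i, j) _) => rA; split=> h.
  suff A0 : A = 0 by move: rA; rewrite A0 mxrank0.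
  apply/matrixP => i j; have := h (delta_mx 0 i) (delta_mx 0 j).
  rewrite ric_form_mx -/A -rowE mxE sum2 !mxE !eqxx.
  by move: j; apply: I2_ind => /=; rewrite ?mulr0 ?mulr1 ?addr0 ?add0r.
have : row_free A.
  apply/inj_row_free => v vA; apply: h => w.
  by rewrite ric_form_mx -/A vA mul0mx mxE.
by rewrite /row_free rA.
Qed.

Lemma ricci_rank2 M : type_A M -> ricci_rank M 2 -> ricci_nondegenerate M.
Proof.
move=> hM /(ricci_rank_mx hM); set A := (\matrix_(i, j) _) => rA v h.
have fA : row_free A by rewrite /row_free rA.
apply: (row_free_inj fA); rewrite mul0mx; apply/rowP => j.
have := h (delta_mx 0 j); rewrite ric_form_mx -/A => E; rewrite [RHS]mxE -[RHS]E.
rewrite [RHS]mxE sum2 !mxE !eqxx.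
by move: j E; apply: I2_ind => _ /=; rewrite ?mulr0 ?mulr1 ?addr0 ?add0r.
Qed.

End RicciOfModels.

(** * Normal forms by change of basis *)

Section NormalForms.
Variable R : realType.
Implicit Types (M N : plane_connection R) (x v w : 'rV[R]_2).

Lemma type_A_model M : type_A M ->
  exists a b c d e f, linearly_equivalent M (model a b c d e f).
Proof.
move=> hM.
exists (Gam M 0 0 0 0), (Gam M 0 0 1 0), (Gam M 0 1 0 0), (Gam M 0 1 1 0),
  (Gam M 1 1 0 0), (Gam M 1 1 1 0), 1%:M; first exact: unitmx1.
apply/intertwines_linear => x v w; rewrite !mulmx1 model_product.
have GE i j k : Gam M i j k x = Gam M i j k 0 by rewrite (type_A_const hM).
by apply: rV2P; rewrite ?vec2_0 ?vec2_1 mxE !sum2 !GE (Gam_sym M 1 0); ring.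
Qed.

(* The new basis is (p, q), (r, s). *)
Lemma model_basis (a b c d e f a' b' c' d' e' f' p q r s : R) :
  p * s - q * r != 0 ->
  a * p ^+ 2 + 2 * c * p * q + e * q ^+ 2 = a' * p + b' * r ->
  b * p ^+ 2 + 2 * d * p * q + f * q ^+ 2 = a' * q + b' * s ->
  a * p * r + c * (p * s + q * r) + e * q * s = c' * p + d' * r ->
  b * p * r + d * (p * s + q * r) + f * q * s = c' * q + d' * s ->
  a * r ^+ 2 + 2 * c * r * s + e * s ^+ 2 = e' * p + f' * r ->
  b * r ^+ 2 + 2 * d * r * s + f * s ^+ 2 = e' * q + f' * s ->
  linearly_equivalent (model a b c d e f) (model a' b' c' d' e' f').
Proof.
move=> D h1 h2 h3 h4 h5 h6; apply: linearly_equivalent_sym.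
pose B : 'M[R]_2 := \matrix_(i, j) (if i == 0 then vec2 p q 0 j else vec2 r s 0 j).
have [B00 B01 B10 B11] : [/\ B 0 0 = p, B 0 1 = q, B 1 0 = r & B 1 1 = s].
  by split; rewrite mxE /= ?vec2_0 ?vec2_1.
exists B; first by rewrite unitmxE unitfE det_mx2 B00 B01 B10 B11.
have vB (v : 'rV[R]_2) k : (v *m B) 0 k = v 0 0 * B 0 k + v 0 1 * B 1 k by rewrite mxE sum2.
apply/intertwines_linear => x v w; rewrite !model_product.
apply: rV2P; rewrite ?vec2_0 ?vec2_1 !vB ?vec2_0 ?vec2_1 B00 B01 B10 B11.
  transitivity (v 0 0 * w 0 0 * (a' * p + b' * r) +
    (v 0 0 * w 0 1 + v 0 1 * w 0 0) * (c' * p + d' * r) + v 0 1 * w 0 1 * (e' * p + f' * r)).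
    by ring.
  by rewrite -h1 -h3 -h5; ring.
transitivity (v 0 0 * w 0 0 * (a' * q + b' * s) +
  (v 0 0 * w 0 1 + v 0 1 * w 0 0) * (c' * q + d' * s) + v 0 1 * w 0 1 * (e' * q + f' * s)).
  by ring.
by rewrite -h2 -h4 -h6; ring.
Qed.

Lemma cubic_bound (p q r n : R) : 0 <= p -> 0 <= q -> 0 <= r -> n = 1 + p + q + r ->
  p * n ^+ 2 + q * n + r <= n ^+ 3.
Proof.
move=> p0 q0 r0 nE; have n1 : 1 <= n by rewrite nE; lra.
have hq : q * n <= q * n ^+ 2 by apply: ler_wpM2l => //; rewrite expr2 ler_peMl//; lra.
have hr : r <= r * n ^+ 2 by rewrite ler_peMr// expr2 mulr_ege1.
have hn : 0 <= n ^+ 2 by exact: sqr_ge0.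
have -> : n ^+ 3 = n ^+ 2 + p * n ^+ 2 + q * n ^+ 2 + r * n ^+ 2.
  by rewrite [LHS]exprS {1}nE; ring.
by move: (n ^+ 2) hq hr hn => m; lra.
Qed.

(** At the two points of absolute value N = 1 + |p| + |q| + |r| the cube dominates the lower terms,
    so the polynomial changes sign between them. *)
Lemma cubic_root (p q r : R) : exists x : R, x ^+ 3 + p * x ^+ 2 + q * x + r = 0.
Proof.
pose N := 1 + `|p| + `|q| + `|r|.
have N1 : 1 <= N by rewrite /N -!addrA lerDl !addr_ge0.
pose P (x : R) := x ^+ 3 + p * x ^+ 2 + q * x + r.
have cP : continuous P.
  move=> x; apply/differentiable_continuous/derivable1_diffP; apply: ex_derive.
have bound (x : R) : `|x| = N -> `|p * x ^+ 2 + q * x + r| <= N ^+ 3.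
  move=> xN; rewrite (le_trans (ler_normD _ _))// (le_trans (lerD (ler_normD _ _) (lexx _)))//.
  rewrite normrM normrX normrM xN.
  exact: cubic_bound.
have hi : 0 <= P N.
  have := bound N; rewrite gtr0_norm ?(lt_le_trans ltr01)// => /(_ erefl).
  by rewrite ler_norml => /andP[h _]; rewrite /P -!addrA; lra.
have lo : P (- N) <= 0.
  have := bound (- N); rewrite normrN gtr0_norm ?(lt_le_trans ltr01)// => /(_ erefl).
  rewrite ler_norml => /andP[_ h]; rewrite /P.
  have -> : (- N) ^+ 3 = - N ^+ 3 by ring.
  by lra.
have [|||x _ Px] := @IVT R P (- N) N 0; last by exists x.
- by lra.
- exact: continuous_subspaceT.
- by rewrite ge_min lo /= le_max hi orbT.
Qed.

(* The directions e with Gamma(e, e) proportional to e are the roots of a cubic form. *)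
Lemma model_eigendirection (a b c d e f : R) : exists a' c' d' e' f',
  linearly_equivalent (model a b c d e f) (model a' 0 c' d' e' f').
Proof.
have [->|b0] := eqVneq b 0.
  exists a, c, d, e, f; exists 1%:M; first exact: unitmx1.
  by apply/intertwines_linear => x v w; rewrite !mulmx1.
have [x Px] := cubic_root (- (a - 2 * d) / b) (- (2 * c - f) / b) (- e / b).
have {}Px : a * x ^+ 2 + 2 * c * x + e = (b * x ^+ 2 + 2 * d * x + f) * x.
  apply/eqP; rewrite -subr_eq0; apply/eqP.
  transitivity (- b * (x ^+ 3 + - (a - 2 * d) / b * x ^+ 2 + - (2 * c - f) / b * x + - e / b)).
    by field.
  by rewrite Px mulr0.
exists (b * x ^+ 2 + 2 * d * x + f), (b * x + d), (a * x + c - (b * x + d) * x), b, (a - b * x).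
apply: (@model_basis _ _ _ _ _ _ _ _ _ _ _ _ x 1 1 0); rewrite ?mulr0 ?sub0r; try ring.
- by rewrite mulr1 oppr_eq0 oner_eq0.
- by rewrite -Px; ring.
Qed.

(** Puts another eigendirection in first position. The basis is completed by (1, 0), whence y !=
    0. *)
Lemma rebase_eigendirection (a b c d e f x y l : R) : y != 0 ->
  a * x ^+ 2 + 2 * c * x * y + e * y ^+ 2 = l * x ->
  b * x ^+ 2 + 2 * d * x * y + f * y ^+ 2 = l * y ->
  exists c' d' e' f', linearly_equivalent (model a b c d e f) (model l 0 c' d' e' f').
Proof.
move=> y0 hx hy.
exists ((b * x + d * y) / y), (a * x + c * y - (b * x + d * y) / y * x), (b / y), (a - b / y * x).
apply: (@model_basis _ _ _ _ _ _ _ _ _ _ _ _ x y 1 0).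
- by rewrite mulr0 sub0r mulr1 oppr_eq0.
- by rewrite hx; ring.
- by rewrite hy; ring.
- by field.
- by field.
- by field.
- by field.
Qed.

End NormalForms.

(** * Logarithmic rays and the criteria up to linear equivalence *)

Section RaysAndTransport.
Variable R : realType.
Implicit Types (M N : plane_connection R) (v w : 'rV[R]_2).

Lemma ray_geodesic (a b c d e f x y l : R) : l != 0 ->
  a * x ^+ 2 + 2 * c * x * y + e * y ^+ 2 = l * x ->
  b * x ^+ 2 + 2 * d * x * y + f * y ^+ 2 = l * y ->
  geodesic_on [set t | 0 < t]
    ((fun t => vec2 (x / l * ln t) (y / l * ln t)) : R -> plane (model a b c d e f)) /\
  forall t, 0 < t -> velocity (fun t => vec2 (x / l * ln t) (y / l * ln t)) t =
    vec2 (x / l * t^-1) (y / l * t^-1).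
Proof.
move=> l0 hx hy; apply: (@model_geodesic _ _ _ _ _ _ _ _ _ _ _ _
  (fun t => - (x / l) * t ^- 2) (fun t => - (y / l) * t ^- 2)); first exact: ray_open.
  move=> t /= t0; have dl := is_derive1_ln t0; have tn : t != 0 by rewrite gt_eqF.
  have di := @is_deriveV R id t _ _ tn (is_derive_id _ _).
  split; apply: is_derive_eq; rewrite /GRing.scale/=; by [ring|field].
move=> t /= t0; have tn : t != 0 by rewrite gt_eqF.
split.
  transitivity (- (x / l) * t ^- 2 + (a * x ^+ 2 + 2 * c * x * y + e * y ^+ 2) / l ^+ 2 * t ^- 2).
    by field; rewrite tn l0.
  by rewrite hx; field; rewrite tn l0.
transitivity (- (y / l) * t ^- 2 + (b * x ^+ 2 + 2 * d * x * y + f * y ^+ 2) / l ^+ 2 * t ^- 2).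
  by field; rewrite tn l0.
by rewrite hy; field; rewrite tn l0.
Qed.

Lemma ln_unbounded (k : R) (g : R -> R) : {for (0 : R), continuous g} ->
  (forall t, 0 < t -> g t = k * ln t) -> k = 0.
Proof.
move=> cg gE; apply/eqP/negPn/negP => k0.
have : \forall t \near (0 : R), `|g 0 - g t| <= 1 by move/cvgrPdist_le: cg; apply.
move/nbhs_ballP => [e e0 he].
pose m := (`|g 0| + 2) / `|k|.
have k1 : 0 < `|k| by rewrite normr_gt0.
have m0 : 0 < m by rewrite divr_gt0// ltr_wpDl.
have [t [t0 te tm]] : exists t : R, [/\ 0 < t, t < e & t <= expR (- m)].
  exists (Num.min (e / 2) (expR (- m))); rewrite lt_min expR_gt0 divr_gt0//= ge_min lexx orbT.
  by split=> //; rewrite gt_min ltr_pdivrMr// ltr_pMr// ltr1n.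
have := he t; rewrite -ball_normE/= sub0r normrN gtr0_norm// => /(_ te).
rewrite (gE t t0) => h.
have lt : ln t <= - m by rewrite -(expRK (- m)) ler_ln ?posrE ?expR_gt0.
have : `|k| * m <= `|k * ln t|.
  by rewrite normrM ler_pM2l// -[`|ln t|]normrN (le_trans _ (ler_norm _))//= lerNr.
rewrite /m mulrCA divff ?mulr1 ?normr_eq0// => h2.
have h3 : `|k * ln t| <= `|g 0| + 1.
  rewrite -[k * ln t](subKr (g 0)) (le_trans (ler_normB _ _))// lerD2l//.
by move: h2 h3; move: `|k * ln t| `|g 0| => p q; lra.
Qed.

Lemma ray_incomplete (a b c d e f x y l : R) : l != 0 -> (x != 0) || (y != 0) ->
  a * x ^+ 2 + 2 * c * x * y + e * y ^+ 2 = l * x ->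
  b * x ^+ 2 + 2 * d * x * y + f * y ^+ 2 = l * y ->
  ~ geodesically_complete (plane (model a b c d e f)).
Proof.
move=> l0 xy hx hy cM; have [gs _] := ray_geodesic l0 hx hy.
have [s [cs _] sE] := cM _ _ (@ray_open R) (@ray_itv R) (@ray0 R) gs.
have z (k : 'I_2) (q : R) : (forall t, 0 < t -> s t 0 k = q / l * ln t) -> q = 0.
  move=> h; have cz : {for (0 : R), continuous (fun t => (s t : 'rV[R]_2) 0 k)}.
    exact: (@cvg_rV2_coord R R s 0 k (cs 0 I)).
  have := ln_unbounded cz h.
  by move/eqP; rewrite mulf_eq0 invr_eq0 (negbTE l0) orbF => /eqP.
have x0 : x = 0 by apply: (z 0) => t t0; rewrite sE// vec2_0.
have y0 : y = 0 by apply: (z 1) => t t0; rewrite sE// vec2_1.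
by move: xy; rewrite x0 y0 eqxx.
Qed.

Lemma equivalent_blow_up M N (s : R -> 'rV[R]_2) : linearly_equivalent M N ->
  geodesic_on [set t | 0 < t] (s : R -> plane N) ->
  (forall B e : R, 0 < e -> exists2 t, 0 < t < e &
     B < `|ric_form (Gam N) (s t) (velocity s t) (velocity s t)|) ->
  essentially_incomplete (plane M).
Proof.
move=> /linearly_equivalent_sym[B uB h] gs unb.
have [gs' vs] := linear_geodesic (@ray_open R) uB h gs.
apply: (ricci_blow_up gs') => K e e0; have [t /andP[t0 te] ht] := unb K e e0.
exists t; first by rewrite t0.
by rewrite vs//; have [<- _] := linear_tensors (s t) uB h.
Qed.

Lemma equivalent_isotropic_ray M N (s : R -> 'rV[R]_2) (k : R) : linearly_equivalent M N ->
  k != 0 -> geodesic_on [set t | 0 < t] (s : R -> plane N) ->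
  (forall t w, 0 < t -> t * nablaric_form (Gam N) (s t) (velocity s t) (velocity s t) w =
     k * ric_form (Gam N) (s t) (velocity s t) w) ->
  (forall t, 0 < t -> velocity s t != 0) -> ricci_nondegenerate M ->
  essentially_incomplete (plane M).
Proof.
move=> /linearly_equivalent_sym[B uB h] k0 gs iso v0 nd.
have [gs' vs] := linear_geodesic (@ray_open R) uB h gs.
apply: (isotropic_ray k0 gs' _ _ nd) => [t w t0|t t0].
  rewrite vs//; have [r n] := linear_tensors (s t) uB h.
  by rewrite -[w](mulmxKV uB) -r -n iso.
rewrite vs//; apply: contra (v0 t t0) => /eqP/(congr1 (mulmx^~ (invmx B))).
by rewrite mulmxK// mul0mx => ->.
Qed.

Lemma equivalent_cubic_relation M N (J : set R) (s : R -> 'rV[R]_2) (k t0 : R) :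
  linearly_equivalent M N -> 0 < k -> open J -> is_interval J -> J t0 ->
  geodesic_on J (s : R -> plane N) ->
  (forall v, nablaric_form (Gam N) 0 v v v ^+ 2 = k * ric_form (Gam N) 0 v v ^+ 3) ->
  ric_form (Gam N) (s t0) (velocity s t0) (velocity s t0) != 0 ->
  essentially_incomplete (plane M).
Proof.
move=> /linearly_equivalent_sym[B uB h] k0 oJ iJ J0 gs cub r0.
have [gs' vs] := linear_geodesic oJ uB h gs.
apply: (cubic_relation (x0 := 0) k0 oJ iJ J0 gs').
  move=> v; have [r n] := linear_tensors 0 uB h.
  by rewrite -[v](mulmxKV uB) -[0](mul0mx _ B) -r -n cub.
by rewrite vs//; have [<- _] := linear_tensors (s t0) uB h.
Qed.

Lemma inverse_square_unbounded (k : R) : k != 0 -> forall B e : R, 0 < e ->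
  exists2 t : R, 0 < t < e & B < `|k * t ^- 2|.
Proof.
move=> k0 B e e0; have k1 : 0 < `|k| by rewrite normr_gt0.
(* With t = m^-1: the summand e^-1 gives t < e, and m >= 1 gives |k| m^2 >= |k| m > |B|. *)
pose m := `|B| / `|k| + 1 + e^-1.
have Bk : 0 <= `|B| / `|k| by rewrite divr_ge0.
have e1 : 0 < e^-1 by rewrite invr_gt0.
have m1 : 1 <= m by rewrite /m; lra.
have m0 : 0 < m by exact: lt_le_trans m1.
exists m^-1.
  rewrite invr_gt0 m0 -[e]invrK ltf_pV2 ?posrE// /m; lra.
rewrite exprVn invrK normrM normrX (gtr0_norm m0).
apply: le_lt_trans (ler_norm B) _; rewrite -ltr_pdivrMl// mulrC.
apply: (@lt_le_trans _ _ m); first by rewrite /m; lra.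
by rewrite expr2 ler_peMl// ltW.
Qed.

(** On the ray of v = (x, y), rho(s', s') = rho(v, v) / (l t)^2; the last hypothesis is rho(v, v) !=
    0. *)
Lemma ray_essentially_incomplete M (a c d e f x y l : R) :
  linearly_equivalent M (model a 0 c d e f) -> l != 0 ->
  a * x ^+ 2 + 2 * c * x * y + e * y ^+ 2 = l * x ->
  2 * d * x * y + f * y ^+ 2 = l * y ->
  d * (a - d) * x ^+ 2 + 2 * c * d * x * y + (a * e - e * d + f * c - c ^+ 2) * y ^+ 2 != 0 ->
  essentially_incomplete (plane M).
Proof.
move=> MN l0 hx hy; set r := _ + _ => r0.
have hy' : 0 * x ^+ 2 + 2 * d * x * y + f * y ^+ 2 = l * y by rewrite mul0r add0r.
have [gs vs] := ray_geodesic l0 hx hy'.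
apply: (equivalent_blow_up MN gs) => B e' e'0.
have [|t t0e tB] := @inverse_square_unbounded (r / l ^+ 2) _ B e' e'0.
  by rewrite mulf_neq0// invr_eq0 expf_neq0.
exists t => //; case/andP: t0e => t0 _; have tn : t != 0 by rewrite gt_eqF.
rewrite vs// model_ric !vec2_0 !vec2_1; apply: lt_le_trans tB _.
rewrite le_eqVlt; apply/orP; left; apply/eqP; congr `|_|.
by rewrite /r; field; rewrite tn l0.
Qed.

End RaysAndTransport.

(** * Case analysis of the normal forms *)

Section Classification.
Variable R : realType.
Implicit Types (M N : plane_connection R) (x v w : 'rV[R]_2).

Lemma eigendirection_model M : type_A M ->
  exists a c d e f, linearly_equivalent M (model a 0 c d e f).
Proof.
move=> /type_A_model[a [b [c [d [e [f MN]]]]]].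
have [a' [c' [d' [e' [f' h]]]]] := model_eigendirection a b c d e f.
by exists a', c', d', e', f'; exact: linearly_equivalent_trans h.
Qed.

Lemma model_ricci_zero (a c d e f : R) : ricci_zero (model a 0 c d e f) <->
  [/\ d * (a - d) = 0, c * d = 0 & a * e - e * d + f * c - c ^+ 2 = 0].
Proof.
split=> [z|[h1 h2 h3] v w]; last by rewrite model_ric h1 h2 h3 !mul0r !addr0.
split.
- by have := z (vec2 1 0) (vec2 1 0); rewrite model_ric !vec2_0 !vec2_1; lra.
- by have := z (vec2 1 0) (vec2 0 1); rewrite model_ric !vec2_0 !vec2_1; lra.
- by have := z (vec2 0 1) (vec2 0 1); rewrite model_ric !vec2_0 !vec2_1; lra.
Qed.

Lemma model_nondegenerate (a c d e f : R) : ricci_nondegenerate (model a 0 c d e f) <->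
  d * (a - d) * (a * e - e * d + f * c - c ^+ 2) - (c * d) ^+ 2 != 0.
Proof.
rewrite -symmetric_form_nondegenerate; split=> nd v h; apply: nd => w.
  by rewrite model_ric h.
by rewrite -(h w) model_ric.
Qed.

(** Completeness forces l = 0 in every eigendirection. The first basis vector gives a = 0, hence d =
    0 from rho = 0; then (e, f) when c = 0, and (-e, c) when c != 0, exclude everything but c = f =
    0. *)
Lemma ricci_zero_complete M : type_A M -> ricci_zero M -> geodesically_complete (plane M) ->
  linearly_equivalent M (M0_0 R) \/ linearly_equivalent M (M0_4 R).
Proof.
move=> hM zM cM; have [a [c [d [e [f MN]]]]] := eigendirection_model hM.
have zN := ricci_zero_equivalent hM (model_type_A _ _ _ _ _ _) MN zM.
have cN := linearly_equivalent_complete (linearly_equivalent_sym MN) cM.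
have [r11 _ r22] := (model_ricci_zero a c d e f).1 zN.
have [a0|a0] := eqVneq a 0; last first.
  by case: (@ray_incomplete _ a 0 c d e f 1 0 a a0 _ _ _ cN); rewrite ?oner_eq0//; ring.
have d0 : d = 0.
  apply/eqP; rewrite -sqrf_eq0; apply/eqP; move: r11; rewrite a0; lra.
move: MN cN r22; rewrite a0 d0 => MN cN r22.
have [c0|c0] := eqVneq c 0.
  have [f0|f0] := eqVneq f 0; last first.
    case: (@ray_incomplete _ 0 0 c 0 e f e f (f ^+ 2) _ _ _ _ cN).
    - by rewrite expf_neq0.
    - by rewrite f0 orbT.
    - by rewrite c0; ring.
    - by ring.
  move: MN; rewrite c0 f0 => MN.
  have [e0|e0] := eqVneq e 0; first by left; move: MN; rewrite e0.
  right; apply: linearly_equivalent_trans MN _.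
  by apply: (@model_basis _ _ _ _ _ _ _ _ _ _ _ _ _ e 0 0 1); [rewrite !mulr1 mulr0 subr0|ring..].
have fc : f = c by apply: (mulIf c0); lra.
case: (@ray_incomplete _ 0 0 c 0 e f (- e) c (c ^+ 2) _ _ _ _ cN).
- by rewrite expf_neq0.
- by rewrite c0 orbT.
- by ring.
- by rewrite fc; ring.
Qed.

Lemma model_shear (a c e f : R) : a != 0 ->
  linearly_equivalent (model a 0 c 0 e f) (model 1 0 0 0 (a * e + f * c - c ^+ 2) f).
Proof.
move=> a0.
apply: (@model_basis _ _ _ _ _ _ _ _ _ _ _ _ _ a^-1 0 (- c / a) 1); try by [field|ring].
by rewrite mulr1 mul0r subr0 invr_eq0.
Qed.

Lemma M1_5_equivalent (g : R) : 0 < g -> linearly_equivalent (model 1 0 0 0 g 0) (M1_5 R).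
Proof.
move=> g0; have s0 : Num.sqrt g != 0 by rewrite sqrtr_eq0 -ltNge.
apply: (@model_basis _ _ _ _ _ _ _ _ _ _ _ _ _ 1 0 0 (Num.sqrt g)^-1); try by ring.
  by rewrite mul1r mul0r subr0 invr_eq0.
transitivity (g / Num.sqrt g ^+ 2); first by field.
by rewrite sqr_sqrtr ?ltW// divff ?gt_eqF//; ring.
Qed.

(** Here v . v = (v_1^2 + g v_2^2) e_1. For g < 0 this quadratic form is indefinite, and a null
    vector serves as second basis vector, which kills Gamma_22; its first component -1/2 becomes
    Gamma_12^1. *)
Lemma M1_2_equivalent (g : R) : g < 0 -> linearly_equivalent (model 1 0 0 0 g 0) (M1_2 R).
Proof.
move=> g0; have g1 : 0 < - g by rewrite oppr_gt0.
have s0 : Num.sqrt (- g) != 0 by rewrite sqrtr_eq0 -ltNge.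
apply: (@model_basis _ _ _ _ _ _ _ _ _ _ _ _ _ (-1) 0 (- 2^-1) ((Num.sqrt (- g))^-1 / 2)).
all: try by field.
  by rewrite mul0r subr0 !mulf_neq0 ?oppr_eq0 ?oner_eq0 ?invr_eq0// pnatr_eq0.
transitivity (4^-1 + g / Num.sqrt (- g) ^+ 2 / 4); first by field.
by rewrite sqr_sqrtr ?ltW//; field; rewrite lt_eqF.
Qed.

(** With y = ln t / f and X = exp x the remaining equation is Euler's, X'' + (g / f^2) t^-2 X = 0,
    whose exponents are 1/2 + i m and 1/2 - i m; the solution taken is X = sqrt t cos (m ln t). *)
Lemma oscillating_geodesic (g f m : R) : f != 0 -> 0 < m -> m ^+ 2 = g / f ^+ 2 - 4^-1 ->
  let J := `]expR (- m^-1), expR (m^-1)[%classic in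
  geodesic_on J ((fun t => vec2 (ln t / 2 + ln (cos (m * ln t))) (ln t / f)) :
    R -> plane (model 1 0 0 0 g f)) /\
  forall t, J t -> velocity (fun t => vec2 (ln t / 2 + ln (cos (m * ln t))) (ln t / f)) t =
    vec2 ((2^-1 - m * tan (m * ln t)) / t) (f^-1 / t).
Proof.
move=> f0 m0 mE J.
(* On J one has |m ln t| < 1 <= pi / 2, which keeps the cosine positive. *)
have Jt t : J t -> 0 < t /\ 0 < cos (m * ln t).
  rewrite /J/= in_itv/= => /andP[h1 h2].
  have t0 : 0 < t by exact: lt_trans (expR_gt0 _) h1.
  have l1 : - m^-1 < ln t by rewrite -[ltLHS]expRK ltr_ln ?posrE ?expR_gt0.
  have l2 : ln t < m^-1 by rewrite -[ltRHS]expRK ltr_ln ?posrE ?expR_gt0.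
  split=> //; apply: cos_gt0_pihalf.
  have p1 : 1 <= pi / 2 :> R by exact: pihalf_ge1.
  have : -1 < m * ln t by rewrite -ltr_pdivrMl// mulrN1.
  have : m * ln t < 1 by rewrite -ltr_pdivlMl// mulr1.
  by move=> ? ?; apply/andP; split; lra.
apply: (@model_geodesic _ _ _ _ _ _ _ _ _ _ _ _
  (fun t => - (2^-1 - m * tan (m * ln t)) / t ^+ 2 - m ^+ 2 * (cos (m * ln t)) ^- 2 / t ^+ 2)
  (fun t => - f^-1 / t ^+ 2)).
- exact: interval_open.
- move=> t /Jt[t0 c0]; have dl := is_derive1_ln t0; have tn : t != 0 by rewrite gt_eqF.
  have cn : cos (m * ln t) != 0 by rewrite gt_eqF.
  have di := @is_deriveV R id t _ _ tn (is_derive_id _ _).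
  have dm : is_derive t (1 : R) (fun t => m * ln t) (m / t).
    by apply: is_derive_eq; rewrite /GRing.scale/=; ring.
  have dc : is_derive t (1 : R) (fun t => cos (m * ln t)) (- sin (m * ln t) * (m / t)).
    exact: (@is_derive1_comp R (@cos R) (fun t => m * ln t) t).
  have dt : is_derive t (1 : R) (fun t => tan (m * ln t)) ((cos (m * ln t)) ^- 2 * (m / t)).
    exact: (@is_derive1_comp R (@tan R) (fun t => m * ln t) t _ _ (is_derive_tan cn)).
  have dlc : is_derive t (1 : R) (fun t => ln (cos (m * ln t)))
      ((cos (m * ln t))^-1 * (- sin (m * ln t) * (m / t))).
    exact: (@is_derive1_comp R (@ln R) (fun t => cos (m * ln t)) t _ _ (is_derive1_ln c0)).
  split; apply: is_derive_eq; rewrite /GRing.scale/= ?/tan; by [ring|field; rewrite ?tn ?cn ?f0].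
move=> t /Jt[t0 c0]; have tn : t != 0 by rewrite gt_eqF.
have cn : cos (m * ln t) != 0 by rewrite gt_eqF.
split; last by field; rewrite tn f0.
have gE : g = (m ^+ 2 + 4^-1) * f ^+ 2 by rewrite mE; field.
have tanE : (cos (m * ln t)) ^- 2 = 1 + tan (m * ln t) ^+ 2.
  exact: cos2_tan2.
rewrite tanE gE; move: (tan _) => T; by field; rewrite tn f0.
Qed.

Lemma degenerate_eigendirection M (a c d e f : R) :
  type_A M -> linearly_equivalent M (model a 0 c d e f) -> a != 0 ->
  ~ ricci_zero M -> ~ ricci_nondegenerate M ->
  [\/ linearly_equivalent M (M1_5 R), linearly_equivalent M (M1_2 R) |
      essentially_incomplete (plane M)].
Proof.
move=> hM MN a0 nz deg; have NM := linearly_equivalent_sym MN.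
have hN := model_type_A a 0 c d e f.
have [d11|d11] := eqVneq (d * (a - d)) 0; last first.
  apply: Or33; apply: (@ray_essentially_incomplete _ _ a c d e f 1 0 a MN a0).
  - by ring.
  - by ring.
  - by apply: contra_neq d11 => h; rewrite -[RHS]h; ring.
have cd : c * d = 0.
  apply/eqP/negPn/negP => h; apply: deg.
  apply: (ricci_nondegenerate_equivalent hN hM NM).
  by apply/model_nondegenerate; rewrite d11 mul0r sub0r oppr_eq0 expf_neq0.
have r22 : a * e - e * d + f * c - c ^+ 2 != 0.
  apply/eqP => h; apply: nz; apply: (ricci_zero_equivalent hN hM NM).
  exact/model_ricci_zero.
(* If d != 0, then c = 0 and a = d, and rho would vanish. So the first basis vector spans the kernel
   of rho. *)
have d0 : d = 0.
  apply/eqP/negPn/negP => d0; move/eqP: d11; move/eqP: cd.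
  rewrite !mulf_eq0 (negbTE d0) orbF /= subr_eq0 => /eqP c0 /eqP ad.
  by move/eqP: r22; apply; rewrite c0 ad; ring.
move: MN r22; rewrite d0 => MN; set g := a * e + f * c - c ^+ 2.
have -> : a * e - e * 0 + f * c - c ^+ 2 = g by rewrite /g; ring.
move=> g0; have {}MN := linearly_equivalent_trans MN (model_shear c e f a0).
rewrite -/g in MN; move: (g) g0 MN => {}g g0 MN.
have [f0|f0] := eqVneq f 0.
  move: MN; rewrite f0 => MN; move: g0; rewrite neq_lt => /orP[g0|g0].
    by apply: Or32; apply: linearly_equivalent_trans MN (M1_2_equivalent g0).
  by apply: Or31; apply: linearly_equivalent_trans MN (M1_5_equivalent g0).
(* Here rho(v, v) = g v_1 ^ 2 and (nabla_v rho)(v, v) = - 2 f g v_1 ^ 3. *)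
apply: Or33; have [fg|fg] := leP (4 * g) (f ^+ 2).
  have D0 : 0 <= f ^+ 2 - 4 * g by rewrite subr_ge0.
  have D2 := sqr_sqrtr D0.
  apply: (@ray_essentially_incomplete _ _ 1 0 0 g f ((f + Num.sqrt (f ^+ 2 - 4 * g)) / 2) 1 f MN f0).
  - by move: (Num.sqrt _) D2 => s D2; lra.
  - by ring.
  - by apply: contra_neq g0 => h; rewrite -[RHS]h; ring.
(* The directions (x, 1) are eigendirections for the roots of x^2 - f x + g = 0. There are none when
   f^2 < 4 g, and the remaining eigendirection lies in the kernel of rho; a geodesic that is not a
   ray is used instead. *)
have f2 : 0 < f ^+ 2 by rewrite lt_neqAle sqr_ge0 eq_sym sqrf_eq0 f0.
have g1 : 0 < g by lra.
have m2 : 0 < g / f ^+ 2 - 4^-1 by rewrite subr_gt0 ltr_pdivlMr//; lra.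
have m0 : 0 < Num.sqrt (g / f ^+ 2 - 4^-1) by rewrite sqrtr_gt0.
have [gs vs] := oscillating_geodesic f0 m0 (sqr_sqrtr (ltW m2)).
have J1 : `]expR (- (Num.sqrt (g / f ^+ 2 - 4^-1))^-1),
    expR ((Num.sqrt (g / f ^+ 2 - 4^-1))^-1)[%classic 1.
  by rewrite /= in_itv/= expR_lt1 expR_gt1 oppr_lt0 invr_gt0 m0.
(* The constant is (2 f g)^2 / g^3. *)
apply: (equivalent_cubic_relation (k := 4 * f ^+ 2 / g) MN _ _ _ J1 gs).
- by rewrite divr_gt0// mulr_gt0.
- exact: interval_open.
- exact: interval_is_interval.
- move=> v; rewrite (type_A_nablaRic _ _ _ _ (model_type_A _ _ _ _ _ _)) !model_ric model_product.
  by rewrite !vec2_0 !vec2_1; field; rewrite gt_eqF.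
- rewrite (vs _ J1) model_ric !vec2_0 !vec2_1 !mul0r !add0r mul1r mulr0 subr0 mulr0 addr0.
  by rewrite expr0n subr0 divr1 !mulf_neq0 ?invr_eq0.
Qed.

(** The resonant case: for f = 2 c the direction (-e, 2 c - f) collapses onto the first axis, where
    l = 0. With y = ln t / (2 c) the other equation is (t x')' = - e / (4 c^2 t), which brings a
    squared logarithm. *)
Lemma logarithmic_geodesic (c e : R) : c != 0 ->
  geodesic_on [set t | 0 < t]
    ((fun t => vec2 (- (e / (8 * c ^+ 2)) * ln t ^+ 2) (ln t / (2 * c))) :
    R -> plane (model 0 0 c 0 e (2 * c))) /\
  forall t, 0 < t ->
    velocity (fun t => vec2 (- (e / (8 * c ^+ 2)) * ln t ^+ 2) (ln t / (2 * c))) t =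
    vec2 (- (e / (4 * c ^+ 2)) * (ln t / t)) ((2 * c)^-1 / t).
Proof.
move=> c0.
apply: (@model_geodesic _ _ _ _ _ _ _ _ _ _ _ _
  (fun t => - (e / (4 * c ^+ 2)) * ((1 - ln t) / t ^+ 2)) (fun t => - (2 * c)^-1 / t ^+ 2)).
- exact: ray_open.
- move=> t /= t0; have dl := is_derive1_ln t0; have tn : t != 0 by rewrite gt_eqF.
  have di := @is_deriveV R id t _ _ tn (is_derive_id _ _).
  split; apply: is_derive_eq; rewrite /GRing.scale/=; by [ring|field; rewrite ?tn ?c0].
move=> t /= t0; have tn : t != 0 by rewrite gt_eqF.
by split; field; rewrite tn c0.
Qed.

Lemma rank1_classification M : type_A M -> ~ ricci_zero M -> ~ ricci_nondegenerate M ->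
  [\/ linearly_equivalent M (M1_3 R), linearly_equivalent M (M1_5 R),
      linearly_equivalent M (M1_2 R) | essentially_incomplete (plane M)].
Proof.
move=> hM nz deg; have [a [c [d [e [f MN]]]]] := eigendirection_model hM.
have NM := linearly_equivalent_sym MN; have hN := model_type_A a 0 c d e f.
have eigen l c' d' e' f' : linearly_equivalent M (model l 0 c' d' e' f') -> l != 0 ->
    [\/ linearly_equivalent M (M1_3 R), linearly_equivalent M (M1_5 R),
      linearly_equivalent M (M1_2 R) | essentially_incomplete (plane M)].
  move=> MN' l0; case: (degenerate_eigendirection hM MN' l0 nz deg) => h.
  - exact: Or42.
  - exact: Or43.
  - exact: Or44.
have [a0|a0] := eqVneq a 0; last exact: eigen MN a0.
move: MN NM hN; rewrite a0 => MN NM hN.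
have [d0|d0] := eqVneq d 0; last first.
  (* For a = 0 the determinant of rho is d^2 (e d - f c). *)
  have edfc : e * d = f * c.
    apply/eqP/negPn/negP => h; apply: deg; apply: (ricci_nondegenerate_equivalent hN hM NM).
    apply/model_nondegenerate.
    have -> : d * (0 - d) * (0 * e - e * d + f * c - c ^+ 2) - (c * d) ^+ 2 =
      d ^+ 2 * (e * d - f * c) by ring.
    by rewrite mulf_neq0 ?expf_neq0// subr_eq0.
  have eE : e = f * c / d by rewrite -edfc mulfK.
  (* The vector (c / d, 1) spans the kernel of rho and is an eigendirection with l = 2 c + f. *)
  have [f2c|l0] := eqVneq (2 * c + f) 0.
    have fE : f = - (2 * c) by apply/eqP; rewrite -addr_eq0 addrC f2c.
    apply: Or41; apply: linearly_equivalent_trans MN _.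
    apply: (@model_basis _ _ _ _ _ _ _ _ _ _ _ _ _ (c / d) 1 (- (2 * d)^-1) 0).
    all: try by rewrite ?eE fE; field.
    by rewrite mulr0 sub0r mul1r opprK invr_eq0 mulf_neq0// pnatr_eq0.
  have [||c' [d' [e' [f' h]]]] := @rebase_eigendirection _ 0 0 c d e f (c / d) 1 (2 * c + f) (oner_neq0 _).
  - by rewrite eE; field.
  - by field.
  - by apply: eigen l0; exact: linearly_equivalent_trans MN h.
move: MN NM hN; rewrite d0 => MN NM hN.
have r22 : f * c - c ^+ 2 != 0.
  apply/eqP => h; apply: nz; apply: (ricci_zero_equivalent hN hM NM).
  by apply/model_ricci_zero; split; [ring|ring|rewrite -[RHS]h; ring].
have c0 : c != 0 by apply: contra_neq r22 => ->; ring.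
(* The vector (-e, 2 c - f) satisfies v . v = l v with l = f (2 c - f); the two values of f for
   which l = 0 are treated first. *)
have [f2c|f2c] := eqVneq (2 * c - f) 0.
  have fE : f = 2 * c by apply/eqP; rewrite eq_sym -subr_eq0 f2c.
  move: MN; rewrite fE => MN; have [gs vs] := logarithmic_geodesic e c0.
  apply: Or44; apply: (equivalent_blow_up MN gs) => B u u0.
  (* Here rho(s', s') = c^2 y'^2 with y' = 1 / (2 c t). *)
  have [|t /andP[t0 tu] tB] := @inverse_square_unbounded R 4^-1 _ B u u0.
    by rewrite invr_eq0 pnatr_eq0.
  exists t; first by rewrite t0.
  have tn : t != 0 by rewrite gt_eqF.
  rewrite vs// model_ric !vec2_0 !vec2_1; apply: lt_le_trans tB _.
  by rewrite le_eqVlt; apply/orP; left; apply/eqP; congr `|_|; field; rewrite tn c0.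
have [f0|f0] := eqVneq f 0.
  apply: Or41; apply: linearly_equivalent_trans MN _; rewrite f0.
  apply: (@model_basis _ _ _ _ _ _ _ _ _ _ _ _ _ 1 0 (e / (4 * c ^+ 2)) (- (2 * c)^-1)).
  all: try by field.
  by rewrite mul0r subr0 mul1r oppr_eq0 invr_eq0 mulf_neq0// pnatr_eq0.
apply: Or44.
apply: (@ray_essentially_incomplete _ _ 0 c 0 e f (- e) (2 * c - f) (f * (2 * c - f)) MN).
- by rewrite mulf_neq0.
- by ring.
- by ring.
- have -> : 0 * (0 - 0) * (- e) ^+ 2 + 2 * c * 0 * (- e) * (2 * c - f) +
    (0 * e - e * 0 + f * c - c ^+ 2) * (2 * c - f) ^+ 2 =
    (f * c - c ^+ 2) * (2 * c - f) ^+ 2 by ring.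
  by rewrite mulf_neq0// expf_neq0.
Qed.

Lemma nondegenerate_eigendirection M (a c d e f : R) :
  type_A M -> linearly_equivalent M (model a 0 c d e f) -> a != 0 ->
  ricci_nondegenerate M -> essentially_incomplete (plane M).
Proof.
move=> hM MN a0 nd; have hN := model_type_A a 0 c d e f.
have := ricci_nondegenerate_equivalent hM hN MN nd; move/model_nondegenerate => D.
have [d11|d11] := eqVneq (d * (a - d)) 0; last first.
  apply: (@ray_essentially_incomplete _ _ a c d e f 1 0 a MN a0).
  - by ring.
  - by ring.
  - by apply: contra_neq d11 => h; rewrite -[RHS]h; ring.
have d0 : d != 0 by apply: contra_neq D => ->; ring.
have da : d = a.
  by move/eqP: d11; rewrite mulf_eq0 (negbTE d0) subr_eq0 => /eqP.
have hx : a * 1 ^+ 2 + 2 * c * 1 * 0 + e * 0 ^+ 2 = a * 1 by ring.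
have hy : 0 * 1 ^+ 2 + 2 * d * 1 * 0 + f * 0 ^+ 2 = a * 0 by ring.
have [gs vs] := ray_geodesic a0 hx hy.
(* Since d = a and rho(e_1, e_1) = 0, the product e_1 . w is a w plus a multiple of e_1, so
   (nabla_e1 rho)(e_1, w) = - 2 a rho(e_1, w); the velocity e_1 / (a t) leaves the factor -2. *)
have k0 : - 2 != 0 :> R by rewrite oppr_eq0 pnatr_eq0.
apply: (equivalent_isotropic_ray MN k0 gs _ _ nd) => [t w t0|t t0]; rewrite vs//.
  have tn : t != 0 by rewrite gt_eqF.
  rewrite (type_A_nablaRic _ _ _ _ hN) !model_ric !model_product !vec2_0 !vec2_1 da.
  by field; rewrite tn a0.
apply/eqP => /(congr1 (fun v : 'rV[R]_2 => v 0 0)); rewrite vec2_0 mxE => /eqP.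
by rewrite !mulf_eq0 !invr_eq0 oner_eq0 (negbTE a0) gt_eqF.
Qed.

Lemma rank2_classification M : type_A M -> ricci_nondegenerate M ->
  (exists b, linearly_equivalent M (M2_2 b)) \/ essentially_incomplete (plane M).
Proof.
move=> hM nd; have [a [c [d [e [f MN]]]]] := eigendirection_model hM.
have [a0|a0] := eqVneq a 0; last by right; exact: nondegenerate_eigendirection MN a0 nd.
move: MN; rewrite a0 => MN.
have hN := model_type_A 0 0 c d e f.
have := ricci_nondegenerate_equivalent hM hN MN nd; move/model_nondegenerate.
have -> : d * (0 - d) * (0 * e - e * d + f * c - c ^+ 2) - (c * d) ^+ 2 =
      d ^+ 2 * (e * d - f * c) by ring.
rewrite mulf_eq0 sqrf_eq0 negb_or => /andP[d0 edfc].
(* The discriminant of 2 d x^2 + (f - 2 c) x - e = 0, the equation of the eigendirections (x, 1). *)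
have [D|D] := leP 0 ((2 * c - f) ^+ 2 + 8 * d * e).
  have D2 := sqr_sqrtr D; set s := Num.sqrt _ in D2.
  pose x := (2 * c - f + s) / (4 * d).
  have xE : 2 * c * x + e = (2 * d * x + f) * x.
    apply/eqP; rewrite -subr_eq0; apply/eqP.
    transitivity (((2 * c - f) ^+ 2 + 8 * d * e - s ^+ 2) / (8 * d)); first by rewrite /x; field.
    by rewrite D2 subrr mul0r.
  (* The value l = 0 would give e d = f c, that is, a degenerate rho. *)
  have l0 : 2 * d * x + f != 0.
    apply: contra_neq edfc => l0.
    have fE : f = - (2 * d * x) by apply/eqP; rewrite -addr_eq0 addrC l0.
    have eE : e = - (2 * c * x) by apply/eqP; rewrite -addr_eq0 addrC xE l0 mul0r.
    by rewrite fE eE; ring.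
  have [||c' [d' [e' [f' h]]]] := @rebase_eigendirection _ 0 0 c d e f x 1 (2 * d * x + f) (oner_neq0 _).
  - by rewrite -xE; ring.
  - by ring.
  - by right; apply: (nondegenerate_eigendirection hM _ l0 nd); exact: linearly_equivalent_trans MN h.
left; have D' : 0 <= - ((2 * c - f) ^+ 2 + 8 * d * e) by rewrite oppr_ge0 ltW.
have D2 := sqr_sqrtr D'; set s := Num.sqrt _ in D2.
have s0 : s != 0 by rewrite -sqrf_eq0 D2 oppr_eq0 lt_eqF.
(* The first vector is scaled to get d = 1. In the second, the first component removes Gamma_22^2
   and the factor 2 / s brings the discriminant to -4, its value for every M_2^2(-1, b). *)
exists (2 / s * (c + f / 2)); apply: linearly_equivalent_trans MN _.
apply: (@model_basis _ _ _ _ _ _ _ _ _ _ _ _ _ d^-1 0 (- (2 / s) * f / (2 * d)) (2 / s)).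
all: try by field; rewrite ?d0 ?s0.
  by rewrite mul0r subr0 !mulf_neq0 ?invr_eq0// pnatr_eq0.
apply/eqP; rewrite -subr_eq0; apply/eqP.
transitivity ((s ^+ 2 + ((2 * c - f) ^+ 2 + 8 * d * e)) / (2 * d * s ^+ 2)).
  by field; rewrite d0 s0.
by rewrite D2 addNr mul0r.
Qed.

Lemma M1_5_incomplete : ~ geodesically_complete (plane (M1_5 R)).
Proof. by apply: (@ray_incomplete _ 1 0 0 0 1 0 1 0 1); rewrite ?oner_eq0//; ring. Qed.

Lemma M1_2_incomplete : ~ geodesically_complete (plane (M1_2 R)).
Proof.
by apply: (@ray_incomplete _ (-1) 0 (- 2^-1) 0 0 0 1 0 (-1)); rewrite ?oppr_eq0 ?oner_eq0//; ring.
Qed.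

End Classification.

Theorem theorem3p11 (R : realType) (M : plane_connection R) (hM : type_A M) :
  (flat M ->
    (geodesically_complete (plane M) <->
     linearly_equivalent M (M0_0 R) \/ linearly_equivalent M (M0_4 R)))
  /\
  (ricci_rank M 1 ->
    [/\ geodesically_complete (plane M) <-> linearly_equivalent M (M1_3 R),
        linearly_equivalent M (M1_5 R) ->
          ~ geodesically_complete (plane M) /\
          geodesic_completion (plane M) (plane (modelN R)),
        linearly_equivalent M (M1_2 R) ->
          ~ geodesically_complete (plane M) /\
          geodesic_completion (plane M) (plane (M1_3 R)) &
        ~ linearly_equivalent M (M1_3 R) ->
        ~ linearly_equivalent M (M1_5 R) ->
        ~ linearly_equivalent M (M1_2 R) ->
          essentially_incomplete (plane M)])
  /\
  (ricci_rank M 2 ->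
    ((exists b2 : R, linearly_equivalent M (M2_2 b2)) ->
       geodesically_complete (plane M)) /\
    (~ (exists b2 : R, linearly_equivalent M (M2_2 b2)) ->
       essentially_incomplete (plane M))).
Proof.
have incomplete N : linearly_equivalent M N -> ~ geodesically_complete (plane N) ->
    ~ geodesically_complete (plane M).
  by move=> /linearly_equivalent_sym h nN /(linearly_equivalent_complete h).
split=> [fM|].
  split; first exact: ricci_zero_complete hM (flat_ricci_zero hM fM).
  by case=> /linearly_equivalent_complete; apply; [exact: M0_0_complete|exact: M0_4_complete].
split=> [/(ricci_rank1 hM)[nz deg]|/(ricci_rank2 hM) nd].
  have cl := rank1_classification hM nz deg.
  split.
  - split=> [cM|/linearly_equivalent_complete]; last by apply; exact: M1_3_complete.
    case: cl => // [h|h|h].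
    + by case: (incomplete _ h (@M1_5_incomplete R)).
    + by case: (incomplete _ h (@M1_2_incomplete R)).
    + by case: (essentially_incomplete_incomplete hM h).
  - move=> h; split; first exact: incomplete h (@M1_5_incomplete R).
    exact: M1_5_completion.
  - move=> h; split; first exact: incomplete h (@M1_2_incomplete R).
    exact: M1_2_completion.
  - by case: cl.
split=> [[b /linearly_equivalent_complete]|nb]; first by apply; exact: M2_2_complete.
by case: (rank2_classification hM nd).
Qed.
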